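(* Let $(A,B)$ be a Weyl pair of dimension $d$ on a complex Banach space $X$. For $t>0$ put $\lambda_t=\frac{1-e^{-t}}{1+e^{-t}}$ and $a_t(x,\xi)=(1+\lambda_t)^d e^{-\lambda_t(|x|^2+|\xi|^2)}$ for $(x,\xi)\in\mathbb{R}^{2d}$. Define $P(0)=I$ and $P(t)=a_t(A,B)$ for $t>0$ (Weyl calculus). Then: (1) $(P(t))_{t\ge0}$ is a uniformly bounded $C_0$-semigroup on $X$. (2) Let $-L$ be its generator. The dense set $\mathsf{D}(A^2)\cap\mathsf{D}(B^2)$ is a core for $-L$, and on this core $L=\frac12(A^2+B^2)-\frac12 d$. (3) The semigroup $(P(t))_{t\ge0}$ extends to an analytic semigroup of angle $\frac12\pi$ that is uniformly bounded and strongly continuous on every subsector of smaller angle.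
   Context: Weyl pair: a pair $(A,B)$ of $d$-tuples $A=(A_1,\dots,A_d)$, $B=(B_1,\dots,B_d)$ of closed densely defined operators on a complex Banach space $X$ such that each $iA_j$ and $iB_j$ generates a uniformly bounded $C_0$-group, denoted $(e^{itA_j})_{t\in\mathbb{R}}$, $(e^{itB_j})_{t\in\mathbb{R}}$, and for all $s,t\in\mathbb{R}$, $1\le j,k\le d$: $e^{isA_j}e^{itA_k}=e^{itA_k}e^{isA_j}$, $e^{isB_j}e^{itB_k}=e^{itB_k}e^{isB_j}$, $e^{isA_j}e^{itB_k}=e^{-ist\delta_{jk}}e^{itB_k}e^{isA_j}$. For $u,v\in\mathbb{R}^d$: $uv=\sum_j u_jv_j$, $e^{iuA}=\prod_j e^{iu_jA_j}$, $e^{ivB}=\prod_j e^{iv_jB_j}$, $e^{i(uA+vB)}:=e^{\frac12 iuv}e^{iuA}e^{ivB}$. Weyl calculus: for $a\in\mathscr{S}(\mathbb{R}^{2d})$, $a(A,B)f=\frac{1}{(2\pi)^d}\int_{\mathbb{R}^{2d}}\widehat a(u,v)e^{i(uA+vB)}f\,du\,dv$ for $f\in X$, where $\widehat a(u,v)=\frac1{(2\pi)^d}\int_{\mathbb{R}^{2d}}a(x,\xi)e^{-i(xu+\xi v)}\,dx\,d\xi$. $A^2:=\sum_{j=1}^d A_j^2$ with domain $\mathsf{D}(A^2)=\bigcap_{j=1}^d\mathsf{D}(A_j^2)$, and $B^2:=\sum_{j=1}^d B_j^2$ with domain $\mathsf{D}(B^2)=\bigcap_{j=1}^d\mathsf{D}(B_j^2)$;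 $A^2+B^2$ is defined on $\mathsf{D}(A^2)\cap\mathsf{D}(B^2)$. *)

(* Defs.v *)
From HB Require Import structures.
From mathcomp Require Import all_boot all_order all_algebra complex.
From mathcomp Require Import all_classical all_reals all_analysis.
Set Implicit Arguments.
Unset Strict Implicit.
Unset Printing Implicit Defensive.
Import Order.TTheory GRing.Theory Num.Theory numFieldNormedType.Exports.

Local Open Scope classical_set_scope.
Local Open Scope ring_scope.
Local Open Scope complex_scope.

(* R^n is the type of n-tuples with its product (Borel) sigma-algebra.  The
   Lebesgue measure is the n-fold product of the one-dimensional one, moved
   from R x R^n to R^(n+1) by (x, t) |-> x :: t. *)

Notation rvec R n := (n.-tuple (measurableTypeR R)).

Section lebesgue_tuple.
Context {R : realType}.
Local Notation rvec n := (rvec R n).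

Definition consv n (p : measurableTypeR R * rvec n) : rvec n.+1 :=
  [tuple of p.1 :: p.2].

Lemma measurable_consv n : measurable_fun setT (@consv n).
Proof. exact: (measurable_cons measurable_fst measurable_snd). Qed.

Section step.
Context (n : nat) (mu : {sigma_finite_measure set (rvec n) -> \bar R}).

Definition lebesgue_step (A : set (rvec n.+1)) : \bar R :=
  (lebesgue_measure \x mu)%E (@consv n @^-1` A).

Let mpre (A : set (rvec n.+1)) : measurable A -> measurable (@consv n @^-1` A).
Proof. by move=> mA; rewrite -[_ @^-1` _]setTI; exact: measurable_consv. Qed.

Let lebesgue_step0 : lebesgue_step set0 = 0%E.
Proof. by rewrite /lebesgue_step preimage_set0 measure0. Qed.

Let lebesgue_step_ge0 A : (0 <= lebesgue_step A)%E.
Proof. exact: measure_ge0. Qed.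

Let lebesgue_step_sigma_additive : semi_sigma_additive lebesgue_step.
Proof.
move=> F mF tF mUF; rewrite /lebesgue_step preimage_bigcup.
apply: measure_semi_sigma_additive.
- by move=> k; exact: mpre.
- apply/trivIsetP => /= i j _ _ ij; rewrite -preimage_setI.
  by move/trivIsetP : tF => /(_ _ _ _ _ ij) ->//; rewrite preimage_set0.
- by rewrite -preimage_bigcup; exact: mpre.
Qed.

HB.instance Definition _ := isMeasure.Build _ _ _ lebesgue_step
  lebesgue_step0 lebesgue_step_ge0 lebesgue_step_sigma_additive.

Lemma lebesgue_step_sigma_finite : sigma_finite setT lebesgue_step.
Proof.
have /sigma_finiteP[F1 [T1 nd1 fin1]] := sigma_finiteT (@lebesgue_measure R).
have /sigma_finiteP[F2 [T2 nd2 fin2]] := sigma_finiteT mu.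
pose F k := F1 k `*` F2 k.
have TF : setT = \bigcup_k F k.
  apply/esym; rewrite -subTset => -[x y] _.
  have : [set: measurableTypeR R] x by [].
  have : [set: rvec n] y by [].
  rewrite T1 T2 => -[j _ Fjy] [i _ Fix]; exists (maxn i j) => //; split.
  - by move: x Fix; exact/subsetPset/nd1/leq_maxl.
  - by move: y Fjy; exact/subsetPset/nd2/leq_maxr.
have mF k : measurable (F k) /\ ((lebesgue_measure \x mu) (F k) < +oo)%E.
  have [? ?] := fin1 k; have [? ?] := fin2 k.
  split; first exact: measurableX.
  by rewrite product_measure1E// lte_mul_pinfty// ge0_fin_numE.
pose g (t : rvec n.+1) : measurableTypeR R * rvec n :=
  (thead t, [tuple of behead t]).
have Kg p : g (consv p) = p.
  by case: p => x t; apply/pair_equal_spec; split;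
    [exact: theadE | exact: val_inj].
have mg : measurable_fun setT g.
  apply: measurable_fun_pair.
  exact: measurable_tnth.
  exact: measurable_behead.
exists (fun k => g @^-1` F k).
  apply/esym; rewrite -subTset => t _.
  have : [set: measurableTypeR R * rvec n] (g t) by [].
  by rewrite TF => -[k _ Fk]; exists k.
move=> k; have [mFk Fkoo] := mF k; split.
  by rewrite -[_ @^-1` _]setTI; exact: mg.
rewrite /lebesgue_step.
suff -> : @consv n @^-1` (g @^-1` F k) = F k by [].
by apply/seteqP; split=> p /=; rewrite Kg.
Qed.

HB.instance Definition _ :=
  Measure_isSigmaFinite.Build _ _ _ lebesgue_step lebesgue_step_sigma_finite.

End step.

Fixpoint lebesgue_rvec n : {sigma_finite_measure set (rvec n) -> \bar R} :=
  match n with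
  | 0 => \d_([tuple] : rvec 0)
  | n'.+1 => lebesgue_step (lebesgue_rvec n')
  end.

End lebesgue_tuple.

Lemma lebesgue_rvec_box {R : realType} n (A : 'I_n -> set (measurableTypeR R)) :
  (forall i, measurable (A i)) ->
  lebesgue_rvec n [set t | forall i, A i (tnth t i)] =
  (\prod_(i < n) lebesgue_measure (A i))%E.
Proof.
elim: n A => [|n IH] A mA.
  by rewrite big_ord0 /= diracE mem_set//= => -[].
rewrite big_ord_recl /= /lebesgue_step.
have mbox : measurable [set t : rvec R n | forall i, A (lift ord0 i) (tnth t i)].
  rewrite (_ : [set _ | _] = \bigcap_(i in [set: 'I_n])
      ((fun t : rvec R n => tnth t i) @^-1` A (lift ord0 i))).
    apply: fin_bigcap_measurable => // i _; rewrite -[_ @^-1` _]setTI.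
    exact: measurable_tnth.
  by apply/seteqP; split=> t /= H i; [move=> _; exact: H | exact: H i I].
rewrite (_ : _ @^-1` _ =
    A ord0 `*` [set t | forall i, A (lift ord0 i) (tnth t i)]).
  by rewrite product_measure1E//; congr (_ * _)%E; exact: IH.
apply/seteqP; split=> -[x t] /=.
  move=> H; split; first by have := H ord0.
  by move=> i; have := H (lift ord0 i); rewrite tnthS.
move=> [A0 At] i; have [->//|i0] := eqVneq i ord0.
have [j ->] : exists j, i = lift ord0 j.
  by case: (unliftP ord0 i) i0 => [j ->|-> /eqP//] _; exists j.
by rewrite tnthS.
Qed.

Section bochner.
Context {R : realType} {X : normedModType R[i]}.
Context {disp : measure_display} {T : measurableType disp}.
Variable mu : {measure set T -> \bar R}.

(* Norms in a normed space over R[i] are R[i]-valued. *)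
Definition rnorm (x : X) : R := complex.Re `|x|.

Record step_fun := StepFun {
  step_size : nat;
  step_set : 'I_step_size -> set T;
  step_val : 'I_step_size -> X;
  step_measurable : forall i, measurable (step_set i);
  step_finite : forall i, (mu (step_set i) < +oo)%E
}.

Definition step_app (s : step_fun) (x : T) : X :=
  \sum_(i < step_size s) (\1_(step_set i) x : R)%:C *: step_val i.

Definition step_integral (s : step_fun) : X :=
  \sum_(i < step_size s) (fine (mu (step_set i)))%:C *: step_val i.

Definition strongly_measurable (F : T -> X) :=
  exists s : nat -> step_fun,
    {ae mu, forall x, step_app (s n) x @[n --> \oo] --> F x}.

(* Strong measurability is a separate clause because the library integral of a
   nonnegative non-measurable function is only a lower integral. *)
Definition is_bochner (F : T -> X) (y : X) :=
  strongly_measurable F /\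
  exists s : nat -> step_fun,
    (\int[mu]_x (rnorm (F x - step_app (s n) x))%:E)%E @[n --> \oo] --> 0%E /\
    step_integral (s n) @[n --> \oo] --> y.

Definition bochner (F : T -> X) : X := xget 0 [set y | is_bochner F y].

End bochner.

Section operators.
Context {R : realType} {X : completeNormedModType R[i]}.
Implicit Types (G H : set (X * X)) (D : set X).

Definition is_operator G :=
  [/\ G (0, 0),
      forall (c : R[i]) p q, G p -> G q -> G (c *: p + q)
    & forall f g h, G (f, g) -> G (f, h) -> g = h].

Definition op_dom G : set X := [set f | exists g, G (f, g)].

Definition closed_densely_defined G :=
  [/\ is_operator G, closed G & dense (op_dom G)].

Definition op_id : set (X * X) := [set p | p.2 = p.1].

Definition op_scale (c : R[i]) G : set (X * X) :=
  [set p | exists2 g, G (p.1, g) & p.2 = c *: g].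

Definition op_opp G : set (X * X) := op_scale (-1) G.

Definition op_add G H : set (X * X) :=
  [set p | exists g h, [/\ G (p.1, g), H (p.1, h) & p.2 = g + h]].

Definition op_sqr G : set (X * X) :=
  [set p | exists2 g, G (p.1, g) & G (g, p.2)].

Definition op_sum n (G : 'I_n -> set (X * X)) : set (X * X) :=
  [set p | exists2 g : 'I_n -> X,
    forall j, G j (p.1, g j) & p.2 = \sum_(j < n) g j].

Definition op_sum_sqr n (G : 'I_n -> set (X * X)) : set (X * X) :=
  op_sum (fun j => op_sqr (G j)).

Definition op_restrict G D : set (X * X) := G `&` [set p | D p.1].

Definition is_subspace D :=
  D 0 /\ forall (c : R[i]) f g, D f -> D g -> D (c *: f + g).

(* The product topology on X * X is the graph-norm topology on the graph of G. *)
Definition is_core D G :=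
  [/\ is_subspace D, D `<=` op_dom G & G `<=` closure (op_restrict G D)].

End operators.

Section semigroups.
Context {R : realType} {X : completeNormedModType R[i]}.

Definition bounded_linear (T : X -> X) :=
  linear T /\ exists M : R, forall f, `|T f| <= M%:C * `|f|.

Definition uniformly_bounded_on I (S : set I) (T : I -> X -> X) :=
  exists M : R, forall t f, S t -> `|T t f| <= M%:C * `|f|.

Definition C0_group (T : R -> X -> X) :=
  [/\ forall t, bounded_linear (T t),
      forall f, T 0 f = f,
      forall s t f, T (s + t) f = T s (T t f)
    & forall f, T t f @[t --> (0 : R)] --> f].

Definition bounded_C0_group (T : R -> X -> X) :=
  C0_group T /\ uniformly_bounded_on setT T.

Definition group_generator (T : R -> X -> X) : set (X * X) :=
  [set p | (t^-1)%:C *: (T t p.1 - p.1) @[t --> (0 : R)^'] --> p.2].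

Definition C0_semigroup (T : R -> X -> X) :=
  [/\ forall t, 0 <= t -> bounded_linear (T t),
      forall f, T 0 f = f,
      forall s t f, 0 <= s -> 0 <= t -> T (s + t) f = T s (T t f)
    & forall f, T t f @[t --> (0 : R)^'+] --> f].

Definition bounded_C0_semigroup (T : R -> X -> X) :=
  C0_semigroup T /\ uniformly_bounded_on [set t | 0 <= t] T.

Definition generator (T : R -> X -> X) : set (X * X) :=
  [set p | (t^-1)%:C *: (T t p.1 - p.1) @[t --> (0 : R)^'+] --> p.2].

Definition cis (theta : R) : R[i] := cos theta +i* sin theta.

Definition sector (theta : R) : set R[i]^o :=
  [set z | exists r phi : R, [/\ 0 < r, `|phi| < theta & z = r%:C * cis phi]].

(* Analyticity is strong analyticity: every orbit is complex differentiable. *)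
Definition analytic_semigroup (theta : R) (Q : R[i]^o -> X -> X) :=
  [/\ forall z, sector theta z -> bounded_linear (Q z),
      forall f, Q 0 f = f,
      forall z w f, sector theta z -> sector theta w ->
        Q (z + w) f = Q z (Q w f)
    & forall f z, sector theta z -> derivable (fun w => Q w f) z 1].

Definition strongly_continuous_on (S : set R[i]^o) (Q : R[i]^o -> X -> X) :=
  forall f, {within S, continuous (fun z => Q z f)}.

Definition extends_to_analytic_semigroup (theta : R) (T : R -> X -> X) :=
  exists Q : R[i]^o -> X -> X,
    [/\ analytic_semigroup theta Q,
        forall t f, 0 <= t -> Q t%:C f = T t f
      & forall eta, 0 < eta < theta ->
          uniformly_bounded_on (sector eta) Q /\
          strongly_continuous_on (sector eta `|` [set 0]) Q].

End semigroups.

Section weyl.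
Context {R : realType} {X : completeNormedModType R[i]} {d : nat}.

(* EA j t and EB j t stand for e^(itA_j) and e^(itB_j); they are determined by
   A and B, a C_0-group being determined by its generator. *)
Record weyl_pair (A B : 'I_d -> set (X * X)) (EA EB : 'I_d -> R -> X -> X) :
    Prop := WeylPair {
  weyl_closedA : forall j, closed_densely_defined (A j);
  weyl_closedB : forall j, closed_densely_defined (B j);
  weyl_groupA : forall j, bounded_C0_group (EA j);
  weyl_groupB : forall j, bounded_C0_group (EB j);
  weyl_genA : forall j, group_generator (EA j) = op_scale 'i (A j);
  weyl_genB : forall j, group_generator (EB j) = op_scale 'i (B j);
  weyl_commA : forall j k s t f, EA j s (EA k t f) = EA k t (EA j s f);
  weyl_commB : forall j k s t f, EB j s (EB k t f) = EB k t (EB j s f);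
  weyl_commAB : forall j k s t f,
    EA j s (EB k t f) = cis (- (s * t * (j == k)%:R)) *: EB k t (EA j s f)
}.

Definition dotv (u v : rvec R d) : R := \sum_(j < d) tnth u j * tnth v j.

Definition exp_prod (E : 'I_d -> R -> X -> X) (u : rvec R d) : X -> X :=
  \big[(fun S T => S \o T)/id]_(j < d) E j (tnth u j).

Variables EA EB : 'I_d -> R -> X -> X.

Definition weyl_exp (u v : rvec R d) (f : X) : X :=
  cis (2^-1 * dotv u v) *: exp_prod EA u (exp_prod EB v f).

Definition lebesgue2 : set (rvec R d * rvec R d) -> \bar R :=
  (lebesgue_rvec d \x lebesgue_rvec d)%E.

HB.instance Definition _ := Measure.on lebesgue2.

Definition complex_integral (F : rvec R d * rvec R d -> R[i]) : R[i] :=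
  (\int[lebesgue2]_p complex.Re (F p)) +i* (\int[lebesgue2]_p complex.Im (F p)).

Definition fourier (a : rvec R d -> rvec R d -> R[i]) (u v : rvec R d) : R[i] :=
  ((2 * pi) ^- d)%:C *
  complex_integral
    (fun p => a p.1 p.2 * cis (- (dotv p.1 u + dotv p.2 v))).

(* Total in a; meaningful when a is a Schwartz function. *)
Definition weyl_calculus (a : rvec R d -> rvec R d -> R[i]) (f : X) : X :=
  ((2 * pi) ^- d)%:C *:
  bochner lebesgue2 (fun p => fourier a p.1 p.2 *: weyl_exp p.1 p.2 f).

Definition weyl_lambda (t : R) : R := (1 - expR (- t)) / (1 + expR (- t)).

Definition weyl_symbol (t : R) (x xi : rvec R d) : R[i] :=
  ((1 + weyl_lambda t) ^+ d *
   expR (- (weyl_lambda t * (dotv x x + dotv xi xi))))%:C.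

Definition weyl_semigroup (t : R) : X -> X :=
  if 0 < t then weyl_calculus (weyl_symbol t) else id.

End weyl.

(* Main.v *)
From HB Require Import structures.
Require Import Defs.
From mathcomp Require Import all_boot all_order all_algebra complex.
From mathcomp Require Import all_classical all_reals all_analysis.
From mathcomp Require Import measurable_realfun.
From mathcomp Require Import ring lra zify.
Set Implicit Arguments.
Unset Strict Implicit.
Unset Printing Implicit Defensive.
Import Order.TTheory GRing.Theory Num.Theory numFieldNormedType.Exports.
Local Open Scope classical_set_scope.
Local Open Scope ring_scope.
Local Open Scope complex_scope.

(* For Re z > 0 put q = e^(-z), r = 1/(1 - q), a = r/2 - 1/4.  The Fourier
   transform of a Gaussian turns the Weyl calculus of the symbol into
     Q(z) f = (r/(2 pi))^d int e^(-a |p|^2) W(p) f dp,   W(u, v) = e^(i(uA + vB)),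
   which makes sense for complex z.  Moving e^(isA_j) or e^(isB_j) into the
   integral only translates p and multiplies by a phase, so differentiating at
   s = 0 computes A_j^2 Q(z) and Q(z) A_j^2; summing over j gives Q' = -LQ on X
   and Q' = -QL on D = D(A^2) cap D(B^2).  Hence Q(z + sw) Q(w - sw) f has zero
   derivative in s, which is the semigroup law.  The norm of Q(z) is at most a
   constant times (2 |1 - q| / (1 - |q|^2))^d, which is bounded on sectors, and
   Q(t) f -> f is the usual approximate identity argument.  Since Q(t) maps X
   into D and commutes with the generator, D is a dense core. *)

(** The numbers [r] and [a] come from the symbol: for [lam = (1 - q)/(1 + q)] the transform of
    [e^(-lam |.|^2)] is [(2 lam)^(-d) e^(-|p|^2/(4 lam))], and [(1 + lam)/(2 lam) = r],
    [1/(4 lam) = r/2 - 1/4 = a]. The differential equation rests on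
    [4 a^2 - 1/4 = r^2 - r = - 2 a']: up to a constant term, the squares of the [2d] operators put a
    multiple of [(4 a^2 - 1/4) |p|^2] under the integral, and differentiating the Gaussian in [z]
    gives the same weight. The kernel degenerates at [z = 0], so the equation is available only for
    [Re z > 0]. The path in the semigroup law therefore stops short of its endpoint, and the value
    at [0] is recovered from strong continuity, proved on the real axis and carried to sectors
    through [D]. [bochner] is a choice of value, so every integral needs an existence proof. The
    integrands are continuous with Gaussian decay; step functions on ever finer and larger grids
    converge to them, and scalar dominated convergence together with completeness of [X] gives the
    integral. The unbounded operators are graphs and enter through derivatives at [0] of their
    groups. *)

Section module_equations.
Context {K : comNzRingType} {V : lmodType K}.

(** Reflection of linear expressions over a list of atoms: an equation in the module reduces to one
    equation of scalars per atom. *)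
Inductive lexp : Type :=
  | LVar of nat | LZero | LAdd of lexp & lexp | LOpp of lexp | LScale of K & lexp.

Fixpoint leval (s : seq V) (e : lexp) : V :=
  match e with
  | LVar n => nth 0 s n
  | LZero => 0
  | LAdd a b => leval s a + leval s b
  | LOpp a => - leval s a
  | LScale c a => c *: leval s a
  end.

Fixpoint lcoef (e : lexp) (i : nat) : K :=
  match e with
  | LVar n => if eqn n i then 1 else 0
  | LZero => 0
  | LAdd a b => lcoef a i + lcoef b i
  | LOpp a => - lcoef a i
  | LScale c a => c * lcoef a i
  end.

(** A nested conjunction instead of a quantifier over indices, so that it computes to a list of
    separate goals for [ring]. *)
Fixpoint lcoef_eq (a b : lexp) (n : nat) : Prop :=
  match n with
  | 0 => True
  | n'.+1 => lcoef a n' = lcoef b n' /\ lcoef_eq a b n'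
  end.

Lemma leval_coef s e : leval s e = \sum_(i < size s) lcoef e i *: nth 0 s i.
Proof.
elim: e => [n| |a IHa b IHb|a IHa|c a IHa] /=; rewrite ?IHa ?IHb.
- have [ns|ns] := ltnP n (size s); last first.
    rewrite nth_default // big1 // => i _; case: eqnP => [ni|]; last by rewrite scale0r.
    by move: (ltn_ord i); rewrite -ni ltnNge ns.
  rewrite (bigD1 (Ordinal ns)) //= -[eqn n n]/(n == n) eqxx scale1r big1 ?addr0 // => i /eqP ni.
  by case: eqnP => [e|]; rewrite ?scale0r //; case: ni; apply: val_inj.
- by rewrite big1 // => i _; rewrite scale0r.
- by rewrite -big_split /=; apply: eq_bigr => i _; rewrite scalerDl.
- by rewrite -sumrN; apply: eq_bigr => i _; rewrite scaleNr.
- by rewrite scaler_sumr; apply: eq_bigr => i _; rewrite scalerA.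
Qed.

Lemma leval_eq s a b : lcoef_eq a b (size s) -> leval s a = leval s b.
Proof.
rewrite !leval_coef; set n := size s => h; apply: eq_bigr => i _; congr (_ *: _).
elim: n h i => [|n IH] /= => [_ []//|[h1 h2] i].
have := ltn_ord i; rewrite ltnS leq_eqVlt => /predU1P[->//|ni].
exact: (IH h2 (Ordinal ni)).
Qed.

End module_equations.

Ltac linx_index x s :=
  lazymatch s with
  | x :: _ => constr:(0%N)
  | _ :: ?s' => let n := linx_index x s' in constr:(n.+1)
  end.
(** The inner [match] backtracks: [linx_index] fails on an atom that is not yet listed, and the
    second branch then adds it. *)
Ltac linx_atoms e s :=
  lazymatch e with
  | (?a + ?b)%R => let s1 := linx_atoms a s in linx_atoms b s1
  | (- ?a)%R => linx_atoms a s
  | 0%R => s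
  | (?c *: ?a)%R => linx_atoms a s
  | ?x => match s with
          | _ => let n := linx_index x s in s
          | _ => constr:(x :: s)
          end
  end.
Ltac linx_reify K e s :=
  lazymatch e with
  | (?a + ?b)%R => let a' := linx_reify K a s in let b' := linx_reify K b s in
                   constr:(@LAdd K a' b')
  | (- ?a)%R => let a' := linx_reify K a s in constr:(@LOpp K a')
  | 0%R => constr:(@LZero K)
  | (?c *: ?a)%R => let a' := linx_reify K a s in constr:(@LScale K c a')
  | ?x => let n := linx_index x s in constr:(@LVar K n)
  end.
(* Decides equations of a module over a commutative ring, up to ring equations
   between the coefficients. *)
Ltac linx K :=
  lazymatch goal with
  | |- @eq ?V ?a ?b =>
    let s0 := linx_atoms a (@nil V) in
    let s := linx_atoms b s0 in
    let a' := linx_reify K a s in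
    let b' := linx_reify K b s in
    refine (@leval_eq K _ s a' b' _); cbn [lcoef lcoef_eq size eqn]; repeat split; try ring
  end.

Section linear_maps.
Context {K : comNzRingType} {U V : lmodType K} (f : U -> V) (lf : linear f).

Lemma linr0 : f 0 = 0.
Proof. by have := lf (-1) 0 0; rewrite scaler0 addr0 scaleN1r addNr. Qed.
Lemma linrZ c x : f (c *: x) = c *: f x.
Proof. by have := lf c x 0; rewrite linr0 !addr0. Qed.
Lemma linrD x y : f (x + y) = f x + f y.
Proof. by have := lf 1 x y; rewrite !scale1r. Qed.
Lemma linrN x : f (- x) = - f x.
Proof. by rewrite -scaleN1r linrZ scaleN1r. Qed.
Lemma linrB x y : f (x - y) = f x - f y.
Proof. by rewrite linrD linrN. Qed.
Lemma linr_sum (I : Type) (s : seq I) (P : pred I) (F : I -> U) :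
  f (\sum_(i <- s | P i) F i) = \sum_(i <- s | P i) f (F i).
Proof. by elim/big_rec2: _ => [|i u v _ <-]; rewrite ?linr0 ?linrD. Qed.

End linear_maps.

(** * Real-valued norms and the complex exponential *)

Section real_norm.
Context {R : realType} {X : normedModType R[i]}.
Implicit Types (x y : X).

Lemma rnormE x : `|x| = (rnorm x)%:C.
Proof.
by rewrite /rnorm; have := normr_ge0 x; case: `|x| => a b; rewrite lecE /= => /andP[/eqP -> _].
Qed.

Lemma ler_rC (a b : R) : (a%:C <= b%:C) = (a <= b).
Proof. by rewrite lecE /= eqxx. Qed.

Lemma ltr_rC (a b : R) : (a%:C < b%:C) = (a < b).
Proof. by rewrite ltcE /= eqxx. Qed.

Lemma rC_inj : injective (fun a : R => a%:C).
Proof. by move=> a b []. Qed.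

Lemma rnorm_ge0 x : 0 <= rnorm x.
Proof. by rewrite -ler_rC -rnormE normr_ge0. Qed.

Lemma rnorm0 : rnorm (0 : X) = 0.
Proof. by rewrite /rnorm normr0. Qed.

Lemma rnorm_eq0 x : rnorm x = 0 -> x = 0.
Proof. by move=> h; apply/eqP; rewrite -normr_eq0 rnormE h. Qed.

Lemma rnormD x y : rnorm (x + y) <= rnorm x + rnorm y.
Proof. by rewrite -ler_rC [(_ + _)%:C]rmorphD /= -!rnormE ler_normD. Qed.

Lemma rnormN x : rnorm (- x) = rnorm x.
Proof. by rewrite /rnorm normrN. Qed.

Lemma rnormB x y : rnorm (x - y) <= rnorm x + rnorm y.
Proof. by rewrite -(rnormN y) rnormD. Qed.

Lemma rdistC x y : rnorm (x - y) = rnorm (y - x).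
Proof. by rewrite -rnormN opprB. Qed.

Lemma rdistD y x z : rnorm (x - z) <= rnorm (x - y) + rnorm (y - z).
Proof. by rewrite (le_trans _ (rnormD _ _)) // addrA subrK. Qed.

Lemma rdist_dist x y : `|rnorm x - rnorm y| <= rnorm (x - y).
Proof.
have h (a b : X) : rnorm a - rnorm b <= rnorm (a - b) by rewrite lerBlDr -{1}(subrK b a); exact: rnormD.
by rewrite ler_norml h andbT lerNl opprB rdistC h.
Qed.

Lemma ler_rnormC (T : X) (M : R) (a : X) :
  (`|T| <= M%:C * `|a|) = (rnorm T <= M * rnorm a).
Proof. by rewrite !rnormE -[M%:C * _]rmorphM ler_rC. Qed.

(** Turns limits in [X], where norms and tolerances are elements of [R[i]], into limits of real
    functions, for which the order is total. *)
Lemma rnorm_cvgP (T : Type) (F : set_system T) {FF : Filter F} (f : T -> X) (y : X) :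
  (f @ F --> y) <-> ((fun t => rnorm (f t - y)) @ F --> (0 : R)).
Proof.
split=> h.
- apply/cvgrPdist_le => /= e e0.
  have e0' : 0 < e%:C :> R[i] by rewrite ltr_rC.
  have := (@cvgrPdist_le _ _ _ F FF f y).1 h _ e0'; apply: filterS => t.
  by rewrite rnormE ler_rC sub0r normrN ger0_norm ?rnorm_ge0 // rdistC.
- apply/cvgrPdist_le => /= e e0.
  (* A positive element of [R[i]] has imaginary part zero, so the tolerance is real. *)
  have [r er] : exists r, e = r%:C.
    by exists (complex.Re e); move: e0; case: (e) => a b; rewrite ltcE /= => /andP[/eqP -> _].
  rewrite {}er in e0 *; rewrite ltr_rC in e0.
  have := (@cvgrPdist_le _ _ _ F FF _ (0 : R)).1 h _ e0; apply: filterS => t.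
  by rewrite rnormE ler_rC sub0r normrN ger0_norm ?rnorm_ge0 // rdistC.
Qed.

End real_norm.

Definition cabs {R : realType} (c : R[i]) : R := rnorm (c : R[i]^o).

Section complex_abs.
Context {R : realType}.
Implicit Types (c z w : R[i]) (x y : R).

Lemma cabsE c : `|c| = (cabs c)%:C.
Proof. exact: (@rnormE R R[i]^o c). Qed.

Lemma rnormZ {X : normedModType R[i]} c (x : X) : rnorm (c *: x) = cabs c * rnorm x.
Proof. by apply: rC_inj; rewrite [RHS]rmorphM /= -!rnormE normrZ cabsE. Qed.

Lemma cabs_def c : cabs c = Num.sqrt (complex.Re c ^+ 2 + complex.Im c ^+ 2).
Proof. by apply: rC_inj; rewrite -cabsE normc_def. Qed.

Lemma cabs_ge0 c : 0 <= cabs c. Proof. exact: rnorm_ge0. Qed.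
Lemma cabs0 : cabs (0 : R[i]) = 0. Proof. exact: rnorm0. Qed.
Lemma cabs_eq0 c : cabs c = 0 -> c = 0. Proof. exact: rnorm_eq0. Qed.
Lemma cabsD c z : cabs (c + z) <= cabs c + cabs z. Proof. exact: rnormD. Qed.
Lemma cabsN c : cabs (- c) = cabs c. Proof. exact: rnormN. Qed.
Lemma cabsM c z : cabs (c * z) = cabs c * cabs z. Proof. exact: (@rnormZ R[i]^o). Qed.
Lemma cabs1 : cabs (1 : R[i]) = 1. Proof. by apply: rC_inj; rewrite -cabsE normr1. Qed.
Lemma cabs_real x : cabs x%:C = `|x|.
Proof. by rewrite cabs_def /= expr0n /= addr0 sqrtr_sqr. Qed.
Lemma cabsi : cabs ('i : R[i]) = 1.
Proof. by rewrite cabs_def /= expr0n /= add0r expr1n sqrtr1. Qed.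
Lemma cabsX c n : cabs (c ^+ n) = cabs c ^+ n.
Proof. by elim: n => [|n IH]; rewrite ?expr0 ?cabs1 // !exprS cabsM IH. Qed.
Lemma cabs_gt0 c : (0 < cabs c) = (c != 0).
Proof.
rewrite lt_neqAle cabs_ge0 andbT; congr (~~ _); apply/eqP/eqP => [/esym/cabs_eq0//|->].
by rewrite cabs0.
Qed.
Lemma cabsV c : cabs c^-1 = (cabs c)^-1.
Proof.
have [->|c0] := eqVneq c 0; first by rewrite invr0 cabs0 invr0.
have h : cabs c * cabs c^-1 = 1 by rewrite -cabsM divff // cabs1.
have c0' : cabs c != 0 by rewrite gt_eqF // cabs_gt0.
by apply: (mulfI c0'); rewrite h divff.
Qed.

Lemma cabs_sqr c : cabs c ^+ 2 = complex.Re c ^+ 2 + complex.Im c ^+ 2.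
Proof. by rewrite cabs_def sqr_sqrtr // addr_ge0 // sqr_ge0. Qed.

Lemma Re_le_cabs c : `|complex.Re c| <= cabs c.
Proof.
by rewrite cabs_def -sqrtr_sqr ler_sqrt ?lerDl ?sqr_ge0 // addr_ge0 // sqr_ge0.
Qed.

Lemma Im_le_cabs c : `|complex.Im c| <= cabs c.
Proof.
by rewrite cabs_def -sqrtr_sqr ler_sqrt ?lerDr ?sqr_ge0 // addr_ge0 // sqr_ge0.
Qed.

Lemma cabs_le c : cabs c <= `|complex.Re c| + `|complex.Im c|.
Proof.
case: c => x y /=; have -> : x +i* y = x%:C + y%:C * 'i.
  by apply/eqP; rewrite eq_complex /= !(mulr0, mulr1, addr0, subr0, add0r) !eqxx.
by rewrite (le_trans (cabsD _ _)) // cabsM cabsi mulr1 !cabs_real.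
Qed.

Definition cexp z : R[i] := (expR (complex.Re z))%:C * cis (complex.Im z).

Lemma cisD x y : cis (x + y) = cis x * cis y.
Proof. by rewrite /cis cosD sinD; apply/eqP; rewrite eq_complex /= !eqxx addrC eqxx. Qed.

Lemma cis0 : cis (0 : R) = 1.
Proof. by rewrite /cis cos0 sin0. Qed.

Lemma cabs_cis x : cabs (cis x) = 1.
Proof. by rewrite cabs_def /= cos2Dsin2 sqrtr1. Qed.

Lemma cexpD z w : cexp (z + w) = cexp z * cexp w.
Proof.
rewrite /cexp !raddfD /= expRD cisD rmorphM /=.
by rewrite mulrACA.
Qed.

Lemma cexp0 : cexp 0 = 1.
Proof. by rewrite /cexp /= expR0 cis0 mul1r. Qed.

Lemma cabs_cexp z : cabs (cexp z) = expR (complex.Re z).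
Proof. by rewrite /cexp cabsM cabs_cis mulr1 cabs_real ger0_norm // expR_ge0. Qed.

Lemma cexp_real x : cexp x%:C = (expR x)%:C.
Proof. by rewrite /cexp /= cis0 mulr1. Qed.

Lemma cisE x : cis x = cexp (x%:C * 'i).
Proof.
rewrite /cexp (_ : x%:C * 'i = 0 +i* x) /= ?expR0 ?mul1r //.
by apply/eqP; rewrite eq_complex /=; apply/andP; split; apply/eqP; ring.
Qed.

Lemma expR_sub1 x : `|expR x - 1| <= `|x| * expR `|x|.
Proof.
have h1 := expR_ge1Dx x; have h2 := expR_ge1Dx (- x).
have [x0|x0] := leP 0 x.
- rewrite (ger0_norm x0) ger0_norm; last by lra.
  have := expRxMexpNx_1 x; have := expR_gt0 x; nra.
- rewrite ler0_norm; last by rewrite subr_le0 expR_le1 ltW.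
  rewrite (ltr0_norm x0); have : 1 <= expR (- x) by lra. 
  nra.
Qed.

Lemma expR_sub1x x : `|expR x - 1 - x| <= x ^+ 2 * expR `|x|.
Proof.
have h1 := expR_ge1Dx x; have h2 := expR_ge1Dx (- x).
rewrite ger0_norm; last by lra.
have := expRxMexpNx_1 x; have := expR_gt0 x.
have [x0|x0] := leP 0 x.
- rewrite (ger0_norm x0) => e0 e1.
  have h3 : expR x - 1 <= x * expR x by nra.
  have : x * (expR x - 1) <= x * (x * expR x) by rewrite ler_wpM2l.
  nra.
- rewrite (ltr0_norm x0) => e0 e1.
  have h3 : expR x - 1 - x <= x ^+ 2 by nra.
  have : x^+2 * 1 <= x ^+ 2 * expR (- x) by rewrite ler_wpM2l ?sqr_ge0 //; lra.
  lra.
Qed.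

Lemma sin_le_ge0 x : 0 <= x -> sin x <= x.
Proof.
rewrite le_eqVlt => /predU1P[<-|x0]; first by rewrite sin0.
have [c _] := @MVT R sin cos 0 x x0 (fun y _ => is_derive_sin y)
  (@continuous_subspaceT _ _ _ _ (@continuous_sin R)).
rewrite sin0 !subr0 => ->; have := cos_le1 c; nra.
Qed.

Lemma sin_abs_le x : `|sin x| <= `|x|.
Proof.
wlog x0 : x / 0 <= x => [h|].
  have [/h//|/ltW x0] := leP 0 x.
  by rewrite -(normrN x) -(normrN (sin x)) -sinN h // oppr_ge0.
rewrite (ger0_norm x0).
have [hx|hx] := leP x 1.
  rewrite ger0_norm ?sin_le_ge0 // sin_ge0_pi //.
  have : 1 <= pi / 2 :> R by have := @pi_ge2 R; lra.
  move=> hp; rewrite x0 /=; lra.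
by rewrite (le_trans (sin_max _)) // ltW.
Qed.

Lemma cos_sub1 x : 1 - cos x <= x ^+ 2 / 2 /\ 1 - cos x <= `|x|.
Proof.
have e : 1 - cos x = 2 * sin (x / 2) ^+ 2.
  have -> : cos x = cos (x / 2 + x / 2) by congr cos; lra.
  by rewrite cosD; have := cos2Dsin2 (x / 2); rewrite !expr2; lra.
have h := sin_abs_le (x / 2); rewrite normrM [`|2^-1|]ger0_norm // in h.
have h0 := normr_ge0 (sin (x / 2)); have h1 := sin_max (x / 2).
have -> : x ^+ 2 = `|x| ^+ 2 by rewrite real_normK // num_real.
have e2 : sin (x / 2) ^+ 2 = `|sin (x / 2)| ^+ 2 by rewrite real_normK // num_real.
by rewrite e e2; split; nra.
Qed.

Lemma sin_subx x : `|sin x - x| <= x ^+ 2.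
Proof.
wlog x0 : x / 0 <= x => [h|].
  have [/h//|/ltW x0] := leP 0 x.
  by rewrite -sqrrN -normrN opprD -sinN h // oppr_ge0.
move: x0; rewrite le_eqVlt => /predU1P[<-|x0]; first by rewrite sin0 subrr normr0 expr0n.
have [c] := @MVT R sin cos 0 x x0 (fun y _ => is_derive_sin y)
  (@continuous_subspaceT _ _ _ _ (@continuous_sin R)).
rewrite in_itv /= => /andP[c0 cx]; rewrite sin0 !subr0 => ->.
have [_] := cos_sub1 c; rewrite (gtr0_norm c0) => h; have h1 := cos_le1 c.
by rewrite ler0_norm; nra.
Qed.

Lemma cis_sub1 x : cabs (cis x - 1) <= 2 * `|x|.
Proof.
rewrite (le_trans (cabs_le _)) //= subr0 mulr_natl mulr2n lerD ?sin_abs_le //.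
by rewrite distrC ger0_norm ?subr_ge0 ?cos_le1 // (cos_sub1 x).2.
Qed.

(** This quadratic remainder is the source of all derivatives below: it gives the derivative of
    [cexp] and bounds the integrand when differentiating under the integral sign. *)
Lemma cexp_sub1z z : cabs (cexp z - 1 - z) <= 3 * cabs z ^+ 2 * expR (cabs z).
Proof.
case: z => x y; set m := cabs (x +i* y).
have hx : `|x| <= m := Re_le_cabs (x +i* y).
have hy : `|y| <= m := Im_le_cabs (x +i* y).
(* Three quadratic pieces: the remainder of the real exponential, a mixed product, and the remainder
   of [cis]. *)
have e : cexp (x +i* y) - 1 - (x +i* y) =
   (expR x - 1 - x)%:C + (expR x - 1)%:C * (y%:C * 'i) + (expR x)%:C * ((cos y - 1) +i* (sin y - y)).
  by rewrite /cexp /cis; apply/eqP; rewrite eq_complex /=; apply/andP; split; apply/eqP; ring.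
rewrite {}e.
rewrite (le_trans (cabsD _ _)) // (le_trans (lerD (cabsD _ _) (lexx _))) //.
rewrite !cabsM !cabs_real cabsi mulr1 (ger0_norm (expR_ge0 x)).
have h1 := expR_sub1x x; have h2 := expR_sub1 x.
have h3 : cabs ((cos y - 1) +i* (sin y - y)) <= 2 * y ^+ 2.
  rewrite (le_trans (cabs_le _)) //=; have := sin_subx y; have [+ _] := cos_sub1 y.
  rewrite (distrC (cos y)) (@ger0_norm _ (1 - _)) ?subr_ge0 ?cos_le1 //.
  have := sqr_ge0 y; lra.
have m0 : 0 <= m := cabs_ge0 _.
have sxy : x ^+ 2 + y ^+ 2 = m ^+ 2 by rewrite /m cabs_sqr.
have ex : expR `|x| <= expR m by rewrite ler_expR.
have ex' : expR x <= expR m by rewrite ler_expR (le_trans (ler_norm _)).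
have hxy : `|x| * `|y| <= (x ^+ 2 + y ^+ 2) / 2.
  have := sqr_ge0 (`|x| - `|y|); rewrite sqrrB !real_normK ?num_real //; lra.
have em := expR_ge0 m.
have k1 : x ^+ 2 * expR `|x| <= x ^+ 2 * expR m by rewrite ler_wpM2l // sqr_ge0.
have k2 : `|expR x - 1| * `|y| <= ((x ^+ 2 + y ^+ 2) / 2) * expR m.
  rewrite (le_trans (ler_wpM2r (normr_ge0 y) h2)) //.
  rewrite mulrAC ler_pM // ?mulr_ge0 ?expR_ge0 //.
have k3 : expR x * cabs ((cos y - 1) +i* (sin y - y)) <= expR m * (2 * y ^+ 2).
  by rewrite ler_pM // ?expR_ge0 ?cabs_ge0.
have y20 := sqr_ge0 y; have x20 := sqr_ge0 x.
rewrite -sxy; nra.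
Qed.

End complex_abs.

(** * Derivatives of vector-valued functions *)

Section quadratic_derivative.
Context {R : realType}.

(* With a quadratic remainder the product and chain rules are plain estimates. *)
Definition dq {X : normedModType R[i]} (F : R[i] -> X) (z : R[i]) (y : X) :=
  exists C d : R, [/\ 0 <= C, 0 < d &
    forall h, cabs h <= d -> rnorm (F (z + h) - F z - h *: y) <= C * cabs h ^+ 2].

Definition dqr {X : normedModType R[i]} (F : R -> X) (s : R) (y : X) :=
  exists C d : R, [/\ 0 <= C, 0 < d &
    forall h, `|h| <= d -> rnorm (F (s + h) - F s - h%:C *: y) <= C * `|h| ^+ 2].

Section module.
Context {X : normedModType R[i]}.
Implicit Types (F G : R[i] -> X) (z : R[i]) (y : X).

Lemma dq_lip F z y : dq F z y ->
  exists C d : R, [/\ 0 <= C, 0 < d &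
    forall h, cabs h <= d -> rnorm (F (z + h) - F z) <= C * cabs h].
Proof.
move=> [C [d [C0 d0 H]]]; exists (C * d + rnorm y), d; split=> //.
  by rewrite addr_ge0 ?rnorm_ge0 // mulr_ge0 // ltW.
move=> h hd; rewrite -(subrK (h *: y) (_ - _)) (le_trans (rnormD _ _)) //.
rewrite rnormZ mulrDl; apply: lerD; last by rewrite mulrC.
rewrite (le_trans (H _ hd)) // expr2 mulrA ler_wpM2r ?cabs_ge0 //.
by rewrite ler_wpM2l.
Qed.

Lemma dqr_lip (F : R -> X) s y : dqr F s y ->
  exists C d : R, [/\ 0 <= C, 0 < d &
    forall h, `|h| <= d -> rnorm (F (s + h) - F s) <= C * `|h|].
Proof.
move=> [C [d [C0 d0 H]]]; exists (C * d + rnorm y), d; split=> //.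
  by rewrite addr_ge0 ?rnorm_ge0 // mulr_ge0 // ltW.
move=> h hd; rewrite -(subrK (h%:C *: y) (_ - _)) (le_trans (rnormD _ _)) //.
rewrite rnormZ mulrDl cabs_real; apply: lerD; last by rewrite mulrC.
rewrite (le_trans (H _ hd)) // expr2 mulrA ler_wpM2r //.
by rewrite ler_wpM2l.
Qed.

End module.

Section module_calculus.
Context {X : normedModType R[i]}.
Implicit Types (F G : R[i] -> X) (z : R[i]) (y : X).

Lemma dq_cst (x : X) z : dq (fun=> x) z 0.
Proof.
exists 0, 1; split=> // h _; rewrite subrr scaler0 subr0 rnorm0 mul0r //.
Qed.

Lemma dqD F G z y y' : dq F z y -> dq G z y' -> dq (fun z => F z + G z) z (y + y').
Proof.
move=> [C [d [C0 d0 H]]] [C' [d' [C0' d0' H']]].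
exists (C + C'), (Num.min d d'); split; [exact: addr_ge0|by rewrite lt_min d0|].
move=> h; rewrite le_min => /andP[h1 h2].
rewrite mulrDl (le_trans _ (lerD (H _ h1) (H' _ h2))) //.
rewrite (_ : _ - _ = F (z + h) - F z - h *: y + (G (z + h) - G z - h *: y')); last by linx R[i].
exact: rnormD.
Qed.

Lemma dqM (a : R[i] -> R[i]^o) F z (a' : R[i]) y : dq a z a' -> dq F z y ->
  dq (fun z => a z *: F z) z (a' *: F z + a z *: y).
Proof.
move=> ha hF; have [A1 [d1 [A10 d10 HA]]] := dq_lip ha; have [F1 [d2 [F10 d20 HF]]] := dq_lip hF.
move: ha hF => [C [d [C0 d0 H]]] [C' [d' [C0' d0' H']]].
exists (C * rnorm (F z) + cabs (a z) * C' + A1 * F1), (Num.min (Num.min d d') (Num.min d1 d2)); split.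
- by rewrite !addr_ge0 ?mulr_ge0 ?rnorm_ge0 ?cabs_ge0.
- by rewrite !lt_min d0 d0' d10.
move=> h; rewrite !le_min => /andP[/andP[h1 h2] /andP[h3 h4]].
rewrite [X in rnorm X <= _](_ : _ = (a (z + h) - a z - h * a') *: F z +
   a z *: (F (z + h) - F z - h *: y) + (a (z + h) - a z) *: (F (z + h) - F z)); last first.
  linx R[i].
rewrite !mulrDl (le_trans (rnormD _ _)) // lerD //; last first.
  by rewrite rnormZ expr2 mulrACA ler_pM ?rnorm_ge0 ?cabs_ge0 ?HF // HA.
rewrite (le_trans (rnormD _ _)) // lerD // rnormZ.
  by rewrite mulrAC ler_wpM2r ?rnorm_ge0 // H.
by rewrite -mulrA ler_wpM2l ?cabs_ge0 // H'.
Qed.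

Lemma dq_comp F (a : R[i] -> R[i]^o) z (a' : R[i]) y :
  dq a z a' -> dq F (a z) y -> dq (fun z => F (a z)) z (a' *: y).
Proof.
move=> ha; have [A1 [d1 [A10 d10 HA]]] := dq_lip ha.
move: ha => [C [d [C0 d0 H]]] [C' [d' [C0' d0' H']]].
(* The radius [d' / (A1 + 1)] keeps the increment of [a] within [d']; the added [1] covers [A1 = 0].
   The same device recurs in later choices of radii. *)
exists (C' * A1 ^+ 2 + C * rnorm y), (Num.min (Num.min d d1) (d' / (A1 + 1))); split.
- by rewrite !addr_ge0 ?mulr_ge0 ?rnorm_ge0 ?cabs_ge0 // sqr_ge0.
- by rewrite !lt_min d0 d10 divr_gt0 // ltr_wpDl.
move=> h; rewrite !le_min => /andP[/andP[h1 h2] h3].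
have h4 : cabs (a (z + h) - a z) <= d'.
  rewrite (le_trans (HA _ h2)) //; rewrite ler_pdivlMr ?ltr_wpDl // in h3.
  by rewrite (le_trans _ h3) // mulrC ler_wpM2l ?cabs_ge0 // lerDl.
have := H' _ h4; rewrite [a z + _]addrC subrK => h5.
rewrite [X in rnorm X <= _](_ : _ = (F (a (z + h)) - F (a z) - (a (z + h) - a z) *: y) +
   (a (z + h) - a z - h * a') *: y); last first.
  by linx R[i].
rewrite (le_trans (rnormD _ _)) // mulrDl lerD //.
  rewrite (le_trans h5) // -mulrA -exprMn ler_wpM2l //.
  by rewrite lerXn2r ?nnegrE ?cabs_ge0 ?mulr_ge0 ?cabs_ge0 // HA.
by rewrite rnormZ mulrAC ler_wpM2r ?rnorm_ge0 // H.
Qed.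

Lemma dq_line F z0 (al : R[i]) (s : R) y : dq F (z0 + s%:C * al) y ->
  dqr (fun s => F (z0 + s%:C * al)) s (al *: y).
Proof.
move=> [C [d [C0 d0 H]]]; exists (C * cabs al ^+ 2), (d / (cabs al + 1)).
have a1 : 0 < cabs al + 1 by rewrite ltr_wpDl ?cabs_ge0.
split; [by rewrite mulr_ge0 ?sqr_ge0|exact: divr_gt0|].
move=> h; rewrite ler_pdivlMr // => hd.
have h1 : cabs (h%:C * al) <= d.
  by rewrite cabsM cabs_real (le_trans _ hd) // ler_wpM2l // lerDl.
have := H _ h1; rewrite scalerA rmorphD mulrDl addrA cabsM exprMn cabs_real.
by rewrite mulrA mulrAC.
Qed.

Lemma dqr_cvg (F : R -> X) s y : dqr F s y ->
  (h^-1)%:C *: (F (s + h) - F s) @[h --> (0 : R)^'] --> y.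
Proof.
move=> [C [d [C0 d0 H]]]; apply/rnorm_cvgP.
apply/cvgrPdist_le => /= e e0; near=> h.
have h0 : h != 0 by near: h; exact: nbhs_dnbhs_neq.
have h1 : `|h| <= Num.min d (e / (C + 1)).
  near: h; apply: nbhs_dnbhs; apply: (@nbhs0_le R R).
  by rewrite lt_min d0 divr_gt0 // ltr_wpDl.
move: h1; rewrite le_min => /andP[h1 h2].
rewrite sub0r normrN ger0_norm ?rnorm_ge0 //.
have -> : y = (h^-1)%:C *: (h%:C *: y).
  by rewrite scalerA -rmorphM mulVf // scale1r.
rewrite -scalerBr rnormZ cabs_real normfV ler_pdivrMl ?normr_gt0 //.
rewrite (le_trans (H _ h1)) // mulrC expr2 -mulrA ler_wpM2l //.
rewrite ler_pdivlMr ?ltr_wpDl // in h2.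
by rewrite (le_trans _ h2) // ler_wpM2l // lerDl.
Unshelve. all: by end_near. Qed.

Lemma dqr_uniq (F : R -> X) s y y' : dqr F s y -> dqr F s y' -> y = y'.
Proof. move=> /dqr_cvg h /dqr_cvg; exact: cvg_unique h. Qed.

Lemma dq_derivable (F : R[i]^o -> X) z y : dq F z y -> derivable F z 1.
Proof.
move=> [C [d [C0 d0 H]]]; apply/cvg_ex; exists y.
apply/rnorm_cvgP; apply/cvgrPdist_le => /= e e0; near=> h.
have h0 : h != 0 by near: h; exact: withinT.
have h1 : cabs h <= Num.min d (e / (C + 1)).
  rewrite -ler_rC -cabsE; near: h; apply: nbhs_dnbhs; apply: (@nbhs0_le R[i] R[i]^o).
  by rewrite ltr_rC lt_min d0 divr_gt0 // ltr_wpDl.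
move: h1; rewrite le_min => /andP[h1 h2].
rewrite sub0r normrN ger0_norm ?rnorm_ge0 //.
have -> : y = h^-1 *: (h *: y) by rewrite scalerA mulVf // scale1r.
rewrite -scalerBr rnormZ cabsV ler_pdivrMl ?cabs_gt0 // [_ + z]addrC [h *: 1]mulr1.
rewrite (le_trans (H _ h1)) // mulrC expr2 -mulrA ler_wpM2l ?cabs_ge0 //.
rewrite ler_pdivlMr ?ltr_wpDl // in h2.
by rewrite (le_trans _ h2) // ler_wpM2l ?cabs_ge0 // lerDl.
Unshelve. all: by end_near. Qed.

(** For vector values there is no intermediate point with the right slope. Continuous induction
    replaces it: with the slope relaxed to [K + e], the set of points where the estimate from [a]
    holds contains its supremum, which must be [b]. *)
Lemma mean_value (F : R -> X) (a b K : R) : a <= b ->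
  (forall t, a <= t <= b -> exists2 y, dqr F t y & rnorm y <= K) ->
  rnorm (F b - F a) <= K * (b - a).
Proof.
move=> ab HF.
suff main e : 0 < e -> rnorm (F b - F a) <= (K + e) * (b - a).
  apply/ler_addgt0Pr => e e0; have [ab'|ab'] := eqVneq a b.
    by rewrite (le_trans (main 1 ltr01)) // ab' !subrr !mulr0 add0r ltW.
  have ba : 0 < b - a by rewrite subr_gt0 lt_neqAle ab' ab.
  have := main (e / (b - a)) (divr_gt0 e0 ba).
  by rewrite mulrDl divfK ?gt_eqF.
move=> e0.
(* The slack [e] absorbs the quadratic remainder on a short interval. *)
have step t : a <= t <= b -> exists2 d, 0 < d & forall h, `|h| <= d ->
    rnorm (F (t + h) - F t) <= (K + e) * `|h|.
  move=> /HF[y [C [d [C0 d0 H]]] yK]; exists (Num.min d (e / (C + 1))).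
    by rewrite lt_min d0 divr_gt0 // ltr_wpDl.
  move=> h; rewrite le_min => /andP[h1 h2].
  rewrite -(subrK (h%:C *: y) (_ - _)) (le_trans (rnormD _ _)) //.
  rewrite addrC mulrDl lerD //; first by rewrite rnormZ cabs_real mulrC ler_wpM2r.
  rewrite (le_trans (H _ h1)) // expr2 mulrA ler_wpM2r //.
  rewrite ler_pdivlMr ?ltr_wpDl // in h2.
  by rewrite mulrC (le_trans _ h2) // ler_wpM2l // lerDl.
have K0 : 0 <= K + e.
  have /HF[y _ yK] : a <= a <= b by rewrite lexx.
  by rewrite addr_ge0 ?(ltW e0) // (le_trans (rnorm_ge0 y)).
pose S := [set t | a <= t <= b /\ rnorm (F t - F a) <= (K + e) * (t - a)].
have Sa : S a by split; rewrite ?lexx // !subrr rnorm0 mulr0.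
have hS : has_sup S by split; [exists a|exists b => t [/andP[]]].
pose c := sup S.
have ac : a <= c by exact: (sup_upper_bound hS).
have cb : c <= b by apply: sup_le_ub; [exists a|move=> t [/andP[]]].
have [d d0 Hd] := step c (introT andP (conj ac cb)).
have Sc : S c.
  split; first by rewrite ac cb.
  have [t [/andP[at_ tb] St] tc] := sup_adherent d0 hS.
  have tc' : t <= c by apply: (sup_upper_bound hS); split; rewrite ?at_ ?tb.
  have := Hd (t - c); rewrite ler0_norm ?subr_le0 // opprB [c + _]addrC subrK => /(_ _).
  have -> : c - t <= d by rewrite -/c in tc; lra.
  move=> /(_ isT); rewrite rdistC => h.
  rewrite (le_trans (rdistD (F t) _ _)) // (le_trans (lerD h St)) //.
  by rewrite -mulrDr addrA subrK.
have [->|cb'] := eqVneq b c; first by have [] := Sc.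
have cb2 : c < b by rewrite lt_neqAle eq_sym cb' cb.
(* If [c < b], the local estimate at [c] puts this larger point into [S], against the choice of
   [c]. *)
pose t := Num.min b (c + d).
have ct : c < t by rewrite lt_min cb2 ltrDl.
suff : S t by move=> /(sup_upper_bound hS); rewrite leNgt ct.
have tb : t <= b by rewrite ge_min lexx.
have tcd : t <= c + d by rewrite ge_min lexx orbT.
split; first by rewrite tb (le_trans ac (ltW ct)).
have := Hd (t - c); rewrite ger0_norm ?subr_ge0 ?(ltW ct) // [c + _]addrC subrK => /(_ _).
have -> : t - c <= d by lra.
move=> /(_ isT) h; have [_ Sc2] := Sc.
rewrite (le_trans (rdistD (F c) _ _)) // (le_trans (lerD h Sc2)) //.
by rewrite -mulrDr addrA subrK.
Qed.

End module_calculus.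

Lemma dq_id (z : R[i]) : dq (fun z => z : R[i]^o) z 1.
Proof.
exists 0, 1; split=> // h _; by rewrite [h *: 1]mulr1 addrAC addrK subrr rnorm0 mul0r.
Qed.

Lemma dq_cexp (z : R[i]) : dq (fun z => cexp z : R[i]^o) z (cexp z).
Proof.
exists (cabs (cexp z) * (3 * expR 1)), 1; split=> //.
  by rewrite !mulr_ge0 ?cabs_ge0 ?expR_ge0.
move=> h h1; have -> : cexp (z + h) - cexp z - h *: (cexp z : R[i]^o) =
    cexp z * (cexp h - 1 - h) :> R[i].
  by rewrite cexpD [_ *: _]mulrC !mulrBr mulr1.
rewrite [rnorm _]cabsM -mulrA ler_wpM2l ?cabs_ge0 // (le_trans (cexp_sub1z _)) //.
by rewrite mulrAC ler_wpM2r ?sqr_ge0 // ler_wpM2l // ler_expR.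
Qed.

(** The remainder is exactly [h^2 / (z^2 (z + h))], and [|z + h| >= |z| / 2] on the chosen disc;
    hence the constant [2 / |z|^3]. *)
Lemma dq_inv (z : R[i]) : z != 0 -> dq (fun z => z^-1 : R[i]^o) z (- z ^- 2).
Proof.
move=> z0; have az : 0 < cabs z by rewrite cabs_gt0.
exists (2 / cabs z ^+ 3), (cabs z / 2); split.
- by rewrite divr_ge0 // exprn_ge0 // cabs_ge0.
- by rewrite divr_gt0.
move=> h hz.
have zh : cabs z / 2 <= cabs (z + h).
  have := rdistD (z + h : R[i]^o) z 0; rewrite !subr0 opprD addrA subrr add0r rnormN.
  rewrite -/(cabs z) -/(cabs h) -/(cabs (z + h)); lra.
have zh0 : z + h != 0 by rewrite -cabs_gt0 (lt_le_trans _ zh) // divr_gt0.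
have -> : (z + h)^-1 - z^-1 - h *: (- z ^- 2 : R[i]^o) = h ^+ 2 / (z ^+ 2 * (z + h)) :> R[i].
  by rewrite /GRing.scale /=; field; rewrite zh0.
rewrite [rnorm _]cabsM cabsX mulrC ler_wpM2r ?sqr_ge0 // cabsV cabsM cabsX.
rewrite -[2 / _]invf_div lef_pV2 ?posrE ?divr_gt0 ?exprn_gt0 //; last first.
  by rewrite mulr_gt0 ?exprn_gt0 // cabs_gt0.
by rewrite exprSr -mulrA ler_wpM2l // exprn_ge0 // cabs_ge0.
Qed.

End quadratic_derivative.

(** * Translations and the Gaussian integral *)

Section translation.
Context {R : realType}.

Definition trv n (w u : rvec R n) : rvec R n := [tuple tnth u i + tnth w i | i < n].

Lemma measurable_preimageT d d' (T1 : measurableType d) (T2 : measurableType d')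
  (f : T1 -> T2) A : measurable_fun setT f -> measurable A -> measurable (f @^-1` A).
Proof. by move=> mf mA; rewrite -[_ @^-1` _]setTI; exact: mf. Qed.

(** The pushforward of the product measure along the product map has the right values on rectangles,
    so it is the product measure by uniqueness. *)
Lemma product_translate d1 d2 (T1 : measurableType d1) (T2 : measurableType d2)
    (m1 : {sigma_finite_measure set T1 -> \bar R}) (m2 : {sigma_finite_measure set T2 -> \bar R})
    (f : T1 -> T1) (g : T2 -> T2) :
  measurable_fun setT f -> measurable_fun setT g ->
  (forall A, measurable A -> m1 (f @^-1` A) = m1 A) ->
  (forall A, measurable A -> m2 (g @^-1` A) = m2 A) ->
  forall A, measurable A -> (m1 \x m2)%E ((fun p => (f p.1, g p.2)) @^-1` A) = (m1 \x m2)%E A.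
Proof.
move=> mf mg hf hg A mA.
have mfg : measurable_fun setT (fun p : T1 * T2 => (f p.1, g p.2)).
  by apply/measurable_fun_pair; exact: measurableT_comp.
apply/esym.
apply: (@product_measure_unique _ _ _ _ _ m1 m2
  (measure_function_pushforward__canonical__measure_function_Measure (m1 \x m2)%E mfg)) => // B C mB mC.
rewrite /= /pushforward [X in (_ \x _)%E X = _](_ : _ = (f @^-1` B) `*` (g @^-1` C)); last by [].
have mfB := measurable_preimageT mf mB; have mgC := measurable_preimageT mg mC.
transitivity (m1 (f @^-1` B) * m2 (g @^-1` C))%E; last by rewrite hf // hg.
exact: (product_measure1E m1 m2 mfB mgC).
Qed.

Lemma lebesgue_translate (a : R) (A : set (measurableTypeR R)) : measurable A ->
  lebesgue_measure ((fun x : measurableTypeR R => x + a : measurableTypeR R) @^-1` A) = lebesgue_measure A.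
Proof.
move=> mA; apply/esym.
have mf : measurable_fun setT (fun x : measurableTypeR R => x + a : measurableTypeR R).
  exact: measurable_funD.
apply: (@lebesgue_measure_unique R
  (measure_function_pushforward__canonical__measure_function_Measure lebesgue_measure mf)) => // B [[x y] /= xy <-].
rewrite /pushforward [X in _ = lebesgue_measure X](_ : _ = `]x - a, y - a]%classic).
  by rewrite !lebesgue_measure_itv /= !lte_fin ltrD2r; case: ifP => // _; rewrite -!EFinB; congr EFin; lra.
by apply/seteqP; split=> z /=; rewrite !in_itv /=; lra.
Qed.

Lemma measurable_trv n (w : rvec R n) : measurable_fun setT (trv w).
Proof.
apply/measurable_fun_tnthP => i.
rewrite [X in measurable_fun _ X](_ : _ = fun u : rvec R n => tnth u i + tnth w i : measurableTypeR R).
  by apply: measurable_funD => //; exact: measurable_tnth.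
by apply/funext => u /=; rewrite tnth_mktuple.
Qed.

Lemma lebesgue_rvec_translate n (w : rvec R n) A : measurable A ->
  lebesgue_rvec n (trv w @^-1` A) = lebesgue_rvec n A.
Proof.
elim: n w A => [|n IH] w A mA /=.
  by rewrite !diracE; congr (_%:R%:E); congr nat_of_bool; apply/idP/idP;
     rewrite !inE /= (tuple0 (trv w _)).
pose f (x : measurableTypeR R) : measurableTypeR R := x + thead w.
pose g := trv [tuple of behead w].
rewrite /lebesgue_step [X in (_ \x _)%E X = _](_ : _ = (fun p => (f p.1, g p.2)) @^-1` (@consv _ _ @^-1` A)).
  apply: (@product_translate _ _ _ _ lebesgue_measure (lebesgue_rvec n) f g).
  - exact: measurable_funD.
  - exact: measurable_trv.
  - by move=> B mB; exact: lebesgue_translate.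
  - by move=> B mB; exact: IH.
  - by apply: measurable_preimageT => //; exact: measurable_consv.
apply/seteqP; split=> p /=; rewrite (_ : trv w (consv p) = consv (f p.1, g p.2)) //;
 apply: eq_from_tnth => i; rewrite tnth_mktuple;
 case: (unliftP ord0 i) => [j|] ->; rewrite ?tnthS ?tnth0 /= ?tnth_mktuple //;
 by rewrite !(tnth_nth (thead w)) /= nth_behead.
Qed.

Context (d : nat).
Local Notation E := (rvec R d * rvec R d)%type.

Definition trp (w p : E) : E := (trv w.1 p.1, trv w.2 p.2).

Lemma measurable_trp (w : E) : measurable_fun setT (trp w).
Proof. by apply/measurable_fun_pair; apply: measurableT_comp => //; exact: measurable_trv. Qed.

Lemma lebesgue2_translate (w : E) A : measurable A ->
  lebesgue2 (trp w @^-1` A) = lebesgue2 A.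
Proof.
apply: (@product_translate _ _ _ _ (lebesgue_rvec d) (lebesgue_rvec d) (trv w.1) (trv w.2));
  by [exact: measurable_trv | exact: lebesgue_rvec_translate].
Qed.

Lemma measurable_dotv n (f g : rvec R n -> rvec R n) : measurable_fun setT f -> measurable_fun setT g ->
  measurable_fun setT (fun u => dotv (f u) (g u) : R).
Proof.
move=> mf mg; rewrite /dotv; apply: measurable_sum => j.
by apply: measurable_funM; apply: (@measurableT_comp _ _ _ _ _ _ (fun u : rvec R n => tnth u j)) => //;
  exact: measurable_tnth.
Qed.

Lemma integral_ge0Zl dd (T : measurableType dd) (mu : {measure set T -> \bar R}) (f : T -> R) k :
  0 <= k -> measurable_fun setT f -> (forall x, 0 <= f x) ->
  (\int[mu]_(x in setT) (k%:E * (f x)%:E) = k%:E * \int[mu]_(x in setT) (f x)%:E)%E.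
Proof.
move=> k0 mf f0; rewrite ge0_integralZl_EFin // => [x _|]; first by rewrite lee_fin.
exact/measurable_EFinP.
Qed.

Lemma gauss_line (c : R) : 0 < c ->
  (\int[lebesgue_measure]_(x in [set: measurableTypeR R]) (expR (- (c * x ^+ 2)))%:E = (Num.sqrt (pi / c))%:E)%E.
Proof.
(* With variance [1 / (2 c)] the normal density is [e^(-c x^2)] divided by [sqrt (pi / c)], and its
   integral is known to be 1. *)
move=> c0; pose s := Num.sqrt (2 * c)^-1.
have s2 : s ^+ 2 = (2 * c)^-1 by rewrite sqr_sqrtr // invr_ge0 mulr_ge0 // ltW.
have s0 : s != 0 by rewrite gt_eqF // sqrtr_gt0 invr_gt0 mulr_gt0.
have := integral_normal_pdf 0 s; rewrite normal_pdfE // /normal_peak /normal_fun.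
have -> : s ^+ 2 * pi *+ 2 = pi / c by rewrite s2 mulr2n; field; rewrite gt_eqF.
have k0 : 0 < Num.sqrt (pi / c) by rewrite sqrtr_gt0 divr_gt0 // pi_gt0.
under eq_integral => x _ do rewrite EFinM.
rewrite (@integral_ge0Zl _ _ lebesgue_measure (fun x => expR (- (x - 0) ^+ 2 / (s ^+ 2 *+ 2)))); last 3 first.
- by rewrite invr_ge0 ltW.
- exact: measurable_normal_fun.
- by move=> x; rewrite expR_ge0.
under eq_integral => x _.
  rewrite (_ : _ / _ = - (c * x ^+ 2)); last first.
    by rewrite s2 subr0 mulr2n; field; rewrite gt_eqF.
  over.
set I := (X in (_ * X)%E = _) => h.
transitivity ((Num.sqrt (pi / c))%:E * ((Num.sqrt (pi / c))^-1%:E * I))%E; last by rewrite h mule1.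
by rewrite muleA -EFinM divff ?mul1e // gt_eqF.
Qed.

Lemma gauss_rvec n (c : R) : 0 < c ->
  (\int[lebesgue_rvec n]_(u in [set: rvec R n]) (expR (- (c * dotv u u)))%:E = (Num.sqrt (pi / c) ^+ n)%:E)%E.
Proof.
move=> c0; have mE k : measurable_fun setT (fun u : rvec R k => expR (- (c * dotv u u))).
  apply: measurableT_comp => //; apply: measurableT_comp => //; apply: measurable_funM => //.
  exact: measurable_dotv.
elim: n => [|n IH].
  rewrite /= integral_dirac //; first by rewrite diracE in_setT mul1e /dotv big_ord0 mulr0 oppr0 expR0.
  by apply/measurable_EFinP; exact: mE.
transitivity (\int[pushforward (lebesgue_measure \x lebesgue_rvec n)%E (@consv R n)]_(u in setT)
  (expR (- (c * dotv u u)))%:E)%E; first by [].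
rewrite ge0_integral_pushforward //; last 2 first.
- exact: measurable_consv.
- by apply/measurable_EFinP; exact: mE.
rewrite preimage_setT.
have e : (fun u : rvec R n.+1 => (expR (- (c * dotv u u)))%:E) \o @consv R n =
   fun p => ((expR (- (c * p.1 ^+ 2)))%:E * (expR (- (c * dotv p.2 p.2)))%:E)%E.
  apply/funext => p /=; rewrite -EFinM -expRD; congr (expR _)%:E.
  rewrite /dotv big_ord_recl /= !tnth0 /= -opprD -mulrDr expr2; congr (- (c * (_ + _))).
  by apply: eq_bigr => i _; rewrite !tnthS.
rewrite e fubini_tonelli1 //; last first.
  have m1 : measurable_fun setT (fun x : measurableTypeR R => expR (- (c * x ^+ 2))).
    by apply: measurableT_comp => //; apply: measurableT_comp => //; apply: measurable_funM => //; exact: measurable_funX.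
  have h : measurable_fun setT (EFin \o (fun p : measurableTypeR R * rvec R n =>
      expR (- (c * p.1 ^+ 2)) * expR (- (c * dotv p.2 p.2)))).
    apply/measurable_EFinP; apply: measurable_funM.
      exact: (measurableT_comp m1).
    exact: (measurableT_comp (mE n)).
  exact: h.
rewrite /fubini_F /=.
under eq_integral => x _.
  rewrite (@integral_ge0Zl _ _ (lebesgue_rvec n) (fun y => expR (- (c * dotv y y))) _
    (expR_ge0 _) (mE n) (fun=> expR_ge0 _)).
  rewrite IH muleC; over.
have s0 : 0 <= Num.sqrt (pi / c) ^+ n by rewrite exprn_ge0 // sqrtr_ge0.
rewrite (@integral_ge0Zl _ _ lebesgue_measure (fun x : measurableTypeR R => expR (- (c * x ^+ 2))) _ s0) //.
  by rewrite gauss_line // -EFinM -exprSr.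
by apply: measurableT_comp => //; apply: measurableT_comp => //; apply: measurable_funM => //; exact: measurable_funX.
Qed.

Definition nq (p : E) : R := dotv p.1 p.1 + dotv p.2 p.2.

Lemma measurable_nq : measurable_fun setT nq.
Proof.
by apply: measurable_funD; apply: (@measurableT_comp _ _ _ _ _ _ (fun u : rvec R d => dotv u u : R)) => //;
  exact: measurable_dotv.
Qed.

Lemma measurable_gauss2 (c : R) : measurable_fun setT (fun p : E => expR (- (c * nq p))).
Proof.
apply: measurableT_comp => //; apply: measurableT_comp => //; apply: measurable_funM => //; exact: measurable_nq.
Qed.

Lemma gauss_lebesgue2 (c : R) : 0 < c ->
  (\int[lebesgue2]_(p in [set: E]) (expR (- (c * nq p)))%:E = ((pi / c) ^+ d)%:E)%E.
Proof.
move=> c0; have mE k : measurable_fun setT (fun u : rvec R k => expR (- (c * dotv u u))).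
  apply: measurableT_comp => //; apply: measurableT_comp => //; apply: measurable_funM => //.
  exact: measurable_dotv.
rewrite /lebesgue2 fubini_tonelli1 //; last first.
- have h : measurable_fun setT (EFin \o (fun p : E => expR (- (c * nq p)))).
    by apply/measurable_EFinP; exact: measurable_gauss2.
  exact: h.
rewrite /fubini_F /=.
under eq_integral => x _.
  under eq_integral => y _ do rewrite /nq /= mulrDr opprD expRD EFinM.
  rewrite (@integral_ge0Zl _ _ (lebesgue_rvec d) (fun y => expR (- (c * dotv y y))) _
    (expR_ge0 _) (mE d) (fun=> expR_ge0 _)).
  rewrite gauss_rvec // muleC; over.
have s0 : 0 <= Num.sqrt (pi / c) ^+ d by rewrite exprn_ge0 // sqrtr_ge0.
rewrite (@integral_ge0Zl _ _ (lebesgue_rvec d) (fun y => expR (- (c * dotv y y))) _ s0 (mE d) (fun=> expR_ge0 _)).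
by rewrite gauss_rvec // -EFinM -exprMn -expr2 sqr_sqrtr // divr_ge0 ?pi_ge0 // ltW.
Qed.

End translation.

(** * Bochner integrals of continuous functions with Gaussian decay *)

Section bochner_steps.
Context {R : realType} {X : normedModType R[i]}.
Context {disp : measure_display} {T : measurableType disp}.
Variable mu : {measure set T -> \bar R}.
Local Notation step_fun := (@step_fun R X disp T mu).
Implicit Types (s t : step_fun) (F G : T -> X).

(** [X] carries no sigma-algebra, so norms are handled directly. On the first set and on its
    complement the norm is that of a shorter step function, with offset [w + v ord0] and [w]; the
    free offset makes the induction go through. *)
Lemma measurable_step_norm n (A : 'I_n -> set T) (v : 'I_n -> X) (w : X) :
  (forall i, measurable (A i)) ->
  measurable_fun setT (fun x => rnorm (w + \sum_(i < n) (\1_(A i) x : R)%:C *: v i)).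
Proof.
elim: n A v w => [|n IH] A v w mA.
  by rewrite [X in measurable_fun _ X](_ : _ = fun=> rnorm w) //; apply/funext => x; rewrite big_ord0 addr0.
pose g u x := rnorm (u + \sum_(i < n) (\1_(A (lift ord0 i)) x : R)%:C *: v (lift ord0 i)).
have mg u : measurable_fun setT (g u) by apply: IH.
rewrite [X in measurable_fun _ X](_ : _ =
    fun x => \1_(A ord0) x * g (w + v ord0) x + \1_(~` A ord0) x * g w x).
  apply: measurable_funD; apply: measurable_funM => //; apply: measurable_indic => //.
  exact: measurableC.
apply/funext => x; rewrite big_ord_recl /g !indicE in_setC.
by case: (x \in A ord0); rewrite /= ?mul1r ?mul0r ?addr0 ?add0r ?scale1r ?scale0r ?add0r // addrA.
Qed.

(** The sets of a step function may overlap, so a termwise triangle inequality would be too weak.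
    Splitting the domain [E] along the first set moves its value into the offset, and induction
    applies to both halves. *)
Lemma step_integral_le_split n (A : 'I_n -> set T) (v : 'I_n -> X) (w : X) (E : set T) :
  (forall i, measurable (A i)) -> measurable E -> (mu E < +oo)%E ->
  ((rnorm ((fine (mu E))%:C *: w + \sum_(i < n) (fine (mu (A i `&` E)))%:C *: v i))%:E <=
   \int[mu]_(x in E) (rnorm (w + \sum_(i < n) (\1_(A i) x : R)%:C *: v i))%:E)%E.
Proof.
elim: n A v w E => [|n IH] A v w E mA mE fE.
  under eq_integral => x _ do rewrite big_ord0 addr0.
  rewrite big_ord0 addr0 integral_cst // rnormZ cabs_real ger0_norm ?fine_ge0 //.
  by rewrite EFinM fineK ?ge0_fin_numE // muleC.
have m1 : measurable (E `&` A ord0) by exact: measurableI.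
have m2 : measurable (E `\` A ord0) by exact: measurableD.
have f1 : (mu (E `&` A ord0) < +oo)%E.
  by rewrite (le_lt_trans _ fE) // le_measure ?inE //; exact: subIsetl.
have f2 : (mu (E `\` A ord0) < +oo)%E.
  by rewrite (le_lt_trans _ fE) // le_measure ?inE //; exact: subDsetl.
have e0 : E = (E `&` A ord0) `|` (E `\` A ord0) by rewrite setUIDK.
have disj : [disjoint E `&` A ord0 & E `\` A ord0].
  by apply/disj_setPS => x [[_ ?] [_ ?]].
have add B : measurable B -> fine (mu (B `&` E)) =
    fine (mu (B `&` (E `&` A ord0))) + fine (mu (B `&` (E `\` A ord0))).
  move=> mB; have g1 : (mu (B `&` (E `&` A ord0)) < +oo)%E.
    by rewrite (le_lt_trans _ f1) // le_measure ?inE //; exact: measurableI.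
  have g2 : (mu (B `&` (E `\` A ord0)) < +oo)%E.
    by rewrite (le_lt_trans _ f2) // le_measure ?inE //; exact: measurableI.
  rewrite -fineD ?ge0_fin_numE // -measureU //; [|exact: measurableI|exact: measurableI|].
    by rewrite -setIUr -e0.
  by apply/seteqP; split=> // x [[_ [_ ?]] [_ [_ ?]]].
have -> : (fine (mu E))%:C *: w + \sum_(i < n.+1) (fine (mu (A i `&` E)))%:C *: v i =
  ((fine (mu (E `&` A ord0)))%:C *: (w + v ord0) +
    \sum_(i < n) (fine (mu (A (lift ord0 i) `&` (E `&` A ord0))))%:C *: v (lift ord0 i)) +
  ((fine (mu (E `\` A ord0)))%:C *: w +
    \sum_(i < n) (fine (mu (A (lift ord0 i) `&` (E `\` A ord0))))%:C *: v (lift ord0 i)).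
  have := add setT measurableT; rewrite !setTI => ->.
  rewrite big_ord_recl [A ord0 `&` E]setIC.
  under eq_bigr => i _ do rewrite (add _ (mA _)) rmorphD scalerDl.
  rewrite big_split /= rmorphD /=.
  set a := _%:C; set b := _%:C; set S1 := \sum_(i < n) _; set S2 := \sum_(i < n) _.
  linx R[i].
set u := (X in (rnorm (X + _))%:E); set u' := (X in (rnorm (_ + X))%:E).
rewrite (@le_trans _ _ (rnorm u + rnorm u')%:E) //; first by rewrite lee_fin; exact: rnormD.
rewrite EFinD {}/u {}/u' [X in (_ <= integral _ X _)%E]e0 ge0_integral_setU //; last 2 first.
- apply/measurable_EFinP; apply: (measurable_funS measurableT) => //.
  exact: measurable_step_norm.
- by move=> x _; rewrite lee_fin rnorm_ge0.
apply: leeD.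
- rewrite (le_trans (IH _ _ _ _ _ m1 f1)) //.
  under [leRHS]eq_integral => x.
    rewrite inE => -[_ xA]; rewrite big_ord_recl indicE mem_set // scale1r addrA; over.
  by [].
- rewrite (le_trans (IH _ _ _ _ _ m2 f2)) //.
  under [leRHS]eq_integral => x.
    rewrite inE => -[_ xA]; rewrite big_ord_recl indicE memNset // scale0r add0r; over.
  by [].
Qed.

Lemma measurable_step_app s w : measurable_fun setT (fun x => rnorm (w + step_app s x)).
Proof. by apply: measurable_step_norm; exact: step_measurable. Qed.

(** Supplies a domain of finite measure on which the split estimate can be started. *)
Lemma finite_measure_cover n (A : 'I_n -> set T) :
  (forall i, measurable (A i)) -> (forall i, (mu (A i) < +oo)%E) ->
  exists E, [/\ measurable E, (mu E < +oo)%E & forall i, A i `<=` E].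
Proof.
elim: n A => [|n IH] A mA fA; first by exists set0; split=> [|| []//]; rewrite ?measure0.
have [E [mE fE sE]] := IH (fun i => A (lift ord0 i)) (fun i => mA _) (fun i => fA _).
exists (A ord0 `|` E); split; first exact: measurableU.
- by have := measureU2 mu (mA ord0) mE; move/le_lt_trans; apply; apply: lte_add_pinfty => //; exact: fA.
- by move=> i; case: (unliftP ord0 i) => [j|] -> x Ax; [right; exact: sE Ax|left].
Qed.

Lemma step_integral_le s : ((rnorm (step_integral s))%:E <= \int[mu]_x (rnorm (step_app s x))%:E)%E.
Proof.
have [E [mE fE sE]] := finite_measure_cover (@step_measurable _ _ _ _ _ s) (@step_finite _ _ _ _ _ s).
have := step_integral_le_split (@step_val _ _ _ _ _ s) 0 (@step_measurable _ _ _ _ _ s) mE fE.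
rewrite scaler0 add0r.
under eq_bigr => i _ do rewrite (setIidl (sE i)).
move=> h; rewrite (le_trans h) //.
under eq_integral => x _ do rewrite add0r.
apply: ge0_subset_integral => //.
- apply/measurable_EFinP.
  rewrite [X in measurable_fun _ X](_ : _ = fun x => rnorm (0 + step_app s x)); first exact: measurable_step_app.
  by apply/funext => x; rewrite add0r.
- by move=> x _; rewrite lee_fin rnorm_ge0.
Qed.

Lemma step_comb_measurable s t (i : 'I_(step_size s + step_size t)) :
  measurable (match fintype.split i with inl j => step_set j | inr j => step_set j end).
Proof. by case: fintype.split => j; exact: step_measurable. Qed.

Lemma step_comb_finite s t (i : 'I_(step_size s + step_size t)) :
  (mu (match fintype.split i with inl j => step_set j | inr j => step_set j end) < +oo)%E.
Proof. by case: fintype.split => j; exact: step_finite. Qed.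

Definition step_comb (c : R[i]) s t : step_fun :=
  @StepFun R X disp T mu (step_size s + step_size t)
    (fun i => match fintype.split i with inl j => step_set j | inr j => step_set j end)
    (fun i => match fintype.split i with inl j => c *: step_val j | inr j => step_val j end)
    (@step_comb_measurable s t) (@step_comb_finite s t).

Lemma step_comb_app c s t x : step_app (step_comb c s t) x = c *: step_app s x + step_app t x.
Proof.
rewrite /step_app /= big_split_ord /=; congr (_ + _).
  by rewrite scaler_sumr; apply: eq_bigr => i _; rewrite (unsplitK (inl i)) scalerA mulrC -scalerA.
by apply: eq_bigr => i _; rewrite (unsplitK (inr i)).
Qed.

Lemma step_comb_integral c s t :
  step_integral (step_comb c s t) = c *: step_integral s + step_integral t.
Proof.
rewrite /step_integral /= big_split_ord /=; congr (_ + _).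
  by rewrite scaler_sumr; apply: eq_bigr => i _; rewrite (unsplitK (inl i)) !scalerA mulrC.
by apply: eq_bigr => i _; rewrite (unsplitK (inr i)).
Qed.

End bochner_steps.

Lemma cvg0_near {R : realType} (T : Type) (F : set_system T) {FF : Filter F} (u : T -> R) e :
  u t @[t --> F] --> (0 : R) -> 0 < e -> \forall t \near F, u t <= e.
Proof.
move=> h e0; have := (@cvgrPdist_le _ _ _ F FF u 0).1 h e e0; apply: filterS => t.
by rewrite sub0r normrN; exact: le_trans (ler_norm _).
Qed.

Lemma rnorm_near {R : realType} {X : normedModType R[i]} (T : Type) (F : set_system T) {FF : Filter F}
  (f : T -> X) y (e : R) :
  f @ F --> y -> 0 < e -> \forall t \near F, rnorm (f t - y) <= e.
Proof. by move=> /rnorm_cvgP h e0; exact: cvg0_near. Qed.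

Lemma rnorm_cvg {R : realType} {X : normedModType R[i]} (T : Type) (F : set_system T) {FF : Filter F}
  (f : T -> X) y : (forall e : R, 0 < e -> \forall t \near F, rnorm (f t - y) <= e) -> f @ F --> y.
Proof.
move=> h; apply/rnorm_cvgP; apply/cvgrPdist_le => /= e e0; have := h e e0; apply: filterS => t.
by rewrite sub0r normrN ger0_norm ?rnorm_ge0.
Qed.

Lemma cvg0_seq_near {R : realType} (u : nat -> R) e :
  u n @[n --> \oo] --> (0 : R) -> 0 < e -> \forall n \near \oo, u n <= e.
Proof. exact: cvg0_near. Qed.

Lemma rnorm_seq_near {R : realType} {X : normedModType R[i]} (f : nat -> X) y (e : R) :
  f n @[n --> \oo] --> y -> 0 < e -> \forall n \near \oo, rnorm (f n - y) <= e.
Proof. exact: rnorm_near. Qed.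

Section bochner_integrals.
Context {R : realType}.
Context {disp : measure_display} {T : measurableType disp}.
Variable mu : {measure set T -> \bar R}.

Section general.
Context {X : normedModType R[i]}.
Local Notation step_fun := (@step_fun R X disp T mu).
Implicit Types (s t : step_fun) (F G : T -> X).

(** Convergence at every point rather than almost everywhere: the norms [rnorm (F x - step_app s x)]
    are then pointwise limits of measurable functions, whether or not [mu] is complete. *)
Definition step_limit F := exists s : nat -> step_fun,
  forall x, step_app (s n) x @[n --> \oo] --> F x.

(** An epsilon form of [is_bochner]: one step function per tolerance, which makes linearity,
    translations and bounded maps direct. *)
Definition bint F y := step_limit F /\ forall e : R, 0 < e -> exists s : step_fun,
  (\int[mu]_x (rnorm (F x - step_app s x))%:E <= e%:E)%E /\ rnorm (step_integral s - y) <= e.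

Lemma step_limit_measurable F s : step_limit F ->
  measurable_fun setT (fun x => rnorm (F x + step_app s x)).
Proof.
move=> [t ht]; apply: (@measurable_fun_cvg _ _ _ _ (fun n x => rnorm (step_app (t n) x + step_app s x))).
  move=> n; have := measurable_step_app (step_comb 1 (t n) s) 0.
  by apply: eq_measurable_fun => x _; rewrite step_comb_app scale1r add0r.
move=> x _; apply/cvgrPdist_le => /= e e0; have := rnorm_seq_near (ht x) e0.
apply: filterS => n h'.
rewrite (le_trans (rdist_dist _ _)) // opprD addrACA subrr addr0 rdistC //.
Qed.

Lemma step_limit_measurableN F s : step_limit F ->
  measurable_fun setT (fun x => rnorm (F x - step_app s x)).
Proof.
move=> hF; have := step_limit_measurable (step_comb (-2) s s) hF.
apply: eq_measurable_fun => x _; rewrite step_comb_app; congr rnorm; linx R[i].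
Qed.

Lemma step_limit_norm F : step_limit F -> measurable_fun setT (fun x => rnorm (F x)).
Proof.
move=> hF; have [s _] := hF; have := step_limit_measurable (step_comb (-1) (s 0) (s 0)) hF.
by apply: eq_measurable_fun => x _; rewrite step_comb_app; congr rnorm; linx R[i].
Qed.

(** Applied to a difference it yields uniqueness of the integral; applied to Gaussian integrands it
    yields the operator bounds. *)
Lemma bint_norm F y : bint F y -> ((rnorm y)%:E <= \int[mu]_x (rnorm (F x))%:E)%E.
Proof.
move=> [hF h]; apply/lee_addgt0Pr => e e0.
have [s [h1 h2]] := h (e / 2) (divr_gt0 e0 (ltr0Sn _ 1)).
have m0 := step_limit_norm hF; have m1 := step_limit_measurableN s hF.
have h3 : (\int[mu]_x (rnorm (step_app s x))%:E <=
    \int[mu]_x (rnorm (F x))%:E + \int[mu]_x (rnorm (F x - step_app s x))%:E)%E.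
  rewrite -ge0_integralD //; try by [move=> x _; rewrite lee_fin rnorm_ge0|exact/measurable_EFinP].
  apply: ge0_le_integral => //.
  - by move=> x _; rewrite lee_fin rnorm_ge0.
  - apply/measurable_EFinP; have := measurable_step_app s 0.
    by apply: eq_measurable_fun => x _; rewrite add0r.
    - by apply/measurable_EFinP; exact: measurable_funD.
  - move=> x _; rewrite -EFinD lee_fin (le_trans _ (rnormB _ _)) // opprB addrC subrK //.
have h4 : rnorm y <= rnorm (step_integral s) + e / 2.
  by rewrite -(subrK (step_integral s) y) addrC (le_trans (rnormD _ _)) // lerD2l rdistC.
rewrite (@le_trans _ _ ((rnorm (step_integral s))%:E + (e / 2)%:E)%E) ?lee_fin //.
rewrite (@le_trans _ _ (\int[mu]_x (rnorm (F x))%:E + (e / 2)%:E + (e / 2)%:E)%E) //.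
  rewrite leeD2r // (le_trans (step_integral_le s)) // (le_trans h3) // leeD2l //.
by rewrite -addeA -EFinD -splitr.
Qed.

Lemma bint_lin (c : R[i]) F G y z : bint F y -> bint G z ->
  bint (fun x => c *: F x + G x) (c *: y + z).
Proof.
move=> [hF h] [hG k].
have hFG : step_limit (fun x => c *: F x + G x).
  have [s hs] := hF; have [t ht] := hG.
  exists (fun n => step_comb c (s n) (t n)) => x.
  under eq_fun => n do rewrite step_comb_app.
  by apply: cvgD => //; apply: cvgZr.
split=> // e e0; have c0 : 0 < cabs c + 1 by rewrite ltr_wpDl // cabs_ge0.
pose e1 := e / (cabs c + 1).
have e10 : 0 < e1 by rewrite divr_gt0.
have ee : cabs c * e1 + e1 = e by rewrite -[X in _ + X]mul1r -mulrDl /e1 mulrC divfK // gt_eqF.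
have [s [h1 h2]] := h _ e10; have [t [k1 k2]] := k _ e10.
exists (step_comb c s t); split.
  have m1 := step_limit_measurableN s hF; have m2 := step_limit_measurableN t hG.
  rewrite -ee EFinD EFinM (@le_trans _ _ ((cabs c)%:E * \int[mu]_x (rnorm (F x - step_app s x))%:E +
     \int[mu]_x (rnorm (G x - step_app t x))%:E)%E) //; last first.
    by rewrite leeD // lee_wpmul2l // lee_fin cabs_ge0.
  rewrite -integral_ge0Zl //; [|exact: cabs_ge0|by move=> x; exact: rnorm_ge0].
  rewrite -ge0_integralD //; last 4 first.
  - by move=> x _; rewrite -EFinM lee_fin mulr_ge0 ?rnorm_ge0 ?cabs_ge0.
  - by apply/measurable_EFinP; apply: measurable_funM.
  - by move=> x _; rewrite lee_fin rnorm_ge0.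
  - exact/measurable_EFinP.
  apply: ge0_le_integral => //.
  - by move=> x _; rewrite lee_fin rnorm_ge0.
  - apply/measurable_EFinP; exact: step_limit_measurableN.
  - by apply/measurable_EFinP; apply: measurable_funD => //; apply: measurable_funM.
  - move=> x _; rewrite -EFinM -EFinD lee_fin -rnormZ (le_trans _ (rnormD _ _)) //.
    by rewrite step_comb_app [X in rnorm X <= _](_ : _ = c *: (F x - step_app s x) + (G x - step_app t x)) //; linx R[i].
rewrite step_comb_integral -ee [X in rnorm X](_ : _ = c *: (step_integral s - y) + (step_integral t - z)); last by linx R[i].
rewrite (le_trans (rnormD _ _)) // lerD // rnormZ ler_wpM2l ?cabs_ge0 //.
Qed.

Lemma bint0 : bint (fun=> 0) 0.
Proof.
have f0 : 'I_0 -> (mu set0 < +oo)%E by case.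
pose s0 := @StepFun R X disp T mu 0 (fun=> set0) (fun=> 0) (fun i => measurable0) f0.
have e0 x : step_app s0 x = 0 by rewrite /step_app big_ord0.
split; first by exists (fun=> s0) => x; under eq_fun do rewrite e0; exact: cvg_cst.
move=> e ep; exists s0; rewrite /step_integral big_ord0 subrr rnorm0 (ltW ep); split=> //.
under eq_integral => x _ do rewrite e0 subrr rnorm0.
by rewrite integral0 lee_fin ltW.
Qed.

Lemma eq_bint F G y : (forall x, F x = G x) -> bint F y -> bint G y.
Proof. by move=> /funext ->. Qed.

Lemma bintZ c F y : bint F y -> bint (fun x => c *: F x) (c *: y).
Proof. by move=> /(bint_lin c) /(_ bint0); rewrite addr0; apply: eq_bint => x; rewrite addr0. Qed.

Lemma bint_uniq F y z : bint F y -> bint F z -> y = z.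
Proof.
move=> hy hz; have := bint_norm (bint_lin (-1) hy hz).
under eq_integral => x _ do rewrite scaleN1r addNr rnorm0.
rewrite integral0 lee_fin => h; apply/eqP; rewrite eq_sym -subr_eq0 addrC -scaleN1r; apply/eqP.
by apply: rnorm_eq0; apply/eqP; rewrite eq_le rnorm_ge0 andbT.
Qed.

Lemma is_bochner_bint F y : step_limit F -> is_bochner mu F y -> bint F y.
Proof.
move=> hF [_ [t [t1 t2]]]; split=> // e e0.
have /fine_cvgP[tf t1'] := t1.
have t1e := cvg0_seq_near t1' e0; have t2e := rnorm_seq_near t2 e0.
have [N1 _ h1] := t1e; have [N2 _ h2] := tf; have [N3 _ h3] := t2e.
pose n := (N1 + N2 + N3)%N.
have [n1 n2 n3] : [/\ fine (\int[mu]_x (rnorm (F x - step_app (t n) x))%:E)%E <= e,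
   (\int[mu]_x (rnorm (F x - step_app (t n) x))%:E)%E \is a fin_num & rnorm (step_integral (t n) - y) <= e].
  by split; [apply: h1|apply: h2|apply: h3]; rewrite /= /n; lia.
by exists (t n); split=> //; rewrite -(fineK n2) lee_fin.
Qed.

Lemma bint_is_bochner F y : bint F y -> is_bochner mu F y.
Proof.
move=> [[s hs] h]; split; first by exists s; apply/aeW.
have /choice[t ht] : forall n : nat, exists s : step_fun,
    (\int[mu]_x (rnorm (F x - step_app s x))%:E <= (n.+1%:R^-1)%:E)%E /\
    rnorm (step_integral s - y) <= n.+1%:R^-1.
  by move=> n; apply: h; rewrite invr_gt0.
exists t; split.
  apply: (@squeeze_cvge _ _ _ _ (fun=> 0%E) _ (fun n => (n.+1%:R^-1 : R)%:E)).
  - near=> n; rewrite (ht n).1 andbT; apply: integral_ge0 => x _; exact: rnorm_ge0.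
  - exact: cvg_cst.
  - by apply/fine_cvgP; split; [exact: nearW|exact: cvg_harmonic].
apply/rnorm_cvgP; apply: (@squeeze_cvgr _ _ _ _ (fun=> 0) (fun n => n.+1%:R^-1)).
- by near=> n; rewrite rnorm_ge0 (ht n).2.
- exact: cvg_cst.
- exact: cvg_harmonic.
Unshelve. all: by end_near. Qed.

(** [xget] returns some admissible value, so the equation amounts to uniqueness among all
    [is_bochner] values; these are [bint] values because [F] is an everywhere limit of step
    functions. *)
Lemma bochnerE F y : bint F y -> bochner mu F = y.
Proof.
move=> hF; apply: xget_subset1; first exact: bint_is_bochner.
by move=> u v /(is_bochner_bint hF.1) hu /(is_bochner_bint hF.1) hv; exact: bint_uniq hu hv.
Qed.

(** Pulling the step sets back along [f] preserves their measures, so the step integrals and the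
    integrated errors do not change. *)
Lemma bint_shift (f : T -> T) F y : measurable_fun setT f ->
  (forall A, measurable A -> mu (f @^-1` A) = mu A) ->
  bint F y -> bint (fun x => F (f x)) y.
Proof.
move=> mf hf [hF h].
have m1 s (i : 'I_(step_size s)) : measurable (f @^-1` step_set i).
  by apply: measurable_preimageT => //; exact: step_measurable.
have m2 s (i : 'I_(step_size s)) : (mu (f @^-1` step_set i) < +oo)%E.
  by rewrite hf; [exact: step_finite|exact: step_measurable].
pose c s : step_fun := @StepFun R X disp T mu _ _ (@step_val _ _ _ _ _ s) (m1 s) (m2 s).
have c1 s x : step_app (c s) x = step_app s (f x) by [].
have c2 s : step_integral (c s) = step_integral s.
  by apply: eq_bigr => i _ /=; rewrite hf //; exact: step_measurable.
split.
  by have [s hs] := hF; exists (fun n => c (s n)) => x; exact: hs.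
move=> e e0; have [s [h1 h2]] := h _ e0; exists (c s); rewrite c2; split=> //.
rewrite (le_trans _ h1) //.
have m3 := step_limit_measurableN s hF.
pose m' : {measure set T -> \bar R} :=
  measure_function_pushforward__canonical__measure_function_Measure mu mf.
have -> : (\int[mu]_x (rnorm (F x - step_app s x))%:E =
   \int[m']_x (rnorm (F x - step_app s x))%:E)%E.
  by apply: eq_measure_integral => A mA _; rewrite /m' /= /pushforward hf.
rewrite [leRHS]ge0_integral_pushforward //.
  by apply/measurable_EFinP.
by move=> x _; rewrite lee_fin rnorm_ge0.
Qed.

Lemma step_integral_dist F s t : step_limit F ->
  ((rnorm (step_integral s - step_integral t))%:E <=
   \int[mu]_x (rnorm (F x - step_app s x))%:E + \int[mu]_x (rnorm (F x - step_app t x))%:E)%E.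
Proof.
move=> hF; have := step_integral_le (step_comb (-1) t s).
rewrite step_comb_integral scaleN1r addrC => h; rewrite (le_trans h) //.
have m1 := step_limit_measurableN s hF; have m2 := step_limit_measurableN t hF.
rewrite -ge0_integralD //; try by [move=> x _; rewrite lee_fin rnorm_ge0|exact/measurable_EFinP].
apply: ge0_le_integral => //.
- by move=> x _; rewrite lee_fin rnorm_ge0.
- apply/measurable_EFinP; have := measurable_step_app (step_comb (-1) t s) 0.
  by apply: eq_measurable_fun => x _; rewrite add0r.
- by apply/measurable_EFinP; exact: measurable_funD.
- move=> x _; rewrite -EFinD lee_fin step_comb_app [rnorm (F x - _)]rdistC.
  rewrite (le_trans _ (rnormD _ _)) // le_eqVlt; apply/orP; left; apply/eqP; congr rnorm; linx R[i].
Qed.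

End general.

Lemma bint_map {X Y : normedModType R[i]} (V : X -> Y) (M : R) (F : T -> X) y : linear V -> 0 <= M ->
  (forall x, rnorm (V x) <= M * rnorm x) -> bint F y -> bint (fun x => V (F x)) (V y).
Proof.
move=> lV M0 bV [hF h].
pose c (s : step_fun mu) : @step_fun R Y disp T mu :=
  @StepFun R Y disp T mu _ _ (fun i => V (step_val i)) (@step_measurable _ _ _ _ _ s) (@step_finite _ _ _ _ _ s).
have c1 s x : step_app (c s) x = V (step_app s x).
  by rewrite /step_app (linr_sum lV); apply: eq_bigr => i _; rewrite (linrZ lV).
have c2 s : step_integral (c s) = V (step_integral s).
  by rewrite /step_integral (linr_sum lV); apply: eq_bigr => i _; rewrite (linrZ lV).
have hVF : step_limit (fun x => V (F x)).
  have [s hs] := hF; exists (fun n => c (s n)) => x; apply/rnorm_cvgP.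
  have /rnorm_cvgP := hs x => hx.
  apply: (@squeeze_cvgr _ _ _ _ (fun=> 0) (fun n => M * rnorm (step_app (s n) x - F x))).
  - by near=> n; rewrite rnorm_ge0 c1 -(linrB lV) bV.
  - exact: cvg_cst.
  - by rewrite -(mulr0 M); apply: cvgMr.
split=> // e e0; have M1 : 0 < M + 1 by rewrite ltr_wpDl.
have [s [h1 h2]] := h (e / (M + 1)) (divr_gt0 e0 M1); exists (c s).
have Me : M * (e / (M + 1)) <= e.
  by rewrite mulrCA ger_pMr // ler_pdivrMr // mul1r lerDl.
split; last by rewrite c2 -(linrB lV) (le_trans (bV _)) // (le_trans _ Me) // ler_wpM2l.
rewrite (@le_trans _ _ (M * (e / (M + 1)))%:E) ?lee_fin // EFinM.
rewrite (@le_trans _ _ (M%:E * \int[mu]_x (rnorm (F x - step_app s x))%:E)%E) //; last first.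
  by rewrite lee_wpmul2l // lee_fin.
have m1 := step_limit_measurableN s hF.
rewrite -integral_ge0Zl //; last by move=> x; exact: rnorm_ge0.
apply: ge0_le_integral => //.
- by move=> x _; rewrite lee_fin rnorm_ge0.
- apply/measurable_EFinP; exact: step_limit_measurableN.
- by apply/measurable_EFinP; apply: measurable_funM.
- by move=> x _; rewrite -EFinM lee_fin c1 -(linrB lV).
Unshelve. all: by end_near. Qed.

Lemma rcauchy_cvg {X : completeNormedModType R[i]} (u : nat -> X) :
  (forall e : R, 0 < e -> exists N, forall n, (N <= n)%N -> rnorm (u N - u n) <= e) ->
  exists y : X, u n @[n --> \oo] --> y.
Proof.
move=> h; apply/cvg_ex; apply: cauchy_cvg; apply: cauchy_exP => e e0.
have [r er] : exists r, e = r%:C.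
  by exists (complex.Re e); move: e0; case: (e) => a b; rewrite ltcE /= => /andP[/eqP -> _].
rewrite {}er in e0 *; rewrite ltr_rC in e0.
have [N hN] := h (r / 2) (divr_gt0 e0 (ltr0Sn _ 1)).
exists (u N); exists N => // n /= Nn; rewrite -ball_normE /= rnormE ltr_rC.
by rewrite (le_lt_trans (hN _ Nn)) // gtr_pMr // invf_lt1 // ltr1n.
Qed.

(** Scalar dominated convergence for the real functions [rnorm (F x - step_app (s n) x)], which are
    bounded by [2 g]. *)
Lemma dominated_steps {X : normedModType R[i]} (F : T -> X) (s : nat -> step_fun mu) (g : T -> R) :
  (forall x, step_app (s n) x @[n --> \oo] --> F x) ->
  (forall n x, rnorm (step_app (s n) x) <= g x) -> (forall x, rnorm (F x) <= g x) ->
  mu.-integrable setT (EFin \o g) -> forall e : R, 0 < e -> \forall n \near \oo,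
    (\int[mu]_x (rnorm (F x - step_app (s n) x))%:E <= e%:E)%E.
Proof.
move=> hs hg hF ig; have sF : step_limit F by exists s.
have key : (\int[mu]_x (rnorm (F x - step_app (s n) x))%:E)%E @[n --> \oo] --> 0%E.
  have [] := @dominated_convergence _ _ _ mu setT measurableT
    (fun n x => (rnorm (F x - step_app (s n) x))%:E) (fun=> 0%E) (fun x => (2%:E * (g x)%:E)%E).
  - by move=> n; apply/measurable_EFinP; exact: step_limit_measurableN.
  - exact: measurable_cst.
  - apply: aeW => x _; apply/fine_cvgP; split; first exact: nearW.
    by have /rnorm_cvgP := hs x; apply: cvg_trans; apply: near_eq_cvg; near=> n; rewrite /= rdistC.
  - exact: integrableZl.
  - apply: aeW => x n _; rewrite /= ger0_norm ?rnorm_ge0 // -EFinM lee_fin.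
    by rewrite mulr_natl mulr2n (le_trans (rnormB _ _)) // lerD.
  by move=> _ _; rewrite integral0.
have /fine_cvgP[fin cv] := key.
move=> e e0; have := cvg0_seq_near cv e0; move: fin; apply: filterS2 => n n1 n2.
by rewrite -(fineK n1) lee_fin.
Unshelve. all: by end_near. Qed.

(** The distance of two step integrals is at most the sum of their integrated distances to [F], so
    the step integrals are Cauchy and completeness of [X] provides the value. *)
Lemma bint_dominated {X : completeNormedModType R[i]} (F : T -> X) (s : nat -> step_fun mu) (g : T -> R) :
  (forall x, step_app (s n) x @[n --> \oo] --> F x) ->
  (forall n x, rnorm (step_app (s n) x) <= g x) -> (forall x, rnorm (F x) <= g x) ->
  mu.-integrable setT (EFin \o g) -> exists y, bint F y.
Proof.
move=> hs hg hF ig; have sF : step_limit F by exists s.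
have near_le := dominated_steps hs hg hF ig.
have [y hy] : exists y : X, step_integral (s n) @[n --> \oo] --> y.
  apply: rcauchy_cvg => e e0; have [N _ hN] := near_le _ (divr_gt0 e0 (ltr0Sn _ 1)).
  exists N => n Nn; rewrite -lee_fin (le_trans (step_integral_dist _ _ sF)) //.
  by rewrite (splitr e) EFinD leeD //; apply: hN => /=.
exists y; split=> // e e0.
have [N1 _ h1] := near_le _ e0; have [N2 _ h2] := rnorm_seq_near hy e0.
by exists (s (N1 + N2)%N); split; [apply: h1|apply: h2]; rewrite /=; lia.
Qed.

End bochner_integrals.

(** * Grid step functions for continuous integrands *)

Section grid.
Context {R : realType} {d : nat}.
Local Notation E := (rvec R d * rvec R d)%type.

(** At level [n] each axis interval [[-(n+1), n+1)] is cut with mesh [1/(n+1)] into [2 (n+1)^2]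
    pieces: one index makes the grid both finer and larger. *)
Definition grid_pt (n k : nat) : R := k%:R / n.+1%:R - n.+1%:R.
Definition grid_itv (n k : nat) : set (measurableTypeR R) :=
  [set` `[grid_pt n k, grid_pt n k + n.+1%:R^-1[].
Definition grid_idx (n : nat) (x : R) : nat := Num.truncn (n.+1%:R * (x + n.+1%:R)).

Lemma grid_itvP n k (x : R) : grid_itv n k x -> grid_idx n x = k.
Proof.
rewrite /grid_itv /= in_itv /= /grid_pt => /andP[h1 h2]; apply: truncn_def.
have N0 : 0 < n.+1%:R :> R by rewrite ltr0n.
apply/andP; split.
  by rewrite mulrC -ler_pdivrMr // -lerBlDr.
have {}h2 : (x < k%:R / n.+1%:R - n.+1%:R + n.+1%:R^-1 :> R) := h2.
rewrite mulrC -ltr_pdivlMr // -(natr1 k) mulrDl mul1r.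
by move: h2; set a : R := k%:R / _; set w : R := _^-1; set N : R := n.+1%:R => h2; lra.
Qed.

Lemma grid_itv_idx n (x : R) : - n.+1%:R <= x -> grid_itv n (grid_idx n x) x.
Proof.
move=> hx; have N0 : 0 < n.+1%:R :> R by rewrite ltr0n.
rewrite /grid_itv /= in_itv /= /grid_pt lerBlDr ler_pdivrMr // [X in _ && X](_ : _ = ((x + n.+1%:R) * n.+1%:R < (grid_idx n x).+1%:R)).
  by rewrite mulrC; apply: truncn_itv; rewrite mulr_ge0 // -lerBlDr sub0r.
rewrite -ltr_pdivlMr // -(natr1 (grid_idx n x)) mulrDl mul1r.
set a : R := _ / _; set w : R := n.+1%:R^-1; set N : R := n.+1%:R.
have e : (x < a - N + w :> R) = (x + N < a + w :> R) by apply/idP/idP; lra.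
exact: e.
Qed.

Lemma grid_idx_lt n (x : R) : - n.+1%:R <= x -> x < n.+1%:R -> (grid_idx n x < 2 * n.+1 * n.+1)%N.
Proof.
move=> h1 h2; rewrite /grid_idx truncn_lt_nat ?mulr_ge0 // -?lerBlDr ?sub0r //.
rewrite natrM mulrC ltr_pM2r ?ltr0n // natrM mulr_natl mulr2n; lra.
Qed.

Lemma grid_pt_near n (x : R) : - n.+1%:R <= x -> `|grid_pt n (grid_idx n x) - x| <= n.+1%:R^-1.
Proof.
move=> /grid_itv_idx; rewrite /grid_itv /= in_itv /= => /andP[]; set y : R := grid_pt n _; set w : R := n.+1%:R^-1 => h1 h2.
have {}h1 : y <= x := h1; have {}h2 : x < y + w := h2.
have w0 : 0 <= w by rewrite invr_ge0.
rewrite ler_norml; lra.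
Qed.

Definition gidx (n : nat) : finType := ({ffun 'I_d -> 'I_(2 * n.+1 * n.+1)} * {ffun 'I_d -> 'I_(2 * n.+1 * n.+1)})%type.
Definition gpt n (k : gidx n) : E :=
  ([tuple grid_pt n (k.1 i) | i < d], [tuple grid_pt n (k.2 i) | i < d]).
Definition gbox n (f : 'I_d -> 'I_(2 * n.+1 * n.+1)) : set (rvec R d) :=
  [set t | forall i, grid_itv n (f i) (tnth t i)].
Definition gcell n (k : gidx n) : set E := gbox k.1 `*` gbox k.2.

Lemma gbox_measurable n f : measurable (@gbox n f).
Proof.
rewrite (_ : gbox f = \bigcap_(i in [set: 'I_d]) ((fun t : rvec R d => tnth t i) @^-1` grid_itv n (f i))).
  apply: fin_bigcap_measurable => // i _; apply: measurable_preimageT; first exact: measurable_tnth.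
  exact: measurable_itv.
by apply/seteqP; split=> t /= H i; [move=> _; exact: H | exact: H i I].
Qed.

Lemma gbox_finite n f : (lebesgue_rvec d (@gbox n f) < +oo)%E.
Proof.
rewrite (@lebesgue_rvec_box _ _ (fun i => grid_itv n (f i))); last by move=> i; exact: measurable_itv.
apply: (@proj2 (0 <= \prod_(i < d) lebesgue_measure (grid_itv n (f i)))%E).
elim/big_rec: _ => [|i x _ [x0 xoo]]; first by split; rewrite ?lee01 ?ltry.
have h : lebesgue_measure (grid_itv n (f i)) \is a fin_num.
  by rewrite lebesgue_measure_itv /= lte_fin; case: ifP.
by split; [apply: mule_ge0|apply: lte_mul_pinfty].
Qed.

Lemma gcell_measurable n (k : gidx n) : measurable (gcell k).
Proof. by apply: measurableX; exact: gbox_measurable. Qed.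

Lemma gcell_finite n (k : gidx n) : (lebesgue2 (gcell k) < +oo)%E.
Proof.
have e : lebesgue2 (gcell k) = (lebesgue_rvec d (gbox k.1) * lebesgue_rvec d (gbox k.2))%E.
  by apply: product_measure1E; exact: gbox_measurable.
by rewrite e; apply: lte_mul_pinfty; rewrite ?ge0_fin_numE //; exact: gbox_finite.
Qed.

(** Coordinatewise convergence of sequences is all that rounding to the grid asks for, so continuity
    of integrands is taken in the sequential sense. *)
Definition pcvg (q : nat -> E) (p : E) :=
  forall i, tnth (q n).1 i @[n --> \oo] --> (tnth p.1 i : R) /\
            tnth (q n).2 i @[n --> \oo] --> (tnth p.2 i : R).

Definition grid_round n (p : E) : E :=
  ([tuple grid_pt n (grid_idx n (tnth p.1 i)) | i < d], [tuple grid_pt n (grid_idx n (tnth p.2 i)) | i < d]).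

Definition grid_in n (p : E) := forall i,
  (- n.+1%:R <= tnth p.1 i < n.+1%:R) /\ (- n.+1%:R <= tnth p.2 i < n.+1%:R).

Lemma grid_in_near (p : E) : \forall n \near \oo, grid_in n p.
Proof.
pose M := \sum_(i < d) (`|tnth p.1 i| + `|tnth p.2 i|) : R.
exists (Num.truncn M) => // n /= hn i.
have hM : M < n.+1%:R by rewrite (lt_le_trans (truncnS_gt M)) // ler_nat.
have : `|tnth p.1 i| + `|tnth p.2 i| <= M.
  by rewrite /M (bigD1 i) //= lerDl sumr_ge0 // => j _; rewrite addr_ge0.
have := ler_norm (tnth p.1 i); have := ler_norm (tnth p.2 i).
have := ler_norm (- tnth p.1 i); have := ler_norm (- tnth p.2 i); rewrite !normrN.
by have := normr_ge0 (tnth p.1 i); have := normr_ge0 (tnth p.2 i) => *; lra.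
Qed.

Lemma grid_round_cvg (p : E) : pcvg (fun n => grid_round n p) p.
Proof.
have [N _ hN] := grid_in_near p.
have key (x : R) : (forall n, (N <= n)%N -> - n.+1%:R <= x) ->
    grid_pt n (grid_idx n x) @[n --> \oo] --> x.
  move=> hx; apply/cvgrPdist_le => /= e e0.
  have := cvg0_seq_near (@cvg_harmonic R) e0; move=> [N' _ hN'].
  exists (maxn N N') => // n /=; rewrite geq_max => /andP[n1 n2].
  by rewrite distrC (le_trans (grid_pt_near (hx _ n1))) // hN'.
by move=> i; split; under eq_fun => n do rewrite tnth_mktuple; apply: key => n /hN /(_ i) [/andP[? ?] /andP[? ?]].
Qed.

Context {X : normedModType R[i]}.
Implicit Types (F : E -> X).

Definition grid_step F n : @step_fun R X _ E (@lebesgue2 R d) :=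
  @StepFun R X _ E (@lebesgue2 R d) #|gidx n| (fun j => gcell (enum_val j)) (fun j => F (gpt (enum_val j)))
    (fun j => gcell_measurable (enum_val j)) (fun j => gcell_finite (enum_val j)).

Lemma grid_step_sum F n p : step_app (grid_step F n) p = \sum_(k : gidx n) (\1_(gcell k) p : R)%:C *: F (gpt k).
Proof. by rewrite [RHS]big_enum_val. Qed.

Lemma grid_step_app F n p : grid_in n p -> step_app (grid_step F n) p = F (grid_round n p).
Proof.
move=> hp; rewrite grid_step_sum.
have h1 i : (grid_idx n (tnth p.1 i) < 2 * n.+1 * n.+1)%N by have [/andP[? ?] _] := hp i; exact: grid_idx_lt.
have h2 i : (grid_idx n (tnth p.2 i) < 2 * n.+1 * n.+1)%N by have [_ /andP[? ?]] := hp i; exact: grid_idx_lt.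
pose k0 : gidx n := ([ffun i => Ordinal (h1 i)], [ffun i => Ordinal (h2 i)]).
rewrite (bigD1 k0) //= big1 ?addr0.
  rewrite indicE mem_set ?scale1r; last first.
    by split=> i; rewrite ffunE /=; apply: grid_itv_idx; have [/andP[? ?] /andP[? ?]] := hp i.
  by congr F; congr pair; apply: eq_from_tnth => i; rewrite !tnth_mktuple ffunE.
move=> k kk0; rewrite indicE memNset ?scale0r // => -[c1 c2]; case/eqP: kk0.
by case: k c1 c2 => a b c1 c2; congr pair; apply/ffunP => i; apply: val_inj; rewrite ffunE /=; apply/esym/grid_itvP;
 [exact: c1|exact: c2].
Qed.

(** Inside the cube the step function takes a value of [F] at a nearby grid point [q]; the bound on
    [nq p] lets the Gaussian decay of [F] at [q] control the step function at [p], uniformly in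
    [n]. *)
Lemma grid_step_out F n p : step_app (grid_step F n) p = 0 \/
  exists2 q : E, step_app (grid_step F n) p = F q & nq p <= 2 * nq q + 4 * d%:R.
Proof.
have [hp|hp] := pselect (grid_in n p).
  right; exists (grid_round n p); first exact: grid_step_app.
  have key (x : R) : - n.+1%:R <= x -> x * x <= 2 * (grid_pt n (grid_idx n x) * grid_pt n (grid_idx n x)) + 2.
    move=> /grid_pt_near; set y := grid_pt _ _; rewrite distrC => h.
    have h1 : `|x - y| <= 1 by rewrite (le_trans h) // invf_le1 ?ltr0n // ler1n.
    have h2 : (x - y) ^+ 2 <= 1 by rewrite -(real_normK (num_real _)) expr_le1.
    (* [2 y^2 + 2 - x^2 = 2 (1 - (x - y)^2) + (x - 2 y)^2]. *)
    have := sqr_ge0 (x - 2 * y); nra.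
  have sum2 (u : rvec R d) : (forall i, - n.+1%:R <= tnth u i) ->
    dotv u u <= 2 * dotv [tuple grid_pt n (grid_idx n (tnth u i)) | i < d] [tuple grid_pt n (grid_idx n (tnth u i)) | i < d] + 2 * d%:R.
    move=> hu; rewrite /dotv mulr_sumr mulr_natr (_ : 2 *+ d = \sum_(i < d) 2) -?big_split /=; last by rewrite sumr_const card_ord.
    by apply: ler_sum => i _; rewrite !tnth_mktuple; apply: key.
  have := sum2 p.1 (fun i => (andP (hp i).1).1); have := sum2 p.2 (fun i => (andP (hp i).2).1).
  by rewrite /nq /=; lra.
left; rewrite grid_step_sum big1 // => k _; rewrite indicE memNset ?scale0r // => -[c1 c2]; apply: hp => i.
have key (j : 'I_(2 * n.+1 * n.+1)) (x : R) : grid_itv n j x -> - n.+1%:R <= x < n.+1%:R.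
  have N0 : 0 < n.+1%:R :> R by rewrite ltr0n.
  rewrite /grid_itv /= in_itv /= /grid_pt => /andP[h1 h2]; apply/andP; split.
    by rewrite (le_trans _ h1) // lerDr divr_ge0 // ltW.
  have : (j.+1%:R / n.+1%:R <= 2 * n.+1%:R :> R) by rewrite ler_pdivrMr // -!natrM ler_nat ltn_ord.
  rewrite -(natr1 j) mulrDl mul1r => h3.
  have {}h2 : (x < j%:R / n.+1%:R - n.+1%:R + n.+1%:R^-1 :> R) := h2.
  by move: h2 h3; set a : R := j%:R / _; set w : R := _^-1; set N : R := n.+1%:R => h2 h3; lra.
by split; [exact: key (c1 i)|exact: key (c2 i)].
Qed.

Definition scont F := forall q p, pcvg q p -> F (q n) @[n --> \oo] --> F p.
Definition gdom F := exists M e : R, [/\ 0 <= M, 0 < e & forall p, rnorm (F p) <= M * expR (- (e * nq p))].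

Lemma grid_step_cvg F p : scont F -> step_app (grid_step F n) p @[n --> \oo] --> F p.
Proof.
move=> hF; have := hF _ _ (grid_round_cvg p); apply: cvg_trans; apply: near_eq_cvg.
by have := grid_in_near p; apply: filterS => n /grid_step_app ->.
Qed.

Lemma gauss_integrable (M c : R) : 0 < c ->
  (@lebesgue2 R d).-integrable setT (EFin \o (fun p => M * expR (- (c * nq p)))).
Proof.
move=> c0; rewrite (_ : EFin \o _ = fun p => (M%:E * (expR (- (c * nq p)))%:E)%E) //.
apply: integrableZl => //; apply/integrableP; split.
  by apply/measurable_EFinP; exact: measurable_gauss2.
under eq_integral => p _ do rewrite /= ger0_norm ?expR_ge0 //.
by rewrite gauss_lebesgue2 // ltry.
Qed.

Lemma nq_ge0 (p : E) : 0 <= nq p.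
Proof. by rewrite addr_ge0 // sumr_ge0 // => i _; rewrite -expr2 sqr_ge0. Qed.

Lemma grid_step_dominated F : gdom F -> exists M c : R, [/\ 0 < c,
  forall n p, rnorm (step_app (grid_step F n) p) <= M * expR (- (c * nq p)) &
  forall p, rnorm (F p) <= M * expR (- (c * nq p))].
Proof.
(* From [nq p <= 2 nq q + 4 d] follows [e nq q >= (e / 2) nq p - 2 d e]: the rate is halved and the
   constant gains [expR (2 d e)]. *)
move=> [M [e [M0 e0 dF]]]; pose M' := M * expR (2 * d%:R * e).
have MM' : M <= M' by rewrite ler_peMr // -expR0 ler_expR !mulr_ge0 // ltW.
have e2 : 0 < e / 2 by rewrite divr_gt0.
exists M', (e / 2); split=> //.
- move=> n p; have [->|[q -> hq]] := grid_step_out F n p.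
    by rewrite rnorm0 !mulr_ge0 ?expR_ge0.
  rewrite (le_trans (dF q)) // /M' -mulrA; apply: ler_wpM2l => //; rewrite -expRD ler_expR.
  have : e / 2 * nq p <= e / 2 * (2 * nq q + 4 * d%:R) by rewrite ler_pM2l.
  lra.
- move=> p; rewrite (le_trans (dF p)) // ler_pM ?expR_ge0 // ler_expR lerN2 ler_wpM2r ?nq_ge0 //; lra.
Qed.

End grid.

Section continuous_integral.
Context {R : realType} {d : nat} {X : completeNormedModType R[i]}.
Local Notation E := (rvec R d * rvec R d)%type.
Implicit Types (F : E -> X).

Lemma bint_exists F : scont F -> gdom F -> exists y, bint (@lebesgue2 R d) F y.
Proof.
move=> hF /grid_step_dominated[M [c [c0 h1 h2]]].
apply: (@bint_dominated _ _ _ _ _ F (grid_step F) (fun p => M * expR (- (c * nq p)))) => //.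
- by move=> p; exact: grid_step_cvg.
- exact: gauss_integrable.
Qed.

(* Locked so that comparing two different integrals does not unfold them. *)
Definition gint F : X := locked (bochner (@lebesgue2 R d) F).

Lemma gintE F : gint F = bochner (@lebesgue2 R d) F.
Proof. by rewrite /gint -lock. Qed.

Lemma gintP F : scont F -> gdom F -> bint (@lebesgue2 R d) F (gint F).
Proof. by move=> hF dF; have [y hy] := bint_exists hF dF; rewrite gintE (bochnerE hy). Qed.

End continuous_integral.

(** * Gaussian decay and weights of quadratic growth *)

Section gauss_functions.
Context {R : realType} {d : nat}.
Local Notation E := (rvec R d * rvec R d)%type.

Section growth.
Context {X : normedModType R[i]}.
Implicit Types (F G : E -> X) (k : E -> R[i]^o).

Definition gfun F := scont F /\ gdom F.
(** Covers the weights produced by differentiation: linear ones from a translation of the variable,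
    [nq] from the exponent of the Gaussian. Multiplication by such a weight preserves Gaussian
    decay, so weights may be iterated. *)
Definition qgrowth k := scont k /\ exists2 K : R, 0 <= K & forall p, cabs (k p) <= K * (1 + nq p).

Lemma scontD F G : scont F -> scont G -> scont (fun p => F p + G p).
Proof. by move=> hF hG q p qp; apply: cvgD; [exact: hF|exact: hG]. Qed.

Lemma scontM k F : scont k -> scont F -> scont (fun p => k p *: F p).
Proof. by move=> hk hF q p qp; apply: cvgZ; [exact: hk|exact: hF]. Qed.

Lemma scont_cst (x : X) : scont (fun _ : E => x).
Proof. by move=> q p _; exact: cvg_cst. Qed.

Lemma gfunD F G : gfun F -> gfun G -> gfun (fun p => F p + G p).
Proof.
move=> [hF [M [e [M0 e0 H]]]] [hG [M' [e' [M0' e0' H']]]]; split; first exact: scontD.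
exists (M + M'), (Num.min e e'); split; [exact: addr_ge0|by rewrite lt_min e0|].
move=> p; rewrite (le_trans (rnormD _ _)) // mulrDl lerD //.
  by rewrite (le_trans (H p)) // ler_wpM2l // ler_expR lerN2 ler_wpM2r ?nq_ge0 // ge_min lexx.
by rewrite (le_trans (H' p)) // ler_wpM2l // ler_expR lerN2 ler_wpM2r ?nq_ge0 // ge_min lexx orbT.
Qed.

(** Polynomial growth is paid for with an arbitrarily small share of the Gaussian decay. *)
Lemma lin_le_expR (e t : R) : 0 < e -> 0 <= t -> 1 + t <= (1 + e^-1) * expR (e * t).
Proof.
move=> e0 t0; have h := expR_ge1Dx (e * t).
have e1 : 0 < e^-1 by rewrite invr_gt0.
have : e^-1 * (1 + e * t) <= e^-1 * expR (e * t) by rewrite ler_pM2l.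
rewrite mulrDr mulr1 mulKf ?gt_eqF // => h2.
have : 0 <= e * t by rewrite mulr_ge0 // ltW.
rewrite mulrDl mul1r; lra.
Qed.

Lemma gfunM k F : qgrowth k -> gfun F -> gfun (fun p => k p *: F p).
Proof.
move=> [hk [K K0 HK]] [hF [M [e [M0 e0 H]]]]; split; first exact: scontM.
have e2 : 0 < e / 2 by rewrite divr_gt0.
exists (K * (1 + (e / 2)^-1) * M), (e / 2); split=> //.
  by rewrite !mulr_ge0 // addr_ge0 // invr_ge0 ltW.
move=> p; rewrite rnormZ (le_trans (ler_pM _ _ (HK p) (H p))) ?cabs_ge0 ?rnorm_ge0 //.
have h := lin_le_expR e2 (nq_ge0 p).
have -> : expR (- (e * nq p)) = expR (- (e / 2 * nq p)) * expR (- (e / 2 * nq p)).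
  by rewrite -expRD; congr expR; lra.
have h1 : (1 + nq p) * expR (- (e / 2 * nq p)) <= 1 + (e / 2)^-1.
  by rewrite expRN ler_pdivrMr ?expR_gt0.
have := expR_ge0 (- (e / 2 * nq p)); set x := expR (- (e / 2 * _)) in h1 *; move=> x0.
have -> : K * (1 + nq p) * (M * (x * x)) = K * M * x * ((1 + nq p) * x) by ring.
have -> : K * (1 + (e / 2)^-1) * M * x = K * M * x * (1 + (e / 2)^-1) by ring.
by rewrite ler_wpM2l // !mulr_ge0.
Qed.

Lemma gfunZ (c : R[i]) F : gfun F -> gfun (fun p => c *: F p).
Proof.
apply: gfunM; split; first by move=> q p _; exact: cvg_cst.
exists (cabs c); first exact: cabs_ge0.
by move=> p; rewrite ler_peMr ?cabs_ge0 // lerDl nq_ge0.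
Qed.

End growth.

Section scalars.
Implicit Types (k l : E -> R[i]^o).

Lemma qgrowthD k l : qgrowth k -> qgrowth l -> qgrowth (fun p => k p + l p).
Proof.
move=> [hk [K K0 HK]] [hl [L L0 HL]]; split; first exact: scontD.
by exists (K + L) => [|p]; rewrite ?addr_ge0 // mulrDl (le_trans (cabsD _ _)) // lerD.
Qed.

Lemma scontMs k l : scont k -> scont l -> scont (fun p => k p * l p : R[i]^o).
Proof. by move=> hk hl q p qp; apply: (@cvgM R[i]); [exact: hk|exact: hl]. Qed.

Lemma qgrowthZ (c : R[i]) k : qgrowth k -> qgrowth (fun p => c * k p).
Proof.
move=> [hk [K K0 HK]]; split; first by apply: (scontMs _ hk); exact: scont_cst.
exists (cabs c * K) => [|p]; first by rewrite mulr_ge0 ?cabs_ge0.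
by rewrite cabsM -mulrA ler_wpM2l ?cabs_ge0.
Qed.

Lemma qgrowth_cst (c : R[i]) : qgrowth (fun=> c).
Proof.
split; first exact: scont_cst.
by exists (cabs c) => [|p]; rewrite ?cabs_ge0 // ler_peMr ?cabs_ge0 // lerDl nq_ge0.
Qed.

Lemma scont_real (r : E -> R) :
  (forall q p, pcvg q p -> r (q n) @[n --> \oo] --> r p) -> scont (fun p => (r p)%:C : R[i]^o).
Proof.
move=> h q p qp; apply: rnorm_cvg => e e0; have /cvgrPdist_le/(_ _ e0) := h _ _ qp.
by apply: filterS => n; rewrite -[rnorm _]/(cabs _) -rmorphB cabs_real distrC.
Qed.

Lemma scont_cexp k : scont k -> scont (fun p => cexp (k p) : R[i]^o).
Proof.
move=> hk q p qp; have [C [dd [C0 d0 H]]] := dq_lip (dq_cexp (k p)).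
apply: rnorm_cvg => e e0.
have m0 : 0 < Num.min dd (e / (C + 1)) by rewrite lt_min d0 divr_gt0 // ltr_wpDl.
have := rnorm_seq_near (hk _ _ qp) m0; apply: filterS => n.
rewrite le_min => /andP[h1 h2]; have := H _ h1; rewrite [k p + _]addrC subrK => h3.
rewrite (le_trans h3) //; rewrite ler_pdivlMr ?ltr_wpDl // in h2.
by rewrite (le_trans _ h2) // mulrC ler_wpM2l ?cabs_ge0 // lerDl.
Qed.

(* Coordinates are indexed by [true] for the first factor, [false] for the second. *)
Definition pcoord (c : bool * 'I_d) (p : E) : R := if c.1 then tnth p.1 c.2 else tnth p.2 c.2.

Lemma nq_pcoord p : nq p = \sum_c pcoord c p ^+ 2.
Proof.
rewrite -(pair_big_dep xpredT (fun _ _ => true) (fun b i => pcoord (b, i) p ^+ 2)) /=.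
rewrite big_bool /nq /dotv /=; congr (_ + _); apply: eq_bigr => i _; by rewrite expr2.
Qed.

Lemma pcoord_sqr_le c p : pcoord c p ^+ 2 <= nq p.
Proof. by rewrite nq_pcoord (bigD1 c) //= lerDl sumr_ge0 // => i _; rewrite sqr_ge0. Qed.

Lemma pcoord_abs_le c p : `|pcoord c p| <= 1 + nq p.
Proof.
have := pcoord_sqr_le c p; rewrite -(real_normK (num_real _)).
have := sqr_ge0 (`|pcoord c p| - 1); have := normr_ge0 (pcoord c p); nra.
Qed.

Lemma pcoord_cvg c q p : pcvg q p -> pcoord c (q n) @[n --> \oo] --> pcoord c p.
Proof. by case: c => -[] i /(_ i) []. Qed.

Lemma qgrowth_pcoord c : qgrowth (fun p => (pcoord c p)%:C).
Proof.
split; first by apply: scont_real => q p; exact: pcoord_cvg.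
by exists 1 => // p; rewrite cabs_real mul1r pcoord_abs_le.
Qed.

Lemma nq_cvg q (p : E) : pcvg q p -> nq (q n) @[n --> \oo] --> nq p.
Proof.
move=> qp; rewrite nq_pcoord; under eq_fun => n do rewrite nq_pcoord.
have key (s : seq (bool * 'I_d)) :
    \sum_(c <- s) pcoord c (q n) ^+ 2 @[n --> \oo] --> (\sum_(c <- s) pcoord c p ^+ 2 : R).
  elim: s => [|c s IH]; first by under eq_fun do rewrite big_nil; rewrite big_nil; exact: cvg_cst.
  under eq_fun do rewrite big_cons; rewrite big_cons; apply: cvgD => //.
  by apply: cvgM; exact: pcoord_cvg.
exact: key.
Qed.

Lemma qgrowth_nq : qgrowth (fun p => (nq p)%:C).
Proof.
split; first by apply: scont_real => q p; exact: nq_cvg.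
by exists 1 => // p; rewrite cabs_real ger0_norm ?nq_ge0 // mul1r lerDr.
Qed.

End scalars.

Section gauss_kernel.
Context {X : normedModType R[i]}.
Implicit Types (F U : E -> X).

Definition bcont U := scont U /\ exists2 M : R, 0 <= M & forall p, rnorm (U p) <= M.

Lemma gfun_gauss (a : R[i]) U : 0 < complex.Re a -> bcont U ->
  gfun (fun p => cexp (- a * (nq p)%:C) *: U p).
Proof.
move=> a0 [hU [M M0 HM]]; split.
  apply: scontM => //; apply: scont_cexp.
  by have [] := qgrowthZ (- a) qgrowth_nq.
exists M, (complex.Re a); split=> // p; rewrite rnormZ cabs_cexp mulrC ler_pM ?rnorm_ge0 ?expR_ge0 //.
by rewrite ler_expR; case: (a) => x y /=; rewrite mulr0 subr0 mulNr.
Qed.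

(** What differentiation of the integral of [e^(h k) F] at [h = 0] requires. Since [k] may grow like
    [nq], the factor [e^(h k)] can itself be a growing Gaussian, so [h] must be small compared with
    the decay rate of [F]. *)
Lemma gfun_cexp k F : qgrowth k -> gfun F -> exists C e dd : R, [/\ 0 <= C, 0 < e, 0 < dd &
  forall h : R[i], cabs h <= dd -> gfun (fun p => cexp (h * k p) *: F p) /\
   forall p, rnorm ((cexp (h * k p) - 1 - h * k p) *: F p) <= C * cabs h ^+ 2 * expR (- (e * nq p))].
Proof.
move=> [hk [K K0 HK]] [hF [M [e [M0 e0 H]]]].
have e8 : 0 < e / 8 by rewrite divr_gt0.
pose C1 := 1 + (e / 8)^-1; have C10 : 0 <= C1 by rewrite addr_ge0 // invr_ge0 ltW.
have K1 : 0 < K + 1 by rewrite ltr_wpDl.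
(* For [|h|] up to this radius, [|h k p|] is at most [(e / 4) (1 + nq p)]. *)
pose dd := e / 4 / (K + 1).
have d0 : 0 < dd by rewrite !divr_gt0.
have hexp h p : cabs h <= dd -> expR (cabs h * cabs (k p)) <= expR (e / 4) * expR (e / 4 * nq p).
  move=> hd; rewrite -expRD ler_expR.
  have hk1 : cabs h * cabs (k p) <= dd * ((K + 1) * (1 + nq p)).
    rewrite ler_pM ?cabs_ge0 // (le_trans (HK p)) // ler_wpM2r ?lerDl //.
    by rewrite addr_ge0 // nq_ge0.
  by rewrite (le_trans hk1) // mulrA /dd divfK ?gt_eqF // mulrDr mulr1.
(* Of the rate [e], one quarter pays for [cabs (k p) ^+ 2] (two shares of [e / 8]), one quarter for
   [e^(|h k|)], and one half is left over. *)
exists (3 * (K * C1) ^+ 2 * expR (e / 4) * M), (e / 2), dd; split=> //.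
- by rewrite !mulr_ge0 ?expR_ge0 ?sqr_ge0.
- by rewrite divr_gt0.
move=> h hd; split.
  split.
    have sk : scont (fun p => h * k p : R[i]^o) := scontMs (@scont_cst R[i]^o h) hk.
    exact: (scontM (scont_cexp sk) hF).
  exists (expR (e / 4) * M), (e / 2); split; [by rewrite mulr_ge0 ?expR_ge0|by rewrite divr_gt0|].
  move=> p; rewrite rnormZ cabs_cexp (le_trans (ler_pM _ _ (_ : _ <= expR (e / 4) * expR (e / 4 * nq p)) (H p))) ?expR_ge0 ?rnorm_ge0 //.
    rewrite (le_trans _ (hexp h p hd)) // ler_expR -cabsM.
    exact: le_trans (ler_norm _) (Re_le_cabs _).
  rewrite mulrACA ler_wpM2l ?mulr_ge0 ?expR_ge0 // -expRD ler_expR.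
  have := nq_ge0 p; have := mulr_ge0 (ltW e0) (nq_ge0 p); lra.
move=> p; rewrite rnormZ.
have b1 := cexp_sub1z (h * k p); rewrite cabsM in b1.
have b2 : cabs (k p) <= K * (C1 * expR (e / 8 * nq p)).
  by rewrite (le_trans (HK p)) // ler_wpM2l // lin_le_expR // nq_ge0.
have b3 : cabs (k p) ^+ 2 <= (K * C1) ^+ 2 * expR (e / 4 * nq p).
  have -> : expR (e / 4 * nq p) = expR (e / 8 * nq p) ^+ 2.
    by rewrite expr2 -expRD; congr expR; lra.
  have := ler_pM (cabs_ge0 _) (cabs_ge0 _) b2 b2; rewrite -!expr2 => /le_trans; apply.
  by rewrite le_eqVlt; apply/orP; left; apply/eqP; ring.
rewrite (le_trans (ler_pM _ _ b1 (H p))) ?cabs_ge0 ?rnorm_ge0 //.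
have -> : expR (- (e / 2 * nq p)) = expR (e / 4 * nq p) * expR (e / 4 * nq p) * expR (- (e * nq p)).
  by rewrite -!expRD; congr expR; lra.
have x0 := expR_ge0 (e / 4 * nq p); set x := expR (e / 4 * nq p) in b3 x0 *.
have y0 := expR_ge0 (- (e * nq p)); set y := expR (- (e * nq p)) in y0 *.
have := hexp h p hd; rewrite -/x => b4.
have -> : 3 * (K * C1) ^+ 2 * expR (e / 4) * M * cabs h ^+ 2 * (x * x * y) =
  3 * cabs h ^+ 2 * ((K * C1) ^+ 2 * x) * (expR (e / 4) * x) * (M * y) by ring.
have c0 : 0 <= 3 * cabs h ^+ 2 by rewrite mulr_ge0 // sqr_ge0.
apply: ler_wpM2r; first exact: mulr_ge0.
apply: ler_pM; [|exact: expR_ge0| |exact: b4]; first by rewrite mulr_ge0 // sqr_ge0.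
by have := ler_wpM2l c0 b3; rewrite [(cabs h * _) ^+ 2]exprMn -!mulrA.
Qed.

End gauss_kernel.
End gauss_functions.

(** * Integrals of Gaussian functions, vector-valued and scalar *)

Section gauss_integrals.
Context {R : realType} {d : nat}.
Local Notation E := (rvec R d * rvec R d)%type.

Section vector.
Context {X : completeNormedModType R[i]}.
Implicit Types (F G : E -> X).

Lemma gint_bint F : gfun F -> bint (@lebesgue2 R d) F (gint F).
Proof. by move=> [hF dF]; exact: gintP. Qed.

Lemma gint_eq F y : bint (@lebesgue2 R d) F y -> gint F = y.
Proof. by rewrite gintE; exact: bochnerE. Qed.

Lemma eq_gint F G : (forall p, F p = G p) -> gint F = gint G.
Proof. by move=> /funext ->. Qed.

Lemma gint_lin c F G : gfun F -> gfun G -> gint (fun p => c *: F p + G p) = c *: gint F + gint G.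
Proof. by move=> hF hG; apply: gint_eq; apply: bint_lin; exact: gint_bint. Qed.

Lemma gintZ c F : gfun F -> gint (fun p => c *: F p) = c *: gint F.
Proof. by move=> hF; apply: gint_eq; apply: bintZ; exact: gint_bint. Qed.

Lemma gintD F G : gfun F -> gfun G -> gint (fun p => F p + G p) = gint F + gint G.
Proof.
move=> hF hG; have := gint_lin 1 hF hG; rewrite scale1r => <-.
by apply: eq_gint => p; rewrite scale1r.
Qed.

Lemma gint_comb3 c F G H : gfun F -> gfun G -> gfun H ->
  gint (fun p => F p - G p - c *: H p) = gint F - gint G - c *: gint H.
Proof.
move=> hF hG hH.
have e1 : gint (fun p => (-1) *: G p + F p) = (-1) *: gint G + gint F := gint_lin (-1) hG hF.
have e2 := gint_lin (- c) hH (gfunD (gfunZ (-1) hG) hF); rewrite /= e1 in e2.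
transitivity (- c *: gint H + ((-1) *: gint G + gint F)); last by linx R[i].
by rewrite -e2; apply: eq_gint => p; linx R[i].
Qed.

Lemma gint_map (V : X -> X) (M : R) F : linear V -> 0 <= M -> (forall x, rnorm (V x) <= M * rnorm x) ->
  gfun F -> gint (fun p => V (F p)) = V (gint F).
Proof. by move=> lV M0 bV hF; apply: gint_eq; apply: (bint_map lV M0 bV); exact: gint_bint. Qed.

Lemma gint_shift w F : gfun F -> gint (fun p => F (trp w p)) = gint F.
Proof.
move=> hF; apply: gint_eq; apply: bint_shift; [exact: measurable_trp|exact: lebesgue2_translate|exact: gint_bint].
Qed.

Lemma gint_norm F (C e : R) : gfun F -> 0 < e ->
  (forall p, rnorm (F p) <= C * expR (- (e * nq p))) -> rnorm (gint F) <= C * (pi / e) ^+ d.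
Proof.
move=> hF e0 H; have C0 : 0 <= C.
  have := le_trans (rnorm_ge0 _) (H ([tuple 0 | i < d], [tuple 0 | i < d])).
  by rewrite pmulr_lge0 // expR_gt0.
rewrite -lee_fin (le_trans (bint_norm (gint_bint hF))) //.
rewrite EFinM -gauss_lebesgue2 // -(@integral_ge0Zl _ _ _ _ (fun p : E => expR (- (e * nq p))) C C0 (@measurable_gauss2 R d e) (fun p => expR_ge0 _)).
apply: ge0_le_integral => //.
- by move=> p _; rewrite lee_fin rnorm_ge0.
- by apply/measurable_EFinP; exact: (step_limit_norm (gint_bint hF).1).
- have h : measurable_fun setT (EFin \o (fun p : E => C * expR (- (e * nq p)))).
    by apply/measurable_EFinP; apply: measurable_funM => //; exact: measurable_gauss2.
  exact: h.
- by move=> p _; rewrite -EFinM lee_fin.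
Qed.

Lemma dq_gint (k : E -> R[i]^o) F : qgrowth k -> gfun F ->
  dq (fun h => gint (fun p => cexp (h * k p) *: F p)) 0 (gint (fun p => k p *: F p)).
Proof.
move=> hk hF; have [C [e [dd [C0 e0 d0 H]]]] := gfun_cexp hk hF.
exists (C * (pi / e) ^+ d), dd; split=> //.
  by rewrite mulr_ge0 // exprn_ge0 // divr_ge0 ?pi_ge0 // ltW.
move=> h hd; have [H1 H2] := H h hd; have H3 := gfunM hk hF.
pose u : R[i] := -1; have H5 := gfunZ u hF.
rewrite add0r [X in _ - X - _](_ : _ = gint F); last first.
  by apply: eq_gint => p; rewrite mul0r cexp0 scale1r.
have -> : gint (fun p => cexp (h * k p) *: F p) - gint F - h *: gint (fun p => k p *: F p) =
    gint (fun p => (cexp (h * k p) - 1 - h * k p) *: F p).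
  rewrite -(gint_comb3 _ H1 hF H3); apply: eq_gint => p; linx R[i].
rewrite mulrAC; apply: gint_norm => //.
have := gfunD (gfunD H1 H5) (gfunZ (- h) H3); congr gfun; apply/funext => p; rewrite /u; linx R[i].
Qed.

End vector.

Section scalar.
Implicit Types (k : E -> R[i]^o).

(** [psi] stands for the real or the imaginary part, which are linear over the reals only. *)
Lemma step_part_integral (psi : R[i] -> R) (s : @step_fun R R[i]^o _ E (@lebesgue2 R d)) :
  (forall a b, psi (a + b) = psi a + psi b) -> (forall (r : R) c, psi (r%:C * c) = r * psi c) ->
  (@lebesgue2 R d).-integrable setT (EFin \o (fun p => psi (step_app s p))) /\
  \int[@lebesgue2 R d]_p psi (step_app s p) = psi (step_integral s).
Proof.
move=> psiD psiZ; have psi0 : psi 0 = 0 by have := psiZ 0 0; rewrite mul0r mul0r.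
have psi_sum n (f : 'I_n -> R[i]) : psi (\sum_(i < n) f i) = \sum_(i < n) psi (f i).
  by elim/big_rec2: _ => [|i a b _ <-]; rewrite ?psi0 ?psiD.
pose f (i : 'I_(step_size s)) (p : E) : \bar R := ((psi (step_val i))%:E * (\1_(step_set i) p)%:E)%E.
have fi i : (@lebesgue2 R d).-integrable setT (f i).
  apply: integrableZl => //; apply/integrableP; split.
    by apply/measurable_EFinP; apply: measurable_indic; exact: step_measurable.
  under eq_integral => p _ do rewrite /= ger0_norm ?indicE ?ler0n // -indicE.
  rewrite integral_indic //; last exact: step_measurable.
  by rewrite setIT; exact: step_finite.
have e1 : EFin \o (fun p => psi (step_app s p)) = fun p => (\sum_(i < step_size s) f i p)%R.
  apply/funext => p /=; rewrite /step_app psi_sum -sumEFin.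
  by apply: eq_bigr => i _; rewrite /f psiZ EFinM muleC.
split; first by rewrite e1; exact: integrable_sum.
rewrite /Rintegral -[X in fine (integral _ _ X)]/(EFin \o (fun p => psi (step_app s p))) e1 integral_sum //.
have e2 i : (\int[@lebesgue2 R d]_p f i p = (psi (step_val i) * fine (lebesgue2 (step_set i)))%:E)%E.
  rewrite /f integralZl //; last first.
    have mi : measurable (step_set i) := step_measurable i.
    apply/integrableP; split; first by apply/measurable_EFinP; exact: measurable_indic.
    under eq_integral => p _ do rewrite /= ger0_norm ?indicE ?ler0n // -indicE.
    by rewrite integral_indic // setIT; exact: step_finite.
  rewrite integral_indic //; last exact: step_measurable.
  by rewrite setIT EFinM fineK // ge0_fin_numE //; exact: step_finite.
under eq_bigr => i _ do rewrite e2.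
rewrite sumEFin /= /step_integral psi_sum; apply: eq_bigr => i _.
by rewrite -[_ *: _]/(_ * _) psiZ mulrC.
Qed.

(** Reconciles the two integrals of the Weyl calculus: the Fourier transform integrates real and
    imaginary parts in the Lebesgue sense, the calculus itself is a Bochner integral. *)
Lemma bint_scalar k : gfun k -> bint (@lebesgue2 R d) k (complex_integral k).
Proof.
move=> [hk dk]; have [M [c [c0 h1 h2]]] := grid_step_dominated dk.
have cv p := grid_step_cvg (p := p) hk.
have sk : step_limit (@lebesgue2 R d) k by exists (grid_step k).
split=> // e e0; have e2 : 0 < e / 2 by rewrite divr_gt0.
have [N _ hN] := dominated_steps cv h1 h2 (gauss_integrable M c0) e2.
have {hN} := hN N (leqnn N); set s := grid_step k N => hs.
exists s; split; first by rewrite (le_trans hs) // lee_fin; lra.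
have part (psi : R[i] -> R) : (forall a b, psi (a + b) = psi a + psi b) ->
    (forall (r : R) c, psi (r%:C * c) = r * psi c) -> (forall c, `|psi c| <= cabs c) ->
    `|psi (step_integral s) - \int[@lebesgue2 R d]_p psi (k p)| <= e / 2.
  move=> psiD psiZ psiN.
  have psiB a b : psi (a - b) = psi a - psi b by rewrite psiD -mulN1r -(rmorphN1 (real_complex R)) psiZ mulN1r.
  have [is1 is2] := step_part_integral s psiD psiZ.
  have mk : measurable_fun setT (fun p => psi (k p)).
    apply: (@measurable_fun_cvg _ _ _ _ (fun n p => psi (step_app (grid_step k n) p))) => [n|p _].
      have [/integrableP[+ _] _] := step_part_integral (grid_step k n) psiD psiZ.
      by move/measurable_EFinP.
    apply/cvgrPdist_le => /= r r0; have := rnorm_seq_near (cv p) r0; apply: filterS => n.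
    by rewrite distrC -psiB; apply: le_trans; exact: psiN.
  have ik : (@lebesgue2 R d).-integrable setT (EFin \o (fun p => psi (k p))).
    apply: le_integrable (gauss_integrable M c0) => //; first exact/measurable_EFinP.
    move=> p _; rewrite /= lee_fin (le_trans (psiN _)) // (le_trans (h2 p)) // ler_norm //.
  have isk := integrableB measurableT is1 ik.
  rewrite -is2 -RintegralB // -lee_fin EFin_normr_Rintegral //.
  rewrite (le_trans (le_abse_integral _ _ _)) //; first by have /integrableP[] := isk.
  apply: le_trans hs; apply: ge0_le_integral => //.
  - by apply: measurableT_comp => //; have /integrableP[] := isk.
  - by apply/measurable_EFinP; exact: step_limit_measurableN.
  - by move=> p _; rewrite lee_fin -psiB (le_trans (psiN _)) // -[cabs _]/(rnorm _) rdistC.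
have ReD (a b : R[i]) : complex.Re (a + b) = complex.Re a + complex.Re b by rewrite raddfD.
have ImD (a b : R[i]) : complex.Im (a + b) = complex.Im a + complex.Im b by rewrite raddfD.
have ReZ (r : R) (a : R[i]) : complex.Re (r%:C * a) = r * complex.Re a.
  by case: a => x y /=; rewrite mul0r subr0.
have ImZ (r : R) (a : R[i]) : complex.Im (r%:C * a) = r * complex.Im a.
  by case: a => x y /=; rewrite mul0r addr0.
have h3 := part _ ReD ReZ (@Re_le_cabs R); have h4 := part _ ImD ImZ (@Im_le_cabs R).
rewrite -[rnorm _]/(cabs (step_integral s - complex_integral k)) (le_trans (cabs_le _)) //.
rewrite !raddfB /= (splitr e); exact: lerD.
Qed.

End scalar.

End gauss_integrals.

(** * Weyl relations *)

Section group_products.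
Context {R : realType} {X : completeNormedModType R[i]} {I : eqType}.
Variable (F : I -> R -> X -> X) (M : R).
Hypothesis linF : forall j t, linear (F j t).
Hypothesis F0 : forall j f, F j 0 f = f.
Hypothesis FD : forall j s t f, F j (s + t) f = F j s (F j t f).
Hypothesis Fcont : forall j f, F j t f @[t --> (0 : R)] --> f.
Hypothesis M0 : 0 <= M.
Hypothesis Fbound : forall j t f, rnorm (F j t f) <= M * rnorm f.
Hypothesis Fcomm : forall j k s t f, F j s (F k t f) = F k t (F j s f).

Definition eapp (s : seq I) (u : I -> R) (f : X) : X := foldr (fun j x => F j (u j) x) f s.

Lemma eapp_lin s u : linear (eapp s u).
Proof. by elim: s => [|j s IH] c x y //=; rewrite IH linF. Qed.

Lemma eapp_bound s u f : rnorm (eapp s u f) <= M ^+ size s * rnorm f.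
Proof.
elim: s => [|j s IH] /=; first by rewrite mul1r.
by rewrite (le_trans (Fbound _ _ _)) // exprS -mulrA ler_wpM2l.
Qed.

(** Joint continuity: the group law moves strong continuity from [0] to [t0], and the uniform bound
    takes care of the moving vector. *)
Lemma group_seq_cvg j (t : nat -> R) t0 (x : nat -> X) x0 :
  t n @[n --> \oo] --> t0 -> x n @[n --> \oo] --> x0 -> F j (t n) (x n) @[n --> \oo] --> F j t0 x0.
Proof.
move=> ht hx; apply/rnorm_cvgP.
have h1 : F j (t n - t0) x0 @[n --> \oo] --> x0.
  have : (t n - t0) @[n --> \oo] --> (0 : R) by rewrite -(subrr t0); apply: cvgB => //; exact: cvg_cst.
  by move=> /(cvg_comp _ (fun t => F j t x0)); apply; exact: Fcont.
apply: (@squeeze_cvgr _ _ _ _ (fun=> 0) (fun n => M * rnorm (x n - x0) + M * rnorm (F j (t n - t0) x0 - x0))).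
- near=> n; rewrite rnorm_ge0 /=.
  have -> : F j (t n) (x n) - F j t0 x0 = F j (t n) (x n - x0) + F j t0 (F j (t n - t0) x0 - x0).
    rewrite !(linrB (linF _ _)) -FD [t0 + _]addrC subrK.
    by rewrite addrA subrK.
  by rewrite (le_trans (rnormD _ _)) // lerD.
- exact: cvg_cst.
- rewrite -[X in _ --> X](addr0 (0 : R)); apply: cvgD.
    by rewrite -(mulr0 M); apply: cvgMr; apply/rnorm_cvgP.
  by rewrite -(mulr0 M); apply: cvgMr; apply/rnorm_cvgP.
Unshelve. all: by end_near. Qed.

Lemma eapp_cvg s (u : nat -> I -> R) u0 (x : nat -> X) x0 : (forall j, u n j @[n --> \oo] --> u0 j) ->
  x n @[n --> \oo] --> x0 -> eapp s (u n) (x n) @[n --> \oo] --> eapp s u0 x0.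
Proof.
move=> hu hx; elim: s => [|j s IH] //=.
exact: group_seq_cvg.
Qed.

Lemma eapp_twist s u f (V : X -> X) (th : I -> R) :
  (forall j x, V (F j (u j) x) = cis (th j) *: F j (u j) (V x)) ->
  V (eapp s u f) = cis (\sum_(j <- s) th j) *: eapp s u (V f).
Proof.
move=> hV; elim: s => [|j s IH] /=; first by rewrite big_nil cis0 scale1r.
by rewrite hV IH big_cons cisD (linrZ (linF _ _)) scalerA.
Qed.

Lemma eapp_comm s u k t f : F k t (eapp s u f) = eapp s u (F k t f).
Proof. by elim: s => [|j s IH] //=; rewrite Fcomm IH. Qed.

Lemma eapp_add s u k t f : uniq s -> k \in s ->
  F k t (eapp s u f) = eapp s (fun j => u j + (if j == k then t else 0)) f.
Proof.
elim: s => [|j s IH] //= /andP[js us]; rewrite in_cons => /predU1P[kj|ks].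
  subst k; rewrite eqxx addrC FD; congr (F j t (F j _ _)).
  elim: s js {IH us} => [|i s IH] //=; rewrite in_cons negb_or => /andP[ij js].
  by rewrite IH // eq_sym (negbTE ij) addr0.
rewrite Fcomm IH //; case: eqP => [jk|_]; last by rewrite addr0.
by rewrite jk ks in js.
Qed.

End group_products.

Section weyl_relations.
Context {R : realType} {X : completeNormedModType R[i]} {d : nat}.
Variables (A B : 'I_d -> set (X * X)) (EA EB : 'I_d -> R -> X -> X).
Hypothesis W : weyl_pair A B EA EB.
Local Notation E := (rvec R d * rvec R d)%type.

Lemma exp_prodE (F : 'I_d -> R -> X -> X) u f :
  exp_prod F u f = eapp F (index_enum 'I_d) (fun j => tnth u j) f.
Proof.
rewrite /exp_prod /eapp unlock /=.
by elim: (index_enum _) => [|j s IH] //=; rewrite /= IH.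
Qed.

(** One family of [2d] groups, indexed like the coordinates of phase space, so that [A] and [B] are
    treated by the same arguments. *)
Definition egrp (c : bool * 'I_d) : R -> X -> X := if c.1 then EA c.2 else EB c.2.

Lemma egrp_bounded c : bounded_C0_group (egrp c).
Proof. by case: c => -[] j; [exact: weyl_groupA W j|exact: weyl_groupB W j]. Qed.

Lemma egrp_lin c t : linear (egrp c t).
Proof. by have [[/(_ t)[]]] := egrp_bounded c. Qed.

Lemma egrp0 c f : egrp c 0 f = f.
Proof. by have [[]] := egrp_bounded c. Qed.

Lemma egrpD c s t f : egrp c (s + t) f = egrp c s (egrp c t f).
Proof. by have [[]] := egrp_bounded c. Qed.

Lemma egrp_cont c f : egrp c t f @[t --> (0 : R)] --> f.
Proof. by have [[_ _ _ +] _] := egrp_bounded c; apply. Qed.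

Lemma egrp_bound : exists2 M : R, 1 <= M & forall c t f, rnorm (egrp c t f) <= M * rnorm f.
Proof.
have H c : exists M : R, forall t f, rnorm (egrp c t f) <= M * rnorm f.
  have [_ [M hM]] := egrp_bounded c; exists M => t f.
  by have := hM t f I; rewrite ler_rnormC.
have /choice[m hm] := H.
exists (1 + \sum_c `|m c|); first by rewrite lerDl sumr_ge0.
move=> c t f; rewrite (le_trans (hm c t f)) // ler_wpM2r ?rnorm_ge0 //.
rewrite (le_trans (ler_norm _)) // (bigD1 c) //= addrCA lerDl addr_ge0 // sumr_ge0 //.
Qed.

Lemma egrp_comm b j k s t f : egrp (b, j) s (egrp (b, k) t f) = egrp (b, k) t (egrp (b, j) s f).
Proof. by case: b; [exact: weyl_commA W j k s t f|exact: weyl_commB W j k s t f]. Qed.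

Definition wexp (f : X) (p : E) : X := weyl_exp EA EB p.1 p.2 f.

Definition eprod b (p : E) : X -> X :=
  eapp (fun j => egrp (b, j)) (index_enum 'I_d) (fun j => pcoord (b, j) p).

Lemma wexpE f p : wexp f p = cis (2^-1 * dotv p.1 p.2) *: eprod true p (eprod false p f).
Proof. by rewrite /wexp /weyl_exp !exp_prodE. Qed.

Lemma eprod_lin b p : linear (eprod b p).
Proof. by apply: eapp_lin => j t; exact: egrp_lin. Qed.

Lemma wexp_lin p : linear (fun f => wexp f p).
Proof. by move=> c x y; rewrite !wexpE !eprod_lin; linx R[i]. Qed.

Lemma wexp_bound : exists2 M : R, 1 <= M & forall p f, rnorm (wexp f p) <= M * rnorm f.
Proof.
have [M M1 hM] := egrp_bound; have M0 : 0 <= M by rewrite (le_trans ler01).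
exists (M ^+ (size (index_enum 'I_d) + size (index_enum 'I_d))%N); first by rewrite exprn_ege1.
move=> p f; rewrite wexpE rnormZ cabs_cis mul1r exprD.
rewrite (le_trans (eapp_bound M0 (fun j => hM (true, j)) _ _ _)) // -mulrA ler_wpM2l ?exprn_ge0 //.
exact: (eapp_bound M0 (fun j => hM (false, j))).
Qed.

Definition porigin : E := ([tuple 0 | i < d], [tuple 0 | i < d]).

Lemma pcoord_origin c : pcoord c porigin = 0.
Proof. by case: c => -[] i; rewrite /pcoord /= tnth_mktuple. Qed.

Lemma wexp_origin f : wexp f porigin = f.
Proof.
have h b x : eprod b porigin x = x.
  by rewrite /eprod; elim: (index_enum _) => [|j s IH] //=; rewrite IH pcoord_origin egrp0.
rewrite wexpE !h /dotv big1 ?mulr0 ?cis0 ?scale1r // => i _; rewrite tnth_mktuple mul0r //.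
Qed.

Lemma scont_wexp f : scont (wexp f).
Proof.
have [M M1 hM] := egrp_bound; have M0 : 0 <= M by rewrite (le_trans ler01).
have hc b q p (x : nat -> X) y : pcvg q p -> x n @[n --> \oo] --> y ->
    eprod b (q n) (x n) @[n --> \oo] --> eprod b p y.
  move=> qp xy; apply: (@eapp_cvg _ _ _ (fun j => egrp (b, j)) M) => //.
  - by move=> j t; exact: egrp_lin.
  - by move=> j s t g; exact: egrpD.
  - by move=> j g; exact: egrp_cont.
  - by move=> j; exact: pcoord_cvg.
have hs : scont (fun p : E => cis (2^-1 * dotv p.1 p.2) : R[i]^o).
  rewrite (_ : (fun _ => _) = fun p : E => cexp ((2^-1 * dotv p.1 p.2)%:C * 'i)); last first.
    by apply/funext => p; rewrite cisE.
  apply: scont_cexp; apply: scontMs; last exact: scont_cst.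
  apply: scont_real => q p qp; apply: cvgM; first exact: cvg_cst.
  rewrite /dotv; have key (s : seq 'I_d) : \sum_(j <- s) tnth (q n).1 j * tnth (q n).2 j @[n --> \oo] -->
      (\sum_(j <- s) tnth p.1 j * tnth p.2 j : R).
    elim: s => [|c s IH]; first by under eq_fun do rewrite big_nil; rewrite big_nil; exact: cvg_cst.
    under eq_fun do rewrite big_cons; rewrite big_cons; apply: cvgD => //.
    by apply: cvgM; [exact: (qp c).1|exact: (qp c).2].
  exact: key.
move=> q p qp; rewrite wexpE; under eq_fun => n do rewrite wexpE.
apply: cvgZ; first exact: hs.
by apply: (hc) => //; apply: (hc) => //; exact: cvg_cst.
Qed.

Definition punit (c : bool * 'I_d) (s : R) : E :=
  ([tuple if c.1 && (i == c.2) then s else 0 | i < d], [tuple if ~~ c.1 && (i == c.2) then s else 0 | i < d]).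

Lemma pcoord_unit c c' s p : pcoord c' (trp (punit c s) p) = pcoord c' p + (if c' == c then s else 0).
Proof.
by case: c c' => -[] j [[] i]; rewrite /pcoord /= !tnth_mktuple ?xpair_eqE /= ?eqxx.
Qed.

(** The canonically conjugate coordinate; its group is the one that [egrp c] passes at the price of
    a phase. *)
Definition pdual (c : bool * 'I_d) (p : E) : R := pcoord (~~ c.1, c.2) p.
(** The sign of the symplectic form: moving [egrp c s] past its conjugate group at time [t] costs
    the phase [wsign c * s * t]. *)
Definition wsign (c : bool * 'I_d) : R := if c.1 then -1 else 1.

Lemma egrp_twist c k s t f :
  egrp c s (egrp (~~ c.1, k) t f) = cis (wsign c * s * (t * (k == c.2)%:R)) *: egrp (~~ c.1, k) t (egrp c s f).
Proof.
case: c => -[] j /=; rewrite /egrp /wsign /=.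
  by rewrite (weyl_commAB W) eq_sym; congr (cis _ *: _); ring.
rewrite (weyl_commAB W k j t s) scalerA -cisD eq_sym.
by rewrite [X in cis X](_ : _ = 0) ?cis0 ?scale1r //; rewrite eq_sym; ring.
Qed.

Lemma eprod_same c s p f : egrp c s (eprod c.1 p f) = eprod c.1 (trp (punit c s) p) f.
Proof.
case: c => b k /=; rewrite /eprod (@eapp_add _ _ _ (fun j => egrp (b, j))) //.
- congr eapp; apply/funext => j; rewrite pcoord_unit; congr (_ + _).
  by rewrite xpair_eqE eqxx.
- by move=> j x y g; exact: egrpD.
- by move=> i j x y g; exact: egrp_comm.
- exact: index_enum_uniq.
- exact: mem_index_enum.
Qed.

Lemma eprod_other c s p f : eprod (~~ c.1) (trp (punit c s) p) f = eprod (~~ c.1) p f.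
Proof.
rewrite /eprod; congr eapp; apply/funext => j; rewrite pcoord_unit.
by case: c => -[] k; rewrite xpair_eqE /= addr0.
Qed.

Lemma eprod_twist c s p f :
  egrp c s (eprod (~~ c.1) p f) = cis (wsign c * s * pdual c p) *: eprod (~~ c.1) p (egrp c s f).
Proof.
rewrite /eprod (@eapp_twist _ _ _ (fun j => egrp (~~ c.1, j)) _ _ _ _ (egrp c s)
  (fun j => wsign c * s * (pcoord (~~ c.1, j) p * (j == c.2)%:R))).
- rewrite -mulr_sumr (bigD1 c.2) //= eqxx mulr1 big1 ?addr0 // => i /negbTE ->; exact: mulr0.
- by move=> j t; exact: egrp_lin.
- by move=> j x; rewrite egrp_twist.
Qed.

Lemma eprod_comm c s p f : egrp c s (eprod c.1 p f) = eprod c.1 p (egrp c s f).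
Proof. by case: c => b k; rewrite /eprod; apply: eapp_comm => i j x y g; exact: egrp_comm. Qed.

Lemma dotv_unit c s p : dotv (trp (punit c s) p).1 (trp (punit c s) p).2 = dotv p.1 p.2 + s * pdual c p.
Proof.
have h q : dotv q.1 q.2 = \sum_(j < d) pcoord (true, j) q * pcoord (false, j) q by [].
rewrite !h; under eq_bigr => j _ do rewrite !pcoord_unit.
rewrite (bigD1 c.2) //= [in RHS](bigD1 c.2) //= addrAC; congr (_ + _); last first.
  by apply: eq_bigr => j /negbTE jc; case: c jc => -[] k /= jc; rewrite !xpair_eqE /= jc !addr0.
by rewrite /pdual; case: c => -[] k /=; rewrite !xpair_eqE /= eqxx ?addr0; ring.
Qed.

(** The symmetric factor [e^(iuv/2)] in [weyl_exp] shares the commutation phase evenly: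
    multiplication on the left and on the right translate [p] in the same way and differ only in the
    sign of a half phase. *)
Lemma wexp_left c s f p :
  egrp c s (wexp f p) = cis (2^-1 * wsign c * s * pdual c p) *: wexp f (trp (punit c s) p).
Proof.
rewrite !wexpE (linrZ (egrp_lin c s)) dotv_unit scalerA -cisD.
(* A left factor from [A] merges at once with the [A]-product standing in front; a factor from [B]
   first has to cross that product. The boolean exponent records this. *)
have -> : eprod true (trp (punit c s) p) (eprod false (trp (punit c s) p) f) =
   cis (- (wsign c * s * pdual c p) * (~~ c.1)%:R) *: egrp c s (eprod true p (eprod false p f)).
  case: c => -[] k; set c := (_, k).
    by rewrite mulr0 cis0 scale1r (eprod_same c) (eprod_other c).
  rewrite (eprod_other c) mulr1 (eprod_twist c) scalerA -cisD addNr cis0 scale1r.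
  by rewrite (eprod_same c).
rewrite scalerA -cisD; congr (cis _ *: _).
by case: c => -[] k; rewrite /wsign /=; field.
Qed.

Lemma wexp_right c s f p :
  wexp (egrp c s f) p = cis (- (2^-1 * wsign c * s * pdual c p)) *: wexp f (trp (punit c s) p).
Proof.
rewrite !wexpE dotv_unit scalerA -cisD.
(* On the right the roles are exchanged: only a factor from [A] has to cross the other product. *)
have -> : eprod true p (eprod false p (egrp c s f)) =
   cis (- (wsign c * s * pdual c p) * (c.1)%:R) *:
     eprod true (trp (punit c s) p) (eprod false (trp (punit c s) p) f).
  case: c => -[] k; set c := (_, k).
    rewrite mulr1 (eprod_other c) -(eprod_same c) (eprod_comm c) (eprod_twist c).
    by rewrite (linrZ (eprod_lin _ _)) scalerA -cisD addNr cis0 scale1r.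
  rewrite mulr0 cis0 scale1r (eprod_other c).
  by rewrite -(eprod_same c) (eprod_comm c).
rewrite scalerA -cisD; congr (cis _ *: _).
by case: c => -[] k; rewrite /wsign /=; field.
Qed.

End weyl_relations.

(** * Translating a Gaussian integral along one coordinate *)

Section gaussian_shift.
Context {R : realType} {X : completeNormedModType R[i]} {d : nat}.
Local Notation E := (rvec R d * rvec R d)%type.
Implicit Types (V : E -> X).

Definition gker (a : R[i]) V (p : E) : X := cexp (- a * (nq p)%:C) *: V p.

(** The logarithmic derivative of the integrand at [s = 0] after the translation has been undone:
    the first term comes from the Gaussian, the second from the phase of rate [th]. *)
Definition shift_weight (a : R[i]) (th : R) (c : bool * 'I_d) (p : E) : R[i]^o :=
  (2 * a) * (pcoord c p)%:C + (th%:C * 'i) * (pdual c p)%:C.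

Lemma qgrowth_shift_weight a th c : qgrowth (shift_weight a th c).
Proof. by apply: qgrowthD; apply: qgrowthZ; exact: qgrowth_pcoord. Qed.

Lemma trp_unitK (c : bool * 'I_d) (s : R) (p : E) : trp (punit c s) (trp (punit c (- s)) p) = p.
Proof.
by case: p => u v; rewrite /trp /=; congr pair; apply: eq_from_tnth => i; rewrite !tnth_mktuple;
  case: ifP => _; rewrite -addrA ?addr0 ?addNr ?addr0.
Qed.

Lemma nq_unit (c : bool * 'I_d) (s : R) (p : E) : nq (trp (punit c s) p) = nq p + 2 * s * pcoord c p + s ^+ 2.
Proof.
rewrite !nq_pcoord (bigD1 c) //= [in RHS](bigD1 c) //= pcoord_unit eqxx.
rewrite (eq_bigr (fun c' => pcoord c' p ^+ 2)); last first.
  by move=> c' /negbTE h; rewrite pcoord_unit h addr0.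
by ring.
Qed.

Lemma pdual_unit (c : bool * 'I_d) (s : R) (p : E) : pdual c (trp (punit c s) p) = pdual c p.
Proof. by rewrite /pdual pcoord_unit; case: c => -[] j; rewrite xpair_eqE /= addr0. Qed.

Lemma trp_pcvg (w : E) q p : pcvg q p -> pcvg (fun n => trp w (q n)) (trp w p).
Proof.
by move=> qp i; have [h1 h2] := qp i; split; rewrite !tnth_mktuple;
  under eq_fun => n do rewrite tnth_mktuple; apply: cvgD => //; exact: cvg_cst.
Qed.

Lemma bcont_shift V (k : E -> R) (w : E) : bcont V -> scont (fun p => (k p)%:C : R[i]^o) ->
  bcont (fun p => cis (k p) *: V (trp w p)).
Proof.
move=> [hV [M M0 HM]] hk; split.
  apply: scontM; last by move=> q p /(trp_pcvg w) /hV.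
  rewrite (_ : (fun _ => _) = fun p => cexp ((k p)%:C * 'i)); last by apply/funext => p; rewrite cisE.
  exact: (scont_cexp (scontMs hk (@scont_cst R d R[i]^o 'i))).
by exists M => // p; rewrite rnormZ cabs_cis mul1r.
Qed.

Variables (a : R[i]) (th : R) (c : bool * 'I_d) (V : E -> X).
Hypothesis a0 : 0 < complex.Re a.
Hypothesis hV : bcont V.
Local Notation b := (shift_weight a th c).

Definition shifted (s : R) (p : E) : X := cis (th * s * pdual c p) *: V (trp (punit c s) p).

Lemma bcont_shifted s : bcont (shifted s).
Proof.
apply: bcont_shift => //; apply: scont_real => q p qp.
by apply: cvgM; [exact: cvg_cst|exact: pcoord_cvg].
Qed.

Lemma gfun_gker : gfun (gker a V). Proof. exact: gfun_gauss. Qed.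

Lemma shift_weight_unit s p : b (trp (punit c (- s)) p) = b p - 2 * a * s%:C.
Proof.
by rewrite /shift_weight pcoord_unit eqxx pdual_unit rmorphB /= mulrBr addrAC.
Qed.

(* Completing the square: -a|p - s e|^2 = -a|p|^2 + 2as p_c - a s^2. *)
Lemma gker_shifted s p : gker a (shifted s) (trp (punit c (- s)) p) =
  cexp (- a * (s%:C) ^+ 2) *: (cexp (s%:C * b p) *: gker a V p).
Proof.
rewrite /gker /shifted nq_unit pdual_unit trp_unitK cisE !scalerA -!cexpD; congr (cexp _ *: _).
rewrite /shift_weight sqrrN expr2 !(rmorphD, rmorphM, rmorphN) /=; ring.
Qed.

(** Valid for every real [s], small or not, because up to a scalar the function is a translate of a
    Gaussian integrand. *)
Lemma gfun_shifted0 s : gfun (fun p => cexp (s%:C * b p) *: gker a V p).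
Proof.
have h : gfun (fun p => gker a (shifted s) (trp (punit c (- s)) p)).
  have := gfun_gauss a0 (bcont_shifted s); rewrite -/(gker a (shifted s)) => -[h1 [M [e [M0 e0 H]]]].
  split; first by move=> q p /(trp_pcvg (punit c (- s))) /h1.
  exists (M * expR (e * s ^+ 2)), (e / 2); split; [by rewrite mulr_ge0 ?expR_ge0|by rewrite divr_gt0|].
  move=> p; rewrite (le_trans (H _)) // -mulrA ler_wpM2l // -expRD ler_expR nq_unit.
  have := pcoord_sqr_le c p; have := sqr_ge0 (pcoord c p - 2 * s); move: e0; set x := pcoord c p; set n := nq p.
  (* [n / 2 - 2 s x + 2 s^2 = (n - x^2) / 2 + (x - 2 s)^2 / 2], so half of the decay survives the
     translation. *)
  move=> e0 h2 h3; have h4 : n / 2 <= n + 2 * - s * x + (- s) ^+ 2 + s ^+ 2.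
    by rewrite sqrrN; have := h2; rewrite sqrrB => ?; nra.
  have := ler_wpM2l (ltW e0) h4; rewrite mulrDr; lra.
have h2 := gfunZ (cexp (a * (s%:C) ^+ 2)) h.
have -> // : (fun p => cexp (s%:C * b p) *: gker a V p) =
  fun p => cexp (a * (s%:C) ^+ 2) *: gker a (shifted s) (trp (punit c (- s)) p).
apply/funext => p; by rewrite gker_shifted [RHS]scalerA -cexpD mulNr subrr cexp0 scale1r.
Qed.

Lemma gshift0 s : gint (gker a (shifted s)) =
  cexp (- a * (s%:C) ^+ 2) *: gint (fun p => cexp (s%:C * b p) *: gker a V p).
Proof.
rewrite -(gint_shift (punit c (- s)) (gfun_gauss a0 (bcont_shifted s))) -gintZ; last exact: gfun_shifted0.
by apply: eq_gint => p; rewrite -[LHS]/(gker a (shifted s) (trp (punit c (- s)) p)) gker_shifted.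
Qed.

(** The translation also moves the weight, by [- 2 a s]; this produces the term [- 2 a] of the
    second derivative. *)
Lemma gshift1 s : gint (fun p => b p *: gker a (shifted s) p) =
  cexp (- a * (s%:C) ^+ 2) *: (gint (fun p => cexp (s%:C * b p) *: (b p *: gker a V p)) -
    (2 * a * s%:C) *: gint (fun p => cexp (s%:C * b p) *: gker a V p)).
Proof.
have hb := qgrowth_shift_weight a th c.
have h0 := gfun_shifted0 s; have h1 := gfunM hb h0.
have h2 : gfun (fun p => cexp (s%:C * b p) *: (b p *: gker a V p)).
  by move: h1; congr gfun; apply/funext => p; linx R[i].
rewrite -(gint_shift (punit c (- s)) (gfunM hb (gfun_gauss a0 (bcont_shifted s)))).
have e1 : gint (fun p => - (2 * a * s%:C) *: (cexp (s%:C * b p) *: gker a V p) + cexp (s%:C * b p) *: (b p *: gker a V p))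
  = _ := gint_lin (- (2 * a * s%:C)) h0 h2.
have h3 := gfunD (gfunZ (- (2 * a * s%:C)) h0) h2; rewrite /= in h3.
transitivity (cexp (- a * s%:C ^+ 2) *: gint (fun p => - (2 * a * s%:C) *: (cexp (s%:C * b p) *: gker a V p) + cexp (s%:C * b p) *: (b p *: gker a V p))).
  apply: etrans (gintZ (cexp (- a * s%:C ^+ 2)) h3); apply: eq_gint => p.
  by rewrite -/(gker a (shifted s) (trp (punit c (- s)) p)) gker_shifted shift_weight_unit; linx R[i].
by rewrite e1; congr (_ *: _); rewrite addrC scaleNr.
Qed.

Lemma dq_real (F : R[i] -> X) y : dq F 0 y -> dqr (fun s => F s%:C) 0 y.
Proof.
move=> [C [dd [C0 d0 H]]]; exists C, dd; split=> // h hd.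
by have := H h%:C; rewrite cabs_real rmorphD => /(_ hd).
Qed.

(** The factor left from completing the square is flat at [0], so it adds nothing to the derivatives
    there. *)
Lemma dq_gauss0 : dq (fun z : R[i] => cexp (- a * z ^+ 2) : R[i]^o) 0 0.
Proof.
have h1 : dq (fun z : R[i] => - a * z ^+ 2 : R[i]^o) 0 0.
  have := dqM (X := R[i]^o) (dq_id 0) (dq_id 0).
  move=> /(dqM (X := R[i]^o) (dq_cst (- a : R[i]^o) 0)).
  by rewrite /GRing.scale /= !(mulr0, mul0r, mulr1, addr0).
by have := dq_comp h1 (dq_cexp _); rewrite scale0r.
Qed.

Lemma gshift0_dqr : dqr (fun s => gint (gker a (shifted s))) 0 (gint (fun p => b p *: gker a V p)).
Proof.
have := dqM dq_gauss0 (dq_gint (qgrowth_shift_weight a th c) gfun_gker).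
rewrite scale0r add0r expr0n /= mulr0 cexp0 scale1r => /dq_real.
by congr dqr; apply/funext => s; rewrite gshift0.
Qed.

Lemma gshift1_dqr : dqr (fun s => gint (fun p => b p *: gker a (shifted s) p)) 0
  (gint (fun p => b p *: (b p *: gker a V p)) - (2 * a) *: gint (gker a V)).
Proof.
have hb := qgrowth_shift_weight a th c.
have h0 := dq_gint hb gfun_gker; have h1 := dq_gint hb (gfunM hb gfun_gker).
have h2 : dq (fun z : R[i] => - (2 * a) * z : R[i]^o) 0 (- (2 * a)).
  have := dqM (X := R[i]^o) (dq_cst (- (2 * a) : R[i]^o) 0) (dq_id 0).
  by rewrite /GRing.scale /= !(mulr0, mul0r, mulr1, addr0, add0r).
have := dqM dq_gauss0 (dqD h1 (dqM h2 h0)).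
rewrite scale0r add0r expr0n /= !mulr0 cexp0 scale1r scale0r addr0 => /dq_real.
have -> : gint (fun p => cexp (0 * b p) *: gker a V p) = gint (gker a V).
  by apply: eq_gint => p; rewrite mul0r cexp0 scale1r.
rewrite scaleNr; congr dqr; apply/funext => s; rewrite gshift1; congr (_ *: (_ + _)).
by rewrite mulNr scaleNr.
Qed.

End gaussian_shift.

Lemma sum_bool_ord (V : nmodType) d (F : bool * 'I_d -> V) : \sum_c F c = \sum_(j < d) (F (true, j) + F (false, j)).
Proof.
rewrite (eq_bigr (fun c => F (c.1, c.2))) /=; last by case.
rewrite big_split /= -(pair_big_dep xpredT (fun _ _ => true) (fun b i => F (b, i))) /=.
by rewrite big_bool.
Qed.

Lemma gint_sum {R : realType} {X : completeNormedModType R[i]} {d : nat} (I : Type) (s : seq I)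
  (F : I -> rvec R d * rvec R d -> X) : (forall i, gfun (F i)) ->
  gfun (fun p => \sum_(i <- s) F i p) /\ gint (fun p => \sum_(i <- s) F i p) = \sum_(i <- s) gint (F i).
Proof.
move=> hF; elim: s => [|i s [IH1 IH2]].
  have g0 : gfun (fun _ : rvec R d * rvec R d => 0 : X).
    by split; [exact: scont_cst|exists 0, 1; split=> // p; rewrite rnorm0 mul0r].
  have -> : (fun p => \sum_(i <- [::]) F i p) = fun p => 0.
    by apply/funext => p; rewrite big_nil.
  split=> //; rewrite big_nil; rewrite -[RHS](scale0r (gint (fun _ : rvec R d * rvec R d => 0 : X))).
  by rewrite -(gintZ 0 g0); apply: eq_gint => p; rewrite scale0r.
have -> : (fun p => \sum_(j <- i :: s) F j p) = fun p => F i p + \sum_(j <- s) F j p.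
  by apply/funext => p; rewrite big_cons.
by rewrite big_cons -IH2; split; [exact: gfunD|exact: gintD].
Qed.

Lemma oppr_eqB (V : zmodType) (x y z : V) : - x = y - z -> x = z - y.
Proof. by move=> h; rewrite -[x]opprK h opprB. Qed.

(** * Squares of the operators on Gaussian Weyl integrals *)

Section weyl_integrals.
Context {R : realType} {X : completeNormedModType R[i]} {d : nat}.
Variables (A B : 'I_d -> set (X * X)) (EA EB : 'I_d -> R -> X -> X).
Hypothesis W : weyl_pair A B EA EB.
Local Notation E := (rvec R d * rvec R d)%type.
Local Notation wexp := (wexp EA EB).
Local Notation egrp := (egrp EA EB).

Lemma bcont_wexp f : bcont (wexp f).
Proof.
split; first exact: (scont_wexp W).
have [M M1 hM] := wexp_bound W; exists (M * rnorm f) => [|p]; last exact: hM.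
by rewrite mulr_ge0 ?rnorm_ge0 // (le_trans ler01).
Qed.

Definition opc (c : bool * 'I_d) : set (X * X) := if c.1 then A c.2 else B c.2.

Lemma gen_opc c : group_generator (egrp c) = op_scale 'i (opc c).
Proof. by case: c => -[] j; [exact: weyl_genA W j|exact: weyl_genB W j]. Qed.

Lemma opc_operator c : is_operator (opc c).
Proof. by case: c => -[] j; [have [] := weyl_closedA W j|have [] := weyl_closedB W j]. Qed.

Lemma opcZ c x f g : opc c (f, g) -> opc c (x *: f, x *: g).
Proof.
have [h0 h1 _] := opc_operator c.
move=> hf; have -> : (x *: f, x *: g) = x *: (f, g) + (0, 0) :> X * X by congr pair; rewrite /= addr0.
exact: h1.
Qed.

Lemma generator_dqr c f g : dqr (fun s => egrp c s f) 0 g -> group_generator (egrp c) (f, g).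
Proof. by move=> /dqr_cvg; under eq_fun => h do rewrite add0r (egrp0 W). Qed.

Lemma generator_opc c f g : group_generator (egrp c) (f, g) -> opc c (f, - 'i%C *: g).
Proof.
rewrite gen_opc => -[h /= hf ->]; rewrite scalerA mulNr.
have -> : 'i%C * 'i%C = -1 :> R[i] by rewrite -expr2; exact: sqr_i.
by rewrite opprK scale1r.
Qed.

Lemma opc_generator c f g : opc c (f, g) -> group_generator (egrp c) (f, 'i%C *: g).
Proof. by rewrite gen_opc => hf; exists g. Qed.

Variable a : R[i].
Hypothesis a0 : 0 < complex.Re a.

Definition tg f : X := gint (gker a (wexp f)).
Definition tgw (m : E -> R[i]^o) f : X := gint (fun p => m p *: gker a (wexp f) p).

Lemma gfun_wexp f : gfun (gker a (wexp f)).
Proof. exact: gfun_gker (bcont_wexp f). Qed.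

Lemma tgw_lin m : qgrowth m -> linear (tgw m).
Proof.
move=> hm x f g; rewrite /tgw.
have h := gint_lin x (gfunM hm (gfun_wexp f)) (gfunM hm (gfun_wexp g)); rewrite /= in h.
rewrite -h; apply: eq_gint => p; rewrite /gker (wexp_lin W); linx R[i].
Qed.

Lemma tg_lin : linear tg.
Proof.
move=> x f g; rewrite /tg.
have h := gint_lin x (gfun_wexp f) (gfun_wexp g); rewrite -h.
by apply: eq_gint => p; rewrite /gker (wexp_lin W); linx R[i].
Qed.

Lemma gker_norm M f p : (forall p f, rnorm (wexp f p) <= M * rnorm f) ->
  rnorm (gker a (wexp f) p) <= M * rnorm f * expR (- (complex.Re a * nq p)).
Proof.
move=> hM; rewrite /gker rnormZ cabs_cexp mulrC ler_pM ?rnorm_ge0 ?expR_ge0 // ler_expR.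
by case: (a) => x y /=; rewrite mulr0 subr0 mulNr.
Qed.

Lemma tg_bound M f : (forall p f, rnorm (wexp f p) <= M * rnorm f) ->
  rnorm (tg f) <= M * (pi / complex.Re a) ^+ d * rnorm f.
Proof.
move=> hM; rewrite mulrAC; apply: gint_norm => //; first exact: gfun_wexp.
by move=> p; exact: gker_norm.
Qed.

Lemma tgw_bound m : qgrowth m -> exists2 C : R, 0 <= C & forall f, rnorm (tgw m f) <= C * rnorm f.
Proof.
move=> hm; have [M M1 hM] := wexp_bound W; have [_ [K K0 hK]] := hm.
have M0 : 0 <= M by rewrite (le_trans ler01).
pose e := complex.Re a / 2; have e0 : 0 < e by rewrite divr_gt0.
exists (K * (1 + e^-1) * M * (pi / e) ^+ d).
  have h1 : 0 <= pi / e by rewrite divr_ge0 ?pi_ge0 // ltW.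
  have h2 : 0 <= 1 + e^-1 by rewrite addr_ge0 // invr_ge0 ltW.
  by do 2?[apply: mulr_ge0]; rewrite ?exprn_ge0 // mulr_ge0.
move=> f; rewrite mulrAC; apply: gint_norm => //; first exact: gfunM hm (gfun_wexp f).
move=> p; rewrite rnormZ (le_trans (ler_pM _ _ (hK p) (gker_norm f p hM))) ?cabs_ge0 ?rnorm_ge0 //.
have h := lin_le_expR e0 (nq_ge0 p).
have -> : expR (- (complex.Re a * nq p)) = expR (- (e * nq p)) * expR (- (e * nq p)).
  by rewrite -expRD; congr expR; rewrite /e; lra.
have h1 : (1 + nq p) * expR (- (e * nq p)) <= 1 + e^-1 by rewrite expRN ler_pdivrMr ?expR_gt0.
have := expR_ge0 (- (e * nq p)); set x := expR (- (e * _)) in h1 *; move=> x0.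
have -> : K * (1 + nq p) * (M * rnorm f * (x * x)) = K * M * rnorm f * x * ((1 + nq p) * x) by ring.
have -> : K * (1 + e^-1) * M * rnorm f * x = K * M * rnorm f * x * (1 + e^-1) by ring.
by rewrite ler_wpM2l // !mulr_ge0 // rnorm_ge0.
Qed.

Section direction.
Variable c : bool * 'I_d.
Local Notation wl := (shift_weight a (2^-1 * wsign c) c).
Local Notation wr := (shift_weight a (- (2^-1 * wsign c)) c).

Definition tgw2 (m : E -> R[i]^o) f : X := gint (fun p => m p *: (m p *: gker a (wexp f) p)).

Lemma egrp_gint s (F : E -> X) : gfun F -> egrp c s (gint F) = gint (fun p => egrp c s (F p)).
Proof.
move=> hF; have [M M1 hM] := egrp_bound W.
by rewrite (gint_map (egrp_lin W c s) (le_trans ler01 M1) (hM c s)).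
Qed.

Lemma egrp_gker s f p : egrp c s (gker a (wexp f) p) =
  gker a (shifted (2^-1 * wsign c) c (wexp f) s) p.
Proof. by rewrite /gker (linrZ (egrp_lin W c s)) (wexp_left W) /shifted. Qed.

Lemma tg_egrp s f : tg (egrp c s f) = gint (gker a (shifted (- (2^-1 * wsign c)) c (wexp f) s)).
Proof.
apply: eq_gint => p; rewrite /gker (wexp_right W) /shifted; congr (_ *: (cis _ *: _)).
by rewrite !mulNr.
Qed.

Lemma egrp_tg_dqr f : dqr (fun s => egrp c s (tg f)) 0 (tgw wl f).
Proof.
have := gshift0_dqr (2^-1 * wsign c) c a0 (bcont_wexp f).
congr dqr; apply/funext => s; rewrite /tg egrp_gint; last exact: gfun_wexp.
by apply: eq_gint => p; rewrite egrp_gker.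
Qed.

Lemma egrp_tgw_dqr f : dqr (fun s => egrp c s (tgw wl f)) 0 (tgw2 wl f - (2 * a) *: tg f).
Proof.
have := gshift1_dqr (2^-1 * wsign c) c a0 (bcont_wexp f).
congr dqr; apply/funext => s; rewrite /tgw egrp_gint; last first.
  by apply: gfunM; [exact: qgrowth_shift_weight|exact: gfun_wexp].
by apply: eq_gint => p; rewrite (linrZ (egrp_lin W c s)) egrp_gker.
Qed.

(** The orbits of [tg f] and [tgw wl f] under the group are differentiable at [0] for every [f],
    which puts [tg f] into the domain of the square; the two factors [- 'i] turn the second
    derivative into its negative. *)
Lemma tg_sqr f : op_sqr (opc c) (tg f, (2 * a) *: tg f - tgw2 wl f).
Proof.
have h1 := generator_opc (generator_dqr (egrp_tg_dqr f)).
have h2 := opcZ (- 'i%C) (generator_opc (generator_dqr (egrp_tgw_dqr f))).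
exists (- 'i%C *: tgw wl f) => //=; move: h2; congr (opc c (_, _)).
rewrite scalerA mulNr mulrN opprK -expr2 [X in X *: _](_ : _ = -1); last exact: sqr_i.
by linx R[i].
Qed.

(** A bounded map passes to the limit defining the generator; comparing with a derivative found by
    translation identifies [V g]. This carries the kernel integrals past an unbounded operator. *)
Lemma generator_map (V : X -> X) (C : R) f g y : linear V -> 0 <= C ->
  (forall x, rnorm (V x) <= C * rnorm x) -> group_generator (egrp c) (f, g) ->
  dqr (fun s => V (egrp c s f)) 0 y -> V g = y.
Proof.
move=> lV C0 bV hg /dqr_cvg hy.
have hV : (h^-1)%:C *: (V (egrp c (0 + h) f) - V (egrp c 0 f)) @[h --> (0 : R)^'] --> V g.
  apply: rnorm_cvg => e e0; have C1 : 0 < C + 1 by rewrite ltr_wpDl.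
  have hn : \forall t \near (0 : R)^', rnorm ((t^-1)%:C *: (egrp c t f - f) - g) <= e / (C + 1).
    exact: rnorm_near hg (divr_gt0 e0 C1).
  move: hn; apply: filterS => t ht.
  rewrite add0r (egrp0 W) -(linrB lV) -(linrZ lV) -(linrB lV).
  rewrite (le_trans (bV _)) // (le_trans (ler_wpM2l C0 ht)) //.
  by rewrite mulrCA ger_pMr // ler_pdivrMr // mul1r lerDl.
by move: hy; exact: cvg_unique hV.
Qed.

Lemma tg_generator f g : group_generator (egrp c) (f, g) -> tg g = tgw wr f.
Proof.
move=> hg; have [M M1 hM] := wexp_bound W.
apply: (generator_map (C := M * (pi / complex.Re a) ^+ d) tg_lin _ _ hg).
- by rewrite mulr_ge0 ?exprn_ge0 ?divr_ge0 ?pi_ge0 ?(ltW a0) // (le_trans ler01).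
- by move=> x; exact: tg_bound.
rewrite (_ : (fun s => tg (egrp c s f)) =
    fun s => gint (gker a (shifted (- (2^-1 * wsign c)) c (wexp f) s))).
  exact: gshift0_dqr (bcont_wexp f).
by apply/funext => s; exact: tg_egrp.
Qed.

Lemma tgw_generator f g : group_generator (egrp c) (f, g) -> tgw wr g = tgw2 wr f - (2 * a) *: tg f.
Proof.
move=> hg; have hw := qgrowth_shift_weight a (- (2^-1 * wsign c)) c.
have [C C0 hC] := tgw_bound hw.
apply: (generator_map (tgw_lin hw) C0 hC hg).
rewrite (_ : (fun s => tgw wr (egrp c s f)) =
    fun s => gint (fun p => wr p *: gker a (shifted (- (2^-1 * wsign c)) c (wexp f) s) p)).
  exact: gshift1_dqr (bcont_wexp f).
apply/funext => s; apply: eq_gint => p; congr (_ *: _).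
rewrite /gker (wexp_right W) /shifted; congr (_ *: (cis _ *: _)).
by rewrite !mulNr.
Qed.

Lemma sqr_tg f g : op_sqr (opc c) (f, g) -> tg g = (2 * a) *: tg f - tgw2 wr f.
Proof.
move=> [h /= h1 h2]; have := tgw_generator (opc_generator h1).
rewrite (linrZ (tgw_lin (qgrowth_shift_weight _ _ _))).
rewrite -(tg_generator (opc_generator h2)) (linrZ tg_lin) scalerA.
rewrite -expr2 [X in X *: _](_ : _ = -1) ?scaleN1r; last exact: sqr_i.
exact: oppr_eqB.
Qed.

End direction.

(** The cross terms cancel between conjugate directions because [wsign] changes sign there, and
    [(e 'i)^2 = - 1/4]. Only [e^2] matters, so the left weights ([e = 1/2]) and the right weights
    ([e = - 1/2]) have the same sum. *)
Lemma shift_weight_sqr (e : R) (p : E) : e ^+ 2 = 4^-1 ->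
  \sum_c shift_weight a (e * wsign c) c p * shift_weight a (e * wsign c) c p =
  (4 * a ^+ 2 - 4^-1) * (nq p)%:C :> R[i].
Proof.
move=> e4; rewrite nq_pcoord (rmorph_sum (real_complex R)) /= !sum_bool_ord mulr_sumr.
apply: eq_bigr => j _; rewrite /shift_weight /pdual /wsign /=.
set x := pcoord (true, j) p; set y := pcoord (false, j) p.
have i2 : 'i * 'i = -1 :> R[i] by rewrite -expr2 sqrCi.
have e4' : e%:C * e%:C = 4^-1 :> R[i].
  rewrite -rmorphM -expr2 e4 /= fmorphV /=; congr (_^-1); exact: rmorph_nat.
rewrite !(rmorphD, rmorphM, rmorphN, rmorphXn) /=.
rewrite !(mulrN1, mulr1).
have -> : (4 * a ^+ 2 - 4^-1) * (x%:C ^+ 2 + y%:C ^+ 2) =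
  4 * a ^+ 2 * (x%:C ^+ 2 + y%:C ^+ 2) + (e%:C * e%:C) * ('i * 'i) * (x%:C ^+ 2 + y%:C ^+ 2).
  by rewrite e4' i2; ring.
by rewrite ?rmorphN1; ring.
Qed.

Lemma tgw2_sum (e : R) f : e ^+ 2 = 4^-1 ->
  \sum_c tgw2 (shift_weight a (e * wsign c) c) f = (4 * a ^+ 2 - 4^-1) *: tgw (fun p => (nq p)%:C) f.
Proof.
move=> e4; have hw (c : bool * 'I_d) := qgrowth_shift_weight a (e * wsign c) c.
rewrite /tgw2 -(gint_sum _ (fun c => gfunM (hw c) (gfunM (hw c) (gfun_wexp f)))).2.
rewrite /tgw -gintZ; last by apply: gfunM; [exact: qgrowth_nq|exact: gfun_wexp].
apply: eq_gint => p; rewrite scalerA -(shift_weight_sqr p e4) scaler_suml.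
by apply: eq_bigr => c _; rewrite scalerA.
Qed.

(** Membership in [D] with the values of the [2d] squares as a witness; the operators are graphs, so
    their values are carried along. *)
Definition sqrs f (g : bool * 'I_d -> X) := forall c, op_sqr (opc c) (f, g c).

Definition sum_sqrs_tg f : X := (4 * d%:R * a) *: tg f - (4 * a ^+ 2 - 4^-1) *: tgw (fun p => (nq p)%:C) f.

Lemma card_dirs (V : lmodType R[i]) (x : V) : \sum_(c : bool * 'I_d) x = (2 * d%:R) *: x.
Proof.
by rewrite sumr_const card_prod card_bool card_ord -scaler_nat natrM.
Qed.

Lemma tg_sqrs f : exists2 g, sqrs (tg f) g & \sum_c g c = sum_sqrs_tg f.
Proof.
exists (fun c => (2 * a) *: tg f - tgw2 (shift_weight a (2^-1 * wsign c) c) f).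
  by move=> c; exact: tg_sqr.
rewrite big_split /= sumrN tgw2_sum; last by rewrite exprVn; congr (_^-1); ring.
by rewrite card_dirs scalerA; congr (_ *: _ - _); ring.
Qed.

(** The right-hand side agrees with that of [tg_sqrs]: on [D] the integral operator commutes with
    the sum of the squares. *)
Lemma sqrs_tg f g : sqrs f g -> tg (\sum_c g c) = sum_sqrs_tg f.
Proof.
move=> hg; rewrite (linr_sum tg_lin); under eq_bigr => c _ do rewrite (sqr_tg (hg c)).
rewrite big_split /= sumrN.
under [X in _ - X]eq_bigr => c _ do rewrite -mulNr.
rewrite tgw2_sum; last by rewrite sqrrN exprVn; congr (_^-1); ring.
by rewrite card_dirs scalerA; congr (_ *: _ - _); ring.
Qed.

End weyl_integrals.

(** * The holomorphic family Q(z) *)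

Section mehler_parameters.
Context {R : realType}.
Implicit Types z : R[i].

Lemma dq_opp z : dq (fun z => - z : R[i]^o) z (- 1).
Proof.
exists 0, 1; split=> // h _.
have e0 : - (z + h) - - z - h * -1 = 0 by ring.
rewrite (_ : _ - _ = 0); last exact: e0.
by rewrite rnorm0 mul0r.
Qed.

(* [mres] and [mexp] are the numbers r and a of the header. *)
Definition mres z : R[i] := (1 - cexp (- z))^-1.
Definition mexp z : R[i] := mres z / 2 - 4^-1.

Lemma mden_neq0 z : 0 < complex.Re z -> 1 - cexp (- z) != 0.
Proof.
move=> z0; apply/eqP => /subr0_eq h; have := cabs_cexp (- z).
rewrite -h cabs1 => /esym; apply/eqP; rewrite lt_eqF //.
by rewrite -expR0 ltr_expR; case: z z0 {h} => x y /=; rewrite oppr_lt0.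
Qed.

(** [r' = - q r^2] and [q = 1 - 1/r]; the resulting Riccati form no longer mentions [q], and all
    later derivatives are polynomials in [r]. *)
Lemma dq_mres z : 0 < complex.Re z -> dq (fun z => mres z : R[i]^o) z (mres z - mres z ^+ 2).
Proof.
move=> z0; have u0 := mden_neq0 z0.
have h1 : dq (fun z => cexp (- z) : R[i]^o) z (- cexp (- z)).
  by have := dq_comp (dq_opp z) (dq_cexp (- z)); rewrite scaleN1r.
have h2 := dqD (dq_cst (1 : R[i]^o) z) (dqM (dq_cst (- 1 : R[i]^o) z) h1).
have h3 : dq (fun z => 1 - cexp (- z) : R[i]^o) z (cexp (- z)).
  move: h2; congr dq; first by apply/funext => w; rewrite scaleN1r.
  by rewrite scale0r add0r scaleN1r opprK add0r.
have := dq_comp h3 (dq_inv u0); congr dq.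
rewrite /mres [_ *: _]mulrN -exprVn; set u := 1 - _ in u0 *.
have -> : cexp (- z) = 1 - u by rewrite /u subKr.
by rewrite [_ ^+ 2]expr2; field.
Qed.

Lemma dq_mexp z : 0 < complex.Re z -> dq (fun z => mexp z : R[i]^o) z ((mres z - mres z ^+ 2) / 2).
Proof.
move=> /dq_mres h; have := dqD (dqM (dq_cst (2^-1 : R[i]^o) z) h) (dq_cst (- 4^-1 : R[i]^o) z).
congr dq; first by apply/funext => w; rewrite /mexp (mulrC (mres w)).
by rewrite scale0r add0r addr0 (mulrC (_ - _)).
Qed.

Lemma dq_mresX n z : 0 < complex.Re z ->
  dq (fun z => mres z ^+ n : R[i]^o) z (n%:R * (1 - mres z) * mres z ^+ n).
Proof.
move=> z0; elim: n => [|n IH].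
  by rewrite !mul0r; exact: (dq_cst (1 : R[i]^o)).
have := dqM (dq_mres z0) IH; congr dq; first by apply/funext => w; rewrite exprS.
have e0 : (mres z - mres z ^+ 2) * mres z ^+ n + mres z * (n%:R * (1 - mres z) * mres z ^+ n) =
    n.+1%:R * (1 - mres z) * mres z ^+ n.+1 by rewrite [_ ^+ n.+1]exprS -natr1; ring.
exact: e0.
Qed.

(** The norm of the family is governed by [|r| / Re a]. Here [Re a = (1 - |q|^2) / (4 |1 - q|^2)],
    and inside a cone [|1 - q|] is comparable with [1 - |q|]. *)
Lemma mexp_bound (kappa : R) z : 0 <= kappa -> 0 < complex.Re z -> `|complex.Im z| <= kappa * complex.Re z ->
  0 < complex.Re (mexp z) /\ cabs (mres z) <= 4 * (1 + 2 * kappa) * complex.Re (mexp z).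
Proof.
move=> k0 z0 hz; have u0 := mden_neq0 z0; rewrite /mexp /mres.
have := cabs_sqr (cexp (- z)); rewrite cabs_cexp.
have hE : complex.Re (- z) = - complex.Re z by case: (z).
have hI : complex.Im (- z) = - complex.Im z by case: (z).
rewrite hE; set E := expR _ => hq.
have E1 : E < 1 by rewrite /E -expR0 ltr_expR oppr_lt0.
have E0 : 0 < E by exact: expR_gt0.
(* With [E = |q|], the modulus contributes [1 - E] and the argument at most [2 E |Im z| <= 2 kappa E
   Re z <= 2 kappa (1 - E)]. *)
have hn : cabs (1 - cexp (- z)) <= (1 - E) * (1 + 2 * kappa).
  have -> : 1 - cexp (- z) = (1 - E)%:C + E%:C * (1 - cis (- complex.Im z)).
    by rewrite /cexp hE hI -/E rmorphB /= mulrBr mulr1 addrA subrK.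
  rewrite (le_trans (cabsD _ _)) // cabsM !cabs_real !ger0_norm ?subr_ge0 ?(ltW E1) ?(ltW E0) //.
  rewrite mulrDr mulr1 lerD2l -cabsN opprB (le_trans (ler_wpM2l (ltW E0) (cis_sub1 _))) // normrN.
  have h1 : E * complex.Re z <= 1 - E.
    have : E * (1 + complex.Re z) <= 1.
      by rewrite /E expRN mulrC ler_pdivrMr ?expR_gt0 // mul1r expR_ge1Dx.
    by lra.
  have h2 := ler_wpM2l (ltW E0) hz; have h3 := ler_wpM2l k0 h1; lra.
have n0 : 0 < cabs (1 - cexp (- z)) by rewrite cabs_gt0.
set n := cabs _ in hn n0 *.
(* [Re (1 / (1 - q)) = (1 - Re q) / n^2] and [n^2 = 1 - 2 Re q + E^2]. *)
have hr : complex.Re ((1 - cexp (- z))^-1 / 2 - 4^-1) = (1 - E ^+ 2) / (4 * n ^+ 2).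
  have hs := cabs_sqr (1 - cexp (- z)).
  have hn0 : n ^+ 2 != 0 by rewrite expf_neq0 // gt_eqF.
  move: hs hn0; rewrite hq -/n => ->; case: (cexp (- z)) => p q /= h0.
  have -> : p ^+ 2 + q ^+ 2 = (1 - p) ^+ 2 + (0 - q) ^+ 2 - 1 + 2 * p by ring.
  by move: h0; set m := _ + (0 - q) ^+ 2 => m0; field.
rewrite hr; have hE2 : 0 < 1 - E ^+ 2 by nra.
split; first by rewrite divr_gt0 // mulr_gt0 // exprn_gt0.
rewrite cabsV -/n; have -> : 4 * (1 + 2 * kappa) * ((1 - E ^+ 2) / (4 * n ^+ 2)) = (1 + 2 * kappa) * (1 - E ^+ 2) / n / n.
  by field; rewrite gt_eqF.
rewrite -{1}[n^-1]mul1r ler_pM2r ?invr_gt0 // ler_pdivlMr // mul1r (le_trans hn) //.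
rewrite mulrC ler_wpM2l ?addr_ge0 ?mulr_ge0 //; nra.
Qed.
End mehler_parameters.

Lemma mean_value0 {R : realType} {X : normedModType R[i]} (F : R -> X) (a b : R) : a <= b ->
  (forall t, a <= t <= b -> dqr F t 0) -> F b = F a.
Proof.
move=> ab hF; have /= h : rnorm (F b - F a) <= 0 * (b - a).
  by apply: mean_value => // t /hF h; exists 0; rewrite ?rnorm0.
by apply: subr0_eq; apply: rnorm_eq0; apply: le_anti; rewrite rnorm_ge0 andbT -(mul0r (b - a)).
Qed.

(** Product rule for operators that are differentiable only vector by vector: differentiability at
    the vector [g'] controls the cross term, and the local bound [K] controls the remainder of
    [g]. *)
Lemma dqr_app {R : realType} {X : normedModType R[i]} (P : R -> X -> X) (g : R -> X) s p p' g' (K : R) :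
  0 <= K -> (exists2 e : R, 0 < e & forall h, `|h| <= e ->
    linear (P (s + h)) /\ forall x, rnorm (P (s + h) x) <= K * rnorm x) ->
  dqr (fun t => P t (g s)) s p -> dqr (fun t => P t g') s p' -> dqr g s g' ->
  dqr (fun t => P t (g t)) s (p + P s g').
Proof.
move=> K0 [e e0 bP] [C1 [d1 [C10 d10 H1]]] /dqr_lip[C2 [d2 [C20 d20 H2]]] [C3 [d3 [C30 d30 H3]]].
exists (C1 + C2 + K * C3), (Num.min (Num.min e d1) (Num.min d2 d3)); split.
- by rewrite !addr_ge0 ?mulr_ge0.
- by rewrite !lt_min e0 d10 d20.
move=> h; rewrite !le_min => /andP[/andP[he h1] /andP[h2 h3]].
have [lP bPh] := bP _ he; have := bP 0; rewrite normr0 addr0 => /(_ (ltW e0))[lPs _].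
have -> : P (s + h) (g (s + h)) - P s (g s) - h%:C *: (p + P s g') =
    (P (s + h) (g s) - P s (g s) - h%:C *: p) + h%:C *: (P (s + h) g' - P s g') +
    P (s + h) (g (s + h) - g s - h%:C *: g').
  by rewrite !(linrB lP) (linrZ lP); linx R[i].
rewrite mulrDl (le_trans (rnormD _ _)) // lerD //.
  rewrite mulrDl (le_trans (rnormD _ _)) // lerD //; first exact: H1.
  rewrite rnormZ cabs_real (le_trans (ler_wpM2l (normr_ge0 _) (H2 _ h2))) //.
  by rewrite mulrCA -expr2.
by rewrite (le_trans (bPh _)) // -mulrA ler_wpM2l // H3.
Qed.

Section mehler_family.
Context {R : realType} {X : completeNormedModType R[i]} {d : nat}.
Variables (A B : 'I_d -> set (X * X)) (EA EB : 'I_d -> R -> X -> X).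
Hypothesis W : weyl_pair A B EA EB.
Local Notation wexp := (wexp EA EB).
Local Notation tg := (tg EA EB).
Local Notation tgw := (tgw EA EB).
Local Notation sqrs := (sqrs A B).
Implicit Types (z w : R[i]) (f g : X).

Lemma dq_tg a f : 0 < complex.Re a -> dq (fun a => tg a f) a (- tgw a (fun p => (nq p)%:C) f).
Proof.
move=> a0; have hk := qgrowthZ (-1) (@qgrowth_nq R d).
have [C [e [C0 e0 H]]] := dq_gint hk (gfun_wexp W a0 f).
exists C, e; split=> // h /H.
have eqg h' : gint (fun p => cexp (h' * (-1 * (nq p)%:C)) *: gker a (wexp f) p) = tg (a + h') f.
  apply: eq_gint => p; rewrite /gker scalerA -cexpD; congr (cexp _ *: _); ring.
rewrite !eqg add0r addr0.
have -> : gint (fun p => -1 * (nq p)%:C *: gker a (wexp f) p) = - tgw a (fun p => (nq p)%:C) f.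
  have := gintZ (-1) (gfunM (@qgrowth_nq R d) (gfun_wexp W a0 f)).
  rewrite scaleN1r => <-; apply: eq_gint => p; exact: (esym (scalerA _ _ _)).
by [].
Qed.

Definition mehler_const z : R[i] := ((2 * pi) ^- d)%:C * mres z ^+ d.
(** For position and momentum operators this is the Mehler semigroup of the harmonic oscillator,
    hence the name. *)
Definition mehler z f : X := mehler_const z *: tg (mexp z) f.

Lemma Re_mexp_gt0 z : 0 < complex.Re z -> 0 < complex.Re (mexp z).
Proof.
move=> z0; have k0 : 0 <= `|complex.Im z| / complex.Re z by rewrite divr_ge0 // ltW.
by have [] := mexp_bound k0 z0; rewrite ?divfK // gt_eqF.
Qed.

Lemma mehler_lin z : 0 < complex.Re z -> linear (mehler z).
Proof.
by move=> /Re_mexp_gt0 z0 x f g; rewrite /mehler (tg_lin W z0); linx R[i].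
Qed.

(** This is [- L f] when [s] is the sum of all squares applied to [f]. *)
Definition mehler_gen f (s : X) : X := - 2^-1 *: s + (2^-1 * d%:R) *: f.

Lemma mehler_const_dq z : 0 < complex.Re z ->
  dq (fun z => mehler_const z : R[i]^o) z (d%:R * (1 - mres z) * mehler_const z).
Proof.
move=> z0; have := dqM (dq_cst (((2 * pi) ^- d)%:C : R[i]^o) z) (dq_mresX d z0).
congr dq; rewrite scale0r add0r.
have e0 : ((2 * pi) ^- d)%:C * (d%:R * (1 - mres z) * mres z ^+ d) =
  d%:R * (1 - mres z) * mehler_const z by rewrite /mehler_const; ring.
exact: e0.
Qed.

Lemma mehler_dq z f : 0 < complex.Re z ->
  dq (fun z => mehler z f) z (mehler_gen (mehler z f) (mehler_const z *: sum_sqrs_tg EA EB (mexp z) f)).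
Proof.
move=> z0; have a0 := Re_mexp_gt0 z0.
have h := dq_comp (dq_mexp z0) (dq_tg f a0).
have := dqM (mehler_const_dq z0) h; congr dq.
rewrite /mehler_gen /mehler /sum_sqrs_tg.
set t := tg _ _; set s := tgw _ _ _; set c := mehler_const z; rewrite /mexp; set r := mres z.
(* Two scalar identities: [4 a^2 - 1/4 = r^2 - r] for the weighted integral, and
   [d (1 - r) = d / 2 - 2 d a] for the plain one. *)
by linx R[i]; field.
Qed.

Lemma mehler_sqrs z f : 0 < complex.Re z ->
  exists2 g, sqrs (mehler z f) g & dq (fun z => mehler z f) z (mehler_gen (mehler z f) (\sum_c g c)).
Proof.
move=> z0; have [g hg eg] := tg_sqrs W (Re_mexp_gt0 z0) f.
exists (fun c => mehler_const z *: g c); last by rewrite -scaler_sumr eg; exact: mehler_dq.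
move=> c; have [y hy1 hy2] := hg c.
by exists (mehler_const z *: y); apply: (opcZ W).
Qed.

Lemma mehler_dq_sqrs z f (g : bool * 'I_d -> X) : 0 < complex.Re z -> sqrs f g ->
  dq (fun z => mehler z f) z (mehler z (mehler_gen f (\sum_c g c))).
Proof.
move=> z0 hg; have a0 := Re_mexp_gt0 z0; have := mehler_dq f z0; congr dq.
rewrite {2}/mehler_gen (linrD (mehler_lin z0)) !(linrZ (mehler_lin z0)) /mehler_gen.
by rewrite {2}/mehler (sqrs_tg W a0 hg).
Qed.

Lemma mehler_bound : exists2 M : R, 1 <= M & forall kappa z f, 0 <= kappa -> 0 < complex.Re z ->
  `|complex.Im z| <= kappa * complex.Re z -> rnorm (mehler z f) <= M * (2 * (1 + 2 * kappa)) ^+ d * rnorm f.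
Proof.
have [M M1 hM] := wexp_bound W; exists M => // kappa z f k0 z0 hz.
have [a0 hr] := mexp_bound k0 z0 hz; have M0 := le_trans ler01 M1.
rewrite /mehler rnormZ (le_trans (ler_wpM2l (cabs_ge0 _) (tg_bound W a0 f hM))) //.
rewrite !mulrA ler_wpM2r ?rnorm_ge0 // mulrAC mulrC ler_wpM2l //.
rewrite /mehler_const cabsM cabsX cabs_real ger0_norm; last by rewrite invr_ge0 exprn_ge0 // mulr_ge0 // pi_ge0.
rewrite -exprVn -!exprMn; set b := complex.Re _ in a0 hr *; have p0 := pi_gt0 R.
move: pi p0 => q p0.
(* Per degree of freedom, the prefactor [|r| / (2 pi)] times the Gaussian mass [pi / Re a]. *)
have -> : (2 * q)^-1 * cabs (mres z) * (q / b) = cabs (mres z) / (2 * b).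
  by have b0 := lt0r_neq0 a0; have q0 := lt0r_neq0 p0; field; rewrite b0 q0.
have r0 := cabs_ge0 (mres z); have k1 : 0 <= 2 * (1 + 2 * kappa) by lra.
rewrite lerXn2r ?nnegrE // ?divr_ge0 ?mulr_ge0 ?(ltW a0) //.
rewrite ler_pdivrMr ?mulr_gt0 // (le_trans hr) // le_eqVlt; apply/orP; left; apply/eqP; ring.
Qed.

Lemma mehler_local_bound z : 0 < complex.Re z -> exists2 K : R, 0 <= K & exists2 e : R, 0 < e &
  forall h, cabs h <= e -> 0 < complex.Re (z + h) /\ forall f, rnorm (mehler (z + h) f) <= K * rnorm f.
Proof.
move=> z0; have [M M1 hM] := mehler_bound; have M0 := le_trans ler01 M1.
(* A cone wide enough for a whole disc around [z], where [|Im|] is at most [|Im z| + 1] and [Re] at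
   least [x / 2]. *)
set x := complex.Re z in z0 *; pose kappa := (`|complex.Im z| + 1) / (x / 2).
have k0 : 0 <= kappa by rewrite divr_ge0 ?addr_ge0 ?divr_ge0 // ltW.
exists (M * (2 * (1 + 2 * kappa)) ^+ d); first by rewrite mulr_ge0 // exprn_ge0 // mulr_ge0 // addr_ge0 // mulr_ge0.
exists (Num.min 1 (x / 2)); first by rewrite lt_min ltr01 divr_gt0.
move=> h; rewrite le_min => /andP[h1 h2].
have hr := le_trans (Re_le_cabs h) h2; have hi := le_trans (Im_le_cabs h) h1.
have eR : complex.Re (z + h) = x + complex.Re h by rewrite /x; case: (z) => ? ?; case: (h).
have eI : complex.Im (z + h) = complex.Im z + complex.Im h by case: (z) => ? ?; case: (h).
have hx : x / 2 <= complex.Re (z + h) by move: hr; rewrite eR ler_norml => /andP[]; lra.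
have hx0 : 0 < complex.Re (z + h) by rewrite (lt_le_trans _ hx) // divr_gt0.
split=> // f; apply: hM => //.
rewrite eI (le_trans (ler_normD _ _)) // (le_trans (_ : _ <= `|complex.Im z| + 1)) ?lerD2l //.
rewrite (le_trans _ (ler_wpM2l k0 hx)) // /kappa divfK // gt_eqF // divr_gt0 //.
Qed.

Lemma mehler_line_bound z (al : R[i]) (s : R) : 0 < complex.Re (z + s%:C * al) ->
  exists2 K : R, 0 <= K & exists2 e : R, 0 < e & forall h : R, `|h| <= e ->
    linear (mehler (z + (s + h)%:C * al)) /\ forall f, rnorm (mehler (z + (s + h)%:C * al) f) <= K * rnorm f.
Proof.
move=> /mehler_local_bound[K K0 [e e0 hK]]; exists K => //.
have al1 : 0 < cabs al + 1 by rewrite ltr_wpDl ?cabs_ge0.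
exists (e / (cabs al + 1)); first exact: divr_gt0.
move=> h; rewrite ler_pdivlMr // => he.
have -> : z + (s + h)%:C * al = z + s%:C * al + h%:C * al by rewrite rmorphD /= mulrDl addrA.
have hal : cabs (h%:C * al) <= e.
  by rewrite cabsM cabs_real (le_trans _ he) // ler_wpM2l // lerDl.
by have [h3 h4] := hK _ hal; split; [exact: mehler_lin|exact: h4].
Qed.

(** Time is moved from the second factor to the first. Both arguments must stay in the right
    half-plane, so [w] cannot be used up completely; the remaining limit is left to [mehlerD]. *)
Lemma mehler_transfer z w (al : R[i]) (b : R) f : 0 <= b ->
  (forall s : R, 0 <= s <= b -> 0 < complex.Re (z + s%:C * al) /\ 0 < complex.Re (w + s%:C * - al)) ->
  mehler (z + b%:C * al) (mehler (w + b%:C * - al) f) = mehler z (mehler w f).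
Proof.
move=> b0 hs; pose F (s : R) := mehler (z + s%:C * al) (mehler (w + s%:C * - al) f).
have F0 : F 0 = mehler z (mehler w f) by rewrite /F !rmorph0 !mul0r !addr0.
rewrite -F0; apply: (mean_value0 (F := F) b0) => s /hs[h1 h2].
have [g hg hd] := mehler_sqrs f h2.
set G := mehler_gen _ _ in hd.
have d2 := dq_line hd; have d1 := dq_line (mehler_dq_sqrs h1 hg); rewrite -/G in d1.
have d3 := dq_line (mehler_dq (- al *: G) h1).
have [K K0 hK] := mehler_line_bound h1.
(* The inner value lies in [D], so the outer factor can be differentiated in the form [Q' = - Q L];
   this cancels against the derivative of the inner factor. *)
have -> : 0 = al *: mehler (z + s%:C * al) G + mehler (z + s%:C * al) (- al *: G).
  by rewrite (linrZ (mehler_lin h1)) scaleNr subrr.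
apply: (dqr_app (P := fun s => mehler (z + s%:C * al)) K0 _ d1 d3 d2).
exact: hK.
Qed.

End mehler_family.

Lemma dqrZ {R : realType} {X : normedModType R[i]} (k : R -> R[i]^o) s k' (v : X) :
  dqr k s k' -> dqr (fun t => k t *: v) s (k' *: v).
Proof.
move=> [C [e [C0 e0 H]]]; exists (C * rnorm v), e; split=> //; first by rewrite mulr_ge0 ?rnorm_ge0.
move=> h he; rewrite scalerA -!scalerBl rnormZ mulrAC ler_wpM2r ?rnorm_ge0 //.
exact: H.
Qed.

Lemma dqrM {R : realType} {X : normedModType R[i]} (k : R -> R[i]^o) (F : R -> X) s k' y :
  dqr k s k' -> dqr F s y -> dqr (fun t => k t *: F t) s (k' *: F s + k s *: y).
Proof.
move=> hk hF; have [C [e [C0 e0 H]]] := dqr_lip hk.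
have K0 : 0 <= C * e + cabs (k s) by rewrite addr_ge0 ?cabs_ge0 // mulr_ge0 // ltW.
apply: (dqr_app (P := fun t x => k t *: x) K0 _ (dqrZ (F s) hk) (dqrZ y hk) hF).
exists e => // h he; split=> [c a b|f]; first by rewrite scalerDr !scalerA mulrC.
rewrite rnormZ ler_wpM2r ?rnorm_ge0 // -[k (s + h)](subrK (k s)) (le_trans (cabsD _ _)) // lerD2r.
by rewrite (le_trans (H _ he)) // ler_wpM2l.
Qed.

(** * Fourier transform of a Gaussian *)

Section oscillation.
Context {R : realType} {X : normedModType R[i]} {d : nat}.
Local Notation E := (rvec R d * rvec R d)%type.
Variables (sg : E) (x : X).

Definition pdot (p q : E) : R := dotv p.1 q.1 + dotv p.2 q.2.

Lemma pdot_pcoord p q : pdot p q = \sum_c pcoord c p * pcoord c q.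
Proof. by rewrite sum_bool_ord big_split. Qed.

(** The Fourier phase at frequency [s sg]: [s] leads from the plain Gaussian integral at [0] to the
    transform at [1], through a differential equation. *)
Definition fosc (s : R) (p : E) : X := cis (- (s * pdot p sg)) *: x.

Lemma scont_pdot : scont (fun p : E => (pdot p sg)%:C : R[i]^o).
Proof.
apply: scont_real => q p qp; under eq_fun => n do rewrite pdot_pcoord.
rewrite pdot_pcoord.
have key (s : seq (bool * 'I_d)) : \sum_(c <- s) pcoord c (q n) * pcoord c sg @[n --> \oo] -->
    (\sum_(c <- s) pcoord c p * pcoord c sg : R); last exact: key.
elim: s => [|c s IH].
  by under eq_fun => n do rewrite big_nil; rewrite big_nil; exact: cvg_cst.
under eq_fun => n do rewrite big_cons; rewrite big_cons; apply: cvgD => //.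
by apply: cvgM; [exact: pcoord_cvg|exact: cvg_cst].
Qed.

Lemma bcont_fosc s : bcont (fosc s).
Proof.
split; last by exists (rnorm x); rewrite ?rnorm_ge0 // => p; rewrite rnormZ cabs_cis mul1r.
rewrite (_ : fosc s = fun p => cexp ((- s%:C * 'i) * (pdot p sg)%:C) *: x); last first.
  by apply/funext => p; rewrite /fosc cisE rmorphN rmorphM /=; congr (cexp _ *: _); ring.
apply: scontM; last exact: scont_cst.
apply: scont_cexp; apply: scontMs; [exact: (@scont_cst R d R[i]^o)|exact: scont_pdot].
Qed.

Lemma qgrowth_pdot : qgrowth (fun p : E => - 'i * (pdot p sg)%:C : R[i]^o).
Proof.
rewrite (_ : (fun _ => _) = fun p => \sum_c (- 'i * (pcoord c sg)%:C) * (pcoord c p)%:C); last first.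
  apply/funext => p; rewrite pdot_pcoord rmorph_sum mulr_sumr; apply: eq_bigr => c _.
  by rewrite rmorphM /=; ring.
elim: (index_enum _) => [|c s IH].
  by rewrite (_ : (fun _ => _) = fun=> 0); [exact: qgrowth_cst|apply/funext => p; rewrite big_nil].
rewrite (_ : (fun _ => _) = fun p => (- 'i * (pcoord c sg)%:C) * (pcoord c p)%:C +
    \sum_(c <- s) (- 'i * (pcoord c sg)%:C) * (pcoord c p)%:C); last first.
  by apply/funext => p; rewrite big_cons.
by apply: qgrowthD IH; apply: qgrowthZ; exact: qgrowth_pcoord.
Qed.

End oscillation.

Section gauss_fourier.
Context {R : realType} {X : completeNormedModType R[i]} {d : nat}.
Local Notation E := (rvec R d * rvec R d)%type.
Variables (lam : R) (sg : E) (x : X).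
Hypothesis lam0 : 0 < lam.
Local Notation fosc := (fosc sg x).

Let lamC : lam%:C != 0. Proof. by rewrite (fmorph_eq0 (real_complex R)) gt_eqF. Qed.

Lemma gint_scalar (k : E -> R[i]^o) : gfun k -> gint (fun p => k p *: x) = complex_integral k *: x.
Proof.
move=> hk; apply: gint_eq.
apply: (bint_map (V := fun c : R[i]^o => c *: x) (M := rnorm x)) (bint_scalar hk); rewrite ?rnorm_ge0 //.
  by move=> c a b; rewrite scalerDl scalerA.
by move=> c; rewrite rnormZ mulrC.
Qed.

Lemma gint_gauss : gint (gker lam%:C (fun _ : E => x)) = ((pi / lam) ^+ d)%:C *: x.
Proof.
have hk : gfun (fun p : E => cexp (- lam%:C * (nq p)%:C) *: (1 : R[i]^o)).
  by apply: gfun_gauss => //; split; [exact: scont_cst|exists (rnorm (1 : R[i]^o)); rewrite ?rnorm_ge0].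
have eg p : cexp (- lam%:C * (nq p)%:C) *: (1 : R[i]^o) = (expR (- (lam * nq p)))%:C.
  by rewrite [_ *: _]mulr1 -rmorphN -rmorphM cexp_real mulNr.
rewrite -(eq_gint (F := fun p => (cexp (- lam%:C * (nq p)%:C) *: (1 : R[i]^o)) *: x)); last first.
  by move=> p; rewrite /gker [X in X *: _]mulr1.
rewrite gint_scalar //; congr (_ *: _); rewrite /complex_integral.
have -> : (fun p : E => complex.Re (cexp (- lam%:C * (nq p)%:C) *: (1 : R[i]^o))) = fun p => expR (- (lam * nq p)).
  by apply/funext => p; rewrite eg.
have -> : (fun p : E => complex.Im (cexp (- lam%:C * (nq p)%:C) *: (1 : R[i]^o))) = fun=> 0.
  by apply/funext => p; rewrite eg.
by rewrite /Rintegral integral0 gauss_lebesgue2.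
Qed.

Let H s := gint (gker lam%:C (fosc s)).

Lemma pdot_unit c t p : pdot (trp (punit c t) p) sg = pdot p sg + t * pcoord c sg.
Proof.
rewrite !pdot_pcoord (bigD1 c) //= [in RHS](bigD1 c) //= pcoord_unit eqxx mulrDl -!addrA; congr (_ + _).
rewrite addrC; congr (_ + _); apply: eq_bigr => c' /negbTE h.
by rewrite pcoord_unit h addr0.
Qed.

(** Integration by parts in disguise: translating the phase along [c] only multiplies the integral
    by a scalar exponential, so the translation derivative is found in two ways and uniqueness
    equates them. *)
Lemma fosc_coord s c : gint (fun p => (2 * lam%:C * (pcoord c p)%:C) *: gker lam%:C (fosc s) p) =
  (- (s * pcoord c sg)%:C * 'i) *: H s.
Proof.
set kap := - (s * pcoord c sg)%:C * 'i.
have h1 : dqr (fun t => gint (gker lam%:C (shifted 0 c (fosc s) t))) 0 _ :=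
  gshift0_dqr 0 c (a := lam%:C) lam0 (bcont_fosc sg x s).
have h2 : dqr (fun t => gint (gker lam%:C (shifted 0 c (fosc s) t))) 0 (kap *: H s).
  have h3 : dq (fun z => z * kap : R[i]^o) 0 kap.
    have := dqM (X := R[i]^o) (dq_id 0) (dq_cst (kap : R[i]^o) 0).
    by congr dq; rewrite scaler0 addr0 scale1r.
  have h4 := dq_comp h3 (dq_cexp _).
  have := dq_real (dqM h4 (dq_cst (H s) 0)).
  rewrite mul0r cexp0 scaler0 addr0 [X in X *: _]mulr1; congr dqr.
  apply/funext => t; rewrite /H -gintZ; last exact: gfun_gker (bcont_fosc sg x s).
  apply: eq_gint => p; rewrite /gker /shifted /fosc mul0r mul0r cis0 scale1r pdot_unit.
  have -> : cis (- (s * (pdot p sg + t * pcoord c sg))) = cexp (t%:C * kap) * cis (- (s * pdot p sg)).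
    rewrite mulrDr opprD addrC cisD; congr (_ * _); rewrite cisE; congr cexp.
    by rewrite /kap !(rmorphN, rmorphM) /=; ring.
  by linx R[i].
rewrite -(dqr_uniq h1 h2); apply: eq_gint => p; rewrite /shift_weight rmorph0 mul0r mul0r addr0 //.
Qed.

(* The translation identity for each coordinate expresses the first moments of
   the integrand through [H s], so that H' = - s |sg|^2 / (2 lam) H. *)
Lemma fosc_dqr s : dqr H s (- (s * nq sg / (2 * lam))%:C *: H s).
Proof.
have hg := @gfun_gker _ _ _ lam%:C _ lam0 (bcont_fosc sg x s).
have [C [e [C0 e0 K]]] := dq_real (dq_gint (qgrowth_pdot sg) hg).
exists C, e; split=> // h /K.
have eH (h' : R) : gint (fun p => cexp (h'%:C * (- 'i * (pdot p sg)%:C)) *: gker lam%:C (fosc s) p) = H (s + h').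
  apply: eq_gint => p; rewrite /gker /fosc mulrDl opprD addrC cisD.
  have -> : cexp (h'%:C * (- 'i * (pdot p sg)%:C)) = cis (- (h' * pdot p sg)).
    by rewrite cisE; congr cexp; rewrite !(rmorphN, rmorphM) /=; ring.
  by linx R[i].
rewrite !eH add0r addr0.
have -> // : gint (fun p => (- 'i * (pdot p sg)%:C) *: gker lam%:C (fosc s) p) = - (s * nq sg / (2 * lam))%:C *: H s.
have hc c := gfunM (qgrowthZ (2 * lam%:C) (qgrowth_pcoord c)) hg.
transitivity (gint (fun p => \sum_c (- 'i * (pcoord c sg)%:C / (2 * lam%:C)) *:
    ((2 * lam%:C * (pcoord c p)%:C) *: gker lam%:C (fosc s) p))).
  apply: eq_gint => p; rewrite pdot_pcoord (rmorph_sum (real_complex R)) /= mulr_sumr scaler_suml; apply: eq_bigr => c _.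
  rewrite [RHS]scalerA; congr (_ *: _); rewrite rmorphM /=; field.
  by rewrite lamC.
rewrite (gint_sum _ (fun c => gfunZ _ (hc c))).2.
transitivity (\sum_c (- 'i * (pcoord c sg)%:C / (2 * lam%:C)) *: ((- (s * pcoord c sg)%:C * 'i) *: H s)).
  by apply: eq_bigr => c _; rewrite -fosc_coord; exact: gintZ.
under eq_bigr => c _ do rewrite scalerA.
rewrite -scaler_suml; congr (_ *: _); rewrite nq_pcoord mulr_sumr mulr_suml.
rewrite (rmorph_sum (real_complex R)) /= -sumrN; apply: eq_bigr => c _.
have i2 : 'i * 'i = -1 :> R[i] by rewrite -expr2 sqrCi.
rewrite !(rmorphN, rmorphM, rmorphXn, fmorphV, rmorph_nat) /=.
transitivity ('i * 'i * (s%:C * (pcoord c sg)%:C ^+ 2 / (2 * lam%:C))); last by rewrite i2; ring.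
by field.
Qed.

Lemma dqr_gauss (m s : R) : dqr (fun t => (expR (t ^+ 2 * m))%:C : R[i]^o) s ((2 * s * m * expR (s ^+ 2 * m))%:C).
Proof.
have h1 : dq (fun z => z * z * m%:C : R[i]^o) s%:C ((2 * s * m)%:C).
  have := dqM (X := R[i]^o) (dqM (X := R[i]^o) (dq_id s%:C) (dq_id s%:C)) (dq_cst (m%:C : R[i]^o) s%:C).
  congr dq; rewrite scaler0 addr0.
  have e0 : (1 * s%:C + s%:C * 1) * m%:C = (2 * s * m)%:C by rewrite !rmorphM /= rmorph_nat; ring.
  exact: e0.
have := dq_comp h1 (dq_cexp _); have e1 : s%:C = 0 + s%:C * 1 by rewrite mulr1 add0r.
rewrite {1}e1 => /dq_line; rewrite scale1r; congr dqr.
  by apply/funext => t; rewrite add0r mulr1 -!rmorphM cexp_real.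
by rewrite -!rmorphM cexp_real [in RHS]rmorphM.
Qed.

Lemma gint_fosc : gint (gker lam%:C (fosc 1)) = ((pi / lam) ^+ d * expR (- (nq sg / (4 * lam))))%:C *: x.
Proof.
(* The equation for [H] reads [H' = - 2 s m H], with integrating factor [expR (s ^+ 2 * m)]; the
   product is constant between [0] and [1]. *)
pose m := nq sg / (4 * lam).
have hF s : dqr (fun t => (expR (t ^+ 2 * m))%:C *: H t) s 0.
  have := dqrM (dqr_gauss m s) (fosc_dqr s); congr dqr.
  rewrite scalerA -scalerDl (_ : _ + _ = 0) ?scale0r //.
  rewrite [X in _ + X](_ : _ = - (expR (s ^+ 2 * m) * (s * nq sg / (2 * lam)))%:C); last first.
    by rewrite [in RHS]rmorphM mulrN.
  by apply/eqP; rewrite subr_eq0; apply/eqP; congr (_%:C); rewrite /m; field; rewrite gt_eqF.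
have := mean_value0 ler01 (fun t _ => hF t); rewrite expr1n mul1r expr0n /= mul0r expR0 scale1r.
have -> : H 0 = gint (gker lam%:C (fun _ : E => x)).
  by apply: eq_gint => p; rewrite /gker /fosc mul0r oppr0 cis0 scale1r.
rewrite gint_gauss => h; rewrite expRN mulrC rmorphM -scalerA -h scalerA -rmorphM mulVf ?gt_eqF ?expR_gt0 //.
by rewrite scale1r.
Qed.

End gauss_fourier.

(** * The Weyl semigroup *)

Section mehler_limits.
Context {R : realType} {X : completeNormedModType R[i]} {d : nat}.
Variables (A B : 'I_d -> set (X * X)) (EA EB : 'I_d -> R -> X -> X).
Hypothesis W : weyl_pair A B EA EB.
Local Notation E := (rvec R d * rvec R d)%type.
Local Notation wexp := (wexp EA EB).
Local Notation tg := (tg EA EB).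
Local Notation sqrs := (sqrs A B).
Local Notation mehler := (mehler EA EB).
Implicit Types (z w : R[i]) (f : X) (t : R).

Lemma mres_real t : mres t%:C = ((1 - expR (- t))^-1)%:C.
Proof. by rewrite /mres -rmorphN cexp_real fmorphV rmorphB. Qed.

Lemma mexp_real t : mexp t%:C = ((1 - expR (- t))^-1 / 2 - 4^-1)%:C.
Proof. by rewrite /mexp mres_real !(rmorphB, rmorphM, fmorphV, rmorph_nat). Qed.

(** Letting the scalar transform act on a vector [y] brings it into the form of [gint_fosc] and also
    into the form of the Bochner integrand of the calculus. *)
Lemma fourier_weyl_symbol t (p : E) (y : X) : 0 < t ->
  fourier (weyl_symbol t) p.1 p.2 *: y = mres t%:C ^+ d *: gker (mexp t%:C) (fun=> y) p.
Proof.
move=> t0; set q := expR (- t).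
have q0 : 0 < q := expR_gt0 _; have q1 : q < 1 by rewrite /q -expR0 ltr_expR oppr_lt0.
pose lam := (1 - q) / (1 + q); have lam0 : 0 < lam by rewrite divr_gt0 ?subr_gt0 // addr_gt0.
have hk : gfun (fun p' : E => cexp (- lam%:C * (nq p')%:C) *: fosc p (1 : R[i]^o) 1 p').
  by apply: gfun_gauss => //; exact: bcont_fosc.
rewrite /fourier -scalerA.
have -> : complex_integral (fun p' : E => weyl_symbol t p'.1 p'.2 * cis (- (dotv p'.1 p.1 + dotv p'.2 p.2))) *: y
    = (((1 + lam) ^+ d)%:C * ((pi / lam) ^+ d * expR (- (nq p / (4 * lam))))%:C) *: y.
  have hk' := gfunZ ((1 + lam) ^+ d)%:C hk.
  rewrite -scalerA -(gint_fosc _ _ lam0) -gintZ; last exact: gfun_gauss (bcont_fosc p y 1).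
  have -> : (fun p' : E => weyl_symbol t p'.1 p'.2 * cis (- (dotv p'.1 p.1 + dotv p'.2 p.2))) =
      fun p' : E => ((1 + lam) ^+ d)%:C *: (cexp (- lam%:C * (nq p')%:C) *: fosc p (1 : R[i]^o) 1 p').
    apply/funext => p'; rewrite /weyl_symbol /weyl_lambda -/q -/lam rmorphM -mulrA.
    by congr (_ * _); rewrite /fosc mul1r -rmorphN -rmorphM cexp_real mulNr; congr (_ * _); rewrite [RHS]mulr1.
  rewrite -(gint_scalar y hk'); apply: eq_gint => p'; rewrite -scalerA; congr (_ *: _).
  by rewrite -scalerA; congr (_ *: _); rewrite /fosc; congr (_ *: _); exact: mulr1.
rewrite /gker !scalerA; congr (_ *: _).
have -> : cexp (- mexp t%:C * (nq p)%:C) = (expR (- ((1 - q)^-1 / 2 - 4^-1) * nq p))%:C.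
  by rewrite mexp_real -/q -rmorphN -rmorphM cexp_real.
rewrite mres_real -/q -rmorphXn -!rmorphM; congr (_%:C).
have p0 := pi_gt0 R; move: pi p0 => c c0.
have e1 : 1 + q != 0 by rewrite gt_eqF // addr_gt0.
have e2 : 1 - q != 0 by rewrite gt_eqF // subr_gt0.
rewrite [(1 + lam) ^+ d * _]mulrA !mulrA -exprVn -!exprMn; congr (_ ^+ d * expR _).
  by rewrite /lam; field; rewrite e1 e2 gt_eqF.
by rewrite /lam; field; rewrite e1 e2.
Qed.

Lemma weyl_calculus_mehler t f : 0 < t -> weyl_calculus EA EB (weyl_symbol t) f = mehler t%:C f.
Proof.
move=> t0; have z0 : 0 < complex.Re t%:C by [].
rewrite /weyl_calculus /mehler /mehler_const -scalerA; congr (_ *: _).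
rewrite /tg -gintZ ?gintE; last exact: (gfun_wexp W (Re_mexp_gt0 z0)).
congr bochner; apply/funext => p; exact: fourier_weyl_symbol.
Qed.

(** Continuity at the origin and the uniform bound combined into one inequality whose right-hand
    side has an explicit Gaussian mean. *)
Lemma wexp_near f (e : R) : 0 < e ->
  exists2 K : R, 0 <= K & forall p, rnorm (wexp f p - f) <= e + K * nq p.
Proof.
move=> e0; have [M M1 hM] := wexp_bound W; have M0 := le_trans ler01 M1.
(* Continuity of [wexp f] is sequential, so the radius is obtained by contradiction from a sequence
   of counterexamples shrinking to the origin. *)
have [dl dl0 hdl] : exists2 dl : R, 0 < dl & forall p, nq p <= dl -> rnorm (wexp f p - f) <= e.
  apply: contrapT => hn.
  have hq n : exists p : E, nq p <= n.+1%:R^-1 /\ e < rnorm (wexp f p - f).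
    apply: contrapT => hp; apply: hn; exists n.+1%:R^-1; first by rewrite invr_gt0.
    move=> p hpn; rewrite leNgt; apply/negP => he; apply: hp; by exists p.
  have [q hq'] := choice hq.
  have hc : pcvg q (porigin : E).
    have hcc c : pcoord c (q n) @[n --> \oo] --> (0 : R).
      have e2 (eps : R) : 0 < eps -> 0 < eps ^+ 2 by move=> h; rewrite exprn_gt0.
      apply/cvgrPdist_le => eps eps0; near=> n; rewrite sub0r normrN.
      rewrite -(@ler_pXn2r _ 2) ?nnegrE ?(ltW eps0) // real_normK ?num_real //.
      rewrite (le_trans (pcoord_sqr_le _ _)) // (le_trans (hq' n).1) // ltW //.
      by near: n; exact: (near_infty_natSinv_lt (PosNum (e2 _ eps0))).
    by move=> i; split; rewrite tnth_mktuple; [exact: (hcc (true, i))|exact: (hcc (false, i))].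
  have hw := @scont_wexp _ _ _ _ _ _ _ W f _ _ hc; rewrite (wexp_origin W) in hw.
  have hn' : \forall n \near \oo, rnorm (wexp f (q n) - f) <= e := rnorm_seq_near hw e0.
  have [N _ hN] := hn'; have := hN N (leqnn N); rewrite leNgt => /negP; apply.
  by have [] := hq' N.
(* Where [nq p > dl], the crude bound [(M + 1) * rnorm f] is at most this constant times [nq p]. *)
have K0 : 0 <= (M + 1) * rnorm f / dl by rewrite divr_ge0 ?mulr_ge0 ?rnorm_ge0 ?addr_ge0 // ltW.
exists ((M + 1) * rnorm f / dl) => // p; have [hp|hp] := leP (nq p) dl.
  by rewrite (le_trans (hdl p hp)) // lerDl mulr_ge0 // nq_ge0.
rewrite (le_trans (rnormB _ _)) // (le_trans (lerD (hM p f) (lexx _))) //.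
rewrite -{2}[rnorm f]mul1r -mulrDl ler_wpDl ?(ltW e0) // mulrAC -mulrA ler_peMr ?mulr_ge0 ?rnorm_ge0 ?addr_ge0 //.
by rewrite ler_pdivlMr // mul1r ltW.
Unshelve. all: end_near.
Qed.

(** Since [1 - e^(-t) <= t <= 1], one has [a >= 1/(2t) - 1/4 >= 1/(4t)]: the kernel concentrates at
    the origin at scale [sqrt t]. *)
Lemma mexp_real_bounds t : 0 < t <= 1 -> let a := complex.Re (mexp t%:C) in
  [/\ 0 < a, a^-1 <= 4 * t & (1 - expR (- t))^-1 = 2 * a + 2^-1].
Proof.
move=> /andP[t0 t1]; rewrite mexp_real /=; set q := expR (- t).
have q1 : q < 1 by rewrite /q -expR0 ltr_expR oppr_lt0.
have hq : 1 - q <= t by have := expR_ge1Dx (- t); rewrite -/q; lra.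
have hr : t^-1 <= (1 - q)^-1 by rewrite lef_pV2 ?posrE // subr_gt0.
have h1 : 1 <= t^-1 by rewrite -invr1 lef_pV2 ?posrE.
have ha : (4 * t)^-1 <= (1 - q)^-1 / 2 - 4^-1 by rewrite invfM; lra.
have h4 : 0 < (4 * t)^-1 by rewrite invr_gt0 mulr_gt0.
split; [exact: lt_le_trans ha| |by lra].
by rewrite -[4 * t]invrK lef_pV2 ?posrE // (lt_le_trans h4).
Qed.

End mehler_limits.

(** * Strong continuity at the origin, on the real axis and in cones *)

Section mehler_continuity.
Context {R : realType} {X : completeNormedModType R[i]} {d : nat}.
Variables (A B : 'I_d -> set (X * X)) (EA EB : 'I_d -> R -> X -> X).
Hypothesis W : weyl_pair A B EA EB.
Local Notation E := (rvec R d * rvec R d)%type.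
Local Notation wexp := (wexp EA EB).
Local Notation tg := (tg EA EB).
Local Notation sqrs := (sqrs A B).
Local Notation mehler := (mehler EA EB).
Local Notation mehler_gen := (@mehler_gen R X d).
Implicit Types (z w : R[i]) (f : X) (t : R).

Lemma tg_dist (a e K : R) f : 0 < a -> 0 <= e -> 0 <= K -> (forall p, rnorm (wexp f p - f) <= e + K * nq p) ->
  rnorm (tg a%:C f - ((pi / a) ^+ d)%:C *: f) <= (e + 2 * K / a) * (2 * pi / a) ^+ d.
Proof.
move=> a0 e0 K0 hK.
have hf : gfun (gker a%:C (fun _ : E => f)).
  by apply: gfun_gauss => //; split; [exact: scont_cst|exists (rnorm f); rewrite ?rnorm_ge0].
have hw := @gfun_wexp _ _ _ _ _ _ _ W a%:C a0 f.
have -> : tg a%:C f - ((pi / a) ^+ d)%:C *: f =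
    gint (fun p => -1 *: gker a%:C (fun _ : E => f) p + gker a%:C (wexp f) p).
  by rewrite (gint_lin _ hf hw) gint_gauss // scaleN1r addrC.
have -> : 2 * pi / a = pi / (a / 2) by field; rewrite gt_eqF.
apply: gint_norm; [|by rewrite divr_gt0|].
  by move: (gfunD (gfunZ (-1) hf) hw).
move=> p; have -> : -1 *: gker a%:C (fun _ : E => f) p + gker a%:C (wexp f) p =
    cexp (- a%:C * (nq p)%:C) *: (wexp f p - f) by rewrite /gker; linx R[i].
rewrite rnormZ -rmorphN -rmorphM cabs_cexp /= mulNr.
rewrite (le_trans (ler_wpM2l (expR_ge0 _) (hK p))) //.
(* One half of the Gaussian reduces the factor [nq p] to [2 / a]; the other half is integrated,
   whence [(2 * pi / a) ^+ d]. *)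
have -> : expR (- (a * nq p)) = expR (- (a / 2 * nq p)) * expR (- (a / 2 * nq p)).
  by rewrite -expRD; congr expR; field.
have n0 := nq_ge0 p; have x0 := expR_gt0 (- (a / 2 * nq p)).
have h1 : nq p * expR (- (a / 2 * nq p)) <= 2 / a.
  rewrite expRN ler_pdivrMr ?expR_gt0 //.
  have h := expR_ge1Dx (a / 2 * nq p).
  have h2 : a / 2 * nq p <= expR (a / 2 * nq p) by lra.
  rewrite -ler_pdivrMl ?divr_gt0 //; move: h2; congr (_ <= _); field; by rewrite gt_eqF.
have h3 : expR (- (a / 2 * nq p)) <= 1 by rewrite -expR0 ler_expR oppr_le0 mulr_ge0 // ltW // divr_gt0.
set x := expR _ in x0 h1 h3 *.
have -> : x * x * (e + K * nq p) = x * (x * e + K * (nq p * x)) by ring.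
rewrite [leRHS]mulrC ler_wpM2l ?(ltW x0) // lerD //; first by rewrite ler_piMl.
by rewrite [2 * K]mulrC -mulrA ler_wpM2l.
Qed.

Lemma mehler_factors (r a c : R) : 0 < a -> 0 < c ->
  (2 * c) ^- d * r ^+ d * (2 * c / a) ^+ d = (r / a) ^+ d /\
  (2 * c) ^- d * r ^+ d * (c / a) ^+ d = (r / (2 * a)) ^+ d.
Proof.
move=> a0 c0; rewrite -exprVn -!exprMn.
by split; congr (_ ^+ d); field; rewrite !gt_eqF.
Qed.

Lemma mehler_real_dist (t e K : R) f : 0 < t <= 1 -> 0 <= e -> 0 <= K ->
  (forall p, rnorm (wexp f p - f) <= e + K * nq p) ->
  rnorm (mehler t%:C f - f) <= 4 ^+ d * (e + 8 * K * t) + d%:R * t * expR d%:R * rnorm f.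
Proof.
move=> t01 e0 K0 hK; have [] := mexp_real_bounds t01; set a := complex.Re _ => a0 ha hr.
have /andP[t0 t1] := t01.
have -> : mehler t%:C f = ((2 * pi) ^- d * (2 * a + 2^-1) ^+ d)%:C *: tg a%:C f.
  have ea : mexp t%:C = a%:C by rewrite /a mexp_real.
  by rewrite /mehler /mehler_const ea mres_real hr rmorphM rmorphXn.
have a2 : 0 <= 2 * a + 2^-1 by rewrite addr_ge0 ?invr_ge0 // mulr_ge0 // ltW.
set c := _ * _; have p0 := pi_gt0 R.
have c0 : 0 <= c by rewrite mulr_ge0 ?invr_ge0 ?exprn_ge0 ?mulr_ge0 ?(ltW p0) // addr_ge0 ?mulr_ge0 // ltW.
have hd := tg_dist a0 e0 K0 hK.
(* The kernel has total mass [(1 + 1/(4a))^d], which is not 1 but tends to 1 with [t]; the second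
   term is this defect. *)
rewrite (_ : _ - f = c%:C *: (tg a%:C f - ((pi / a) ^+ d)%:C *: f) +
  (c * (pi / a) ^+ d - 1)%:C *: f); last first.
  have -> (x y : R) : (x * y - 1)%:C = x%:C * y%:C - 1 :> R[i] by rewrite rmorphB rmorphM.
  by linx R[i].
rewrite (le_trans (rnormD _ _)) // !rnormZ !cabs_real (ger0_norm c0) lerD //.
  rewrite (le_trans (ler_wpM2l c0 hd)) // mulrCA mulrC.
  have -> : c * (2 * pi / a) ^+ d = ((2 * a + 2^-1) / a) ^+ d.
    by have [] := mehler_factors (2 * a + 2^-1) a0 p0.
  apply: ler_pM.
  - by rewrite exprn_ge0 // divr_ge0 // ltW.
  - by rewrite addr_ge0 // divr_ge0 ?mulr_ge0 // ltW.
  (* [(2 a + 1/2) / a = 2 + 1/(2a) <= 2 + 2 t <= 4]. *)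
  - rewrite lerXn2r ?nnegrE ?divr_ge0 ?(ltW a0) //.
    by rewrite mulrDl mulfK ?gt_eqF //; lra.
  - rewrite lerD2l (_ : 8 * K * t = 2 * K * (4 * t)); last by ring.
    by rewrite ler_wpM2l // mulr_ge0.
rewrite ler_wpM2r ?rnorm_ge0 //.
have -> : c * (pi / a) ^+ d = (1 + (4 * a)^-1) ^+ d.
  have -> : 1 + (4 * a)^-1 = (2 * a + 2^-1) / (2 * a) by field; exact: lt0r_neq0 a0.
  by have [] := mehler_factors (2 * a + 2^-1) a0 p0.
have x0 : 0 <= (4 * a)^-1 by rewrite invr_ge0 mulr_ge0 // ltW.
have xt : (4 * a)^-1 <= t by rewrite invfM; move: ha; lra.
rewrite ger0_norm; last by rewrite subr_ge0 exprn_ege1 // lerDl.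
have h1 : (1 + (4 * a)^-1) ^+ d <= expR (d%:R * t).
  rewrite expRM_natl lerXn2r ?nnegrE ?addr_ge0 ?expR_ge0 //.
  by rewrite (le_trans (expR_ge1Dx _)) // ler_expR.
have dt : 0 <= d%:R * t by rewrite mulr_ge0 // ltW.
rewrite (le_trans (lerB h1 (lexx _))) // (le_trans (ler_norm _)) // (le_trans (expR_sub1 _)) //.
by rewrite ger0_norm // ler_wpM2l // ler_expR ler_piMr.
Qed.

Lemma mehler_real_cvg0 f (e : R) : 0 < e ->
  exists2 dl : R, 0 < dl & forall t, 0 < t <= dl -> rnorm (mehler t%:C f - f) <= e.
Proof.
move=> e0; have p4 : 0 < 4 ^+ d :> R by rewrite exprn_gt0.
have e1 : 0 < e / 2 / 4 ^+ d by rewrite !divr_gt0.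
have [K K0 hK] := wexp_near W f e1.
pose C := 4 ^+ d * (8 * K) + d%:R * expR d%:R * rnorm f.
have C0 : 0 <= C by rewrite addr_ge0 ?mulr_ge0 ?rnorm_ge0 ?expR_ge0 ?exprn_ge0.
have C1 : 0 < C + 1 by rewrite ltr_wpDl.
exists (Num.min 1 (e / 2 / (C + 1))); first by rewrite lt_min ltr01 !divr_gt0.
move=> t; rewrite le_min => /andP[t0 /andP[t1 ht]].
have t01 : 0 < t <= 1 by rewrite t0.
have := mehler_real_dist t01 (ltW e1) K0 hK; move/le_trans; apply.
have -> : 4 ^+ d * (e / 2 / 4 ^+ d + 8 * K * t) + d%:R * t * expR d%:R * rnorm f = e / 2 + C * t.
  by rewrite /C; field; rewrite gt_eqF.
have : C * t <= (C + 1) * t by rewrite ler_wpM2r ?(ltW t0) // lerDl.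
move: ht; rewrite ler_pdivlMr //; lra.
Qed.

(** A subsector described in real and imaginary parts; in this form convexity and the norm bound can
    be read off. *)
Definition in_cone (kappa : R) z := 0 < complex.Re z /\ `|complex.Im z| <= kappa * complex.Re z.

Lemma in_cone_convex kappa z w s : 0 <= s <= 1 -> in_cone kappa z -> in_cone kappa w ->
  in_cone kappa (w + s%:C * (z - w)).
Proof.
move=> /andP[s0 s1] [z0 hz] [w0 hw].
have eR : complex.Re (w + s%:C * (z - w)) = (1 - s) * complex.Re w + s * complex.Re z.
  by case: (z); case: (w) => ? ? ? ? /=; ring.
have eI : complex.Im (w + s%:C * (z - w)) = (1 - s) * complex.Im w + s * complex.Im z.
  by case: (z); case: (w) => ? ? ? ? /=; ring.
have s2 : 0 <= 1 - s by rewrite subr_ge0.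
split.
  rewrite eR; have [->|s3] := eqVneq s 0; first by rewrite subr0 mul1r mul0r addr0.
  by rewrite ltr_wpDl ?mulr_ge0 ?(ltW w0) // mulr_gt0 // lt_neqAle eq_sym s3.
rewrite eR eI (le_trans (ler_normD _ _)) // !normrM (ger0_norm s0) (ger0_norm s2).
have := ler_wpM2l s2 hw; have := ler_wpM2l s0 hz; lra.
Qed.

Lemma mehler_cone_bound kappa : 0 <= kappa -> exists2 M : R, 1 <= M &
  forall z f, in_cone kappa z -> rnorm (mehler z f) <= M * rnorm f.
Proof.
move=> k0; have [M M1 hM] := mehler_bound W.
exists (M * (2 * (1 + 2 * kappa)) ^+ d) => [|z f [z0 hz]]; last exact: hM.
by rewrite mulr_ege1 // exprn_ege1 //; lra.
Qed.

Lemma mehler_cone_lip kappa : 0 <= kappa -> exists2 M : R, 1 <= M &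
  forall z w f (g : bool * 'I_d -> X), sqrs f g -> in_cone kappa z -> in_cone kappa w ->
  rnorm (mehler z f - mehler w f) <= M * rnorm (mehler_gen f (\sum_c g c)) * cabs (z - w).
Proof.
move=> k0; have [M M1 hM] := mehler_cone_bound k0; exists M => // z w f g hg hz hw.
have h : rnorm (mehler (w + 1%:C * (z - w)) f - mehler (w + 0%:C * (z - w)) f) <=
    M * rnorm (mehler_gen f (\sum_c g c)) * cabs (z - w) * (1 - 0).
  apply: (mean_value (F := fun s => mehler (w + s%:C * (z - w)) f)) => // s hs.
  have hc := in_cone_convex hs hz hw.
  exists ((z - w) *: mehler (w + s%:C * (z - w)) (mehler_gen f (\sum_c g c))).
    exact: dq_line (mehler_dq_sqrs W hc.1 hg).
  by rewrite rnormZ mulrC ler_wpM2r ?cabs_ge0 // hM.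
have e1 : w + 1%:C * (z - w) = z by rewrite rmorph1 mul1r addrC subrK.
have e0 : w + 0%:C * (z - w) = w by rewrite rmorph0 mul0r addr0.
by move: h; rewrite e1 e0 subr0 mulr1.
Qed.

(** The approximate identity estimate covers real times only. For [f] in [D] the orbit is Lipschitz
    on the cone, so a complex [z] can be compared with a real time tending to [0]. *)
Lemma mehler_sqrs_dist kappa : 0 <= kappa -> exists2 M : R, 1 <= M &
  forall z f (g : bool * 'I_d -> X), sqrs f g -> in_cone kappa z ->
  rnorm (mehler z f - f) <= M * rnorm (mehler_gen f (\sum_c g c)) * cabs z.
Proof.
move=> k0; have [M M1 hM] := mehler_cone_lip k0; exists M => // z f g hg hz.
set C := M * _; have C0 : 0 <= C by rewrite mulr_ge0 ?rnorm_ge0 // (le_trans ler01).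
apply/ler_addgt0Pr => e e0.
have C1 : 0 < C + 1 by rewrite ltr_wpDl.
have [dl dl0 hdl] := mehler_real_cvg0 f (divr_gt0 e0 (ltr0n R 2)).
pose t := Num.min dl (e / 2 / (C + 1)).
have t0 : 0 < t by rewrite lt_min dl0 !divr_gt0.
have tc : in_cone kappa t%:C by split; rewrite //= normr0 mulr_ge0 // ltW.
rewrite (le_trans (rdistD (mehler t%:C f) _ _)) //.
have h1 := hM _ _ _ _ hg hz tc; rewrite -/C in h1.
have h2 : rnorm (mehler t%:C f - f) <= e / 2 by apply: hdl; rewrite t0 ge_min lexx.
have h3 : cabs (z - t%:C) <= cabs z + t by rewrite (le_trans (cabsD _ _)) // cabsN cabs_real ger0_norm // ltW.
have h4 : C * t <= e / 2.
  have : t <= e / 2 / (C + 1) by rewrite ge_min lexx orbT.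
  rewrite ler_pdivlMr // => h; rewrite (le_trans _ h) // mulrC ler_wpM2l ?(ltW t0) // lerDl //.
have := ler_wpM2l C0 h3; lra.
Qed.

Lemma mehler_sqrs_near f (e : R) : 0 < e -> exists2 h : X, rnorm (h - f) <= e & exists g, sqrs h g.
Proof.
move=> /(mehler_real_cvg0 f)[dl dl0 hdl]; exists (mehler dl%:C f); first by apply: hdl; rewrite dl0 lexx.
by have [g hg _] := mehler_sqrs W f (z := dl%:C) dl0; exists g.
Qed.

(** Density of [D] and the uniform bound on the cone: [f] is replaced by a nearby [h] in [D], at a
    cost of at most [(M + 1)] times their distance. *)
Lemma mehler_cone_cvg0 kappa f (e : R) : 0 <= kappa -> 0 < e ->
  exists2 dl : R, 0 < dl & forall z, in_cone kappa z -> cabs z <= dl -> rnorm (mehler z f - f) <= e.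
Proof.
move=> k0 e0; have [M M1 hM] := mehler_cone_bound k0; have [N N1 hN] := mehler_sqrs_dist k0.
have M0 := le_trans ler01 M1; have N0 := le_trans ler01 N1.
have e1 : 0 < e / (2 * (M + 1)) by rewrite divr_gt0 // mulr_gt0 // ltr_wpDl.
have [h hh [g hg]] := mehler_sqrs_near f e1.
set C := N * rnorm (mehler_gen h (\sum_c g c)); have C0 : 0 <= C by rewrite mulr_ge0 ?rnorm_ge0.
have C1 : 0 < C + 1 by rewrite ltr_wpDl.
exists (e / 2 / (C + 1)); first by rewrite !divr_gt0.
move=> z hz; rewrite ler_pdivlMr // => hc.
have h1 : rnorm (mehler z h - h) <= C * cabs z := hN _ _ _ hg hz.
have -> : mehler z f - f = mehler z (f - h) + (mehler z h - h) + (h - f).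
  by rewrite (linrB (mehler_lin W hz.1)); linx R[i].
have h2 := hM _ (f - h) hz; rewrite rdistC in h2.
have h3 := ler_wpM2l M0 hh.
have h4 : M * (e / (2 * (M + 1))) + e / (2 * (M + 1)) = e / 2 by field; rewrite gt_eqF // ltr_wpDl.
rewrite (le_trans (rnormD _ _)) // (le_trans (lerD (rnormD _ _) (lexx _))) //.
have h5 : C * cabs z <= cabs z * (C + 1) by rewrite mulrC ler_wpM2l ?cabs_ge0 // lerDl.
move: h1 h2 h3 h4 h5 hh hc; lra.
Qed.

End mehler_continuity.

Lemma mul_frac_le {R : realFieldType} (K e : R) : 0 <= K -> 0 <= e -> K * (e / (K + 1)) <= e.
Proof.
by move=> K0 e0; rewrite mulrCA ler_piMr // ler_pdivrMr ?mul1r ?lerDl // ltr_wpDl.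
Qed.

Lemma dqr_real {R : realType} {X : normedModType R[i]} (F : R[i] -> X) (s : R) y :
  dq F s%:C y -> dqr (fun t => F t%:C) s y.
Proof.
move=> [C [e [C0 e0 H]]]; exists C, e; split=> // h he.
by have := H h%:C; rewrite cabs_real rmorphD => /(_ he).
Qed.

(** * Semigroup law and derivative at time zero *)

Section mehler_semigroup.
Context {R : realType} {X : completeNormedModType R[i]} {d : nat}.
Variables (A B : 'I_d -> set (X * X)) (EA EB : 'I_d -> R -> X -> X).
Hypothesis W : weyl_pair A B EA EB.
Local Notation sqrs := (sqrs A B).
Local Notation mehler := (mehler EA EB).
Local Notation mehler_gen := (@mehler_gen R X d).
Implicit Types (z w : R[i]) (f : X) (t : R).

Lemma in_coneZ kappa z t : 0 < t -> in_cone kappa z -> in_cone kappa (t%:C * z).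
Proof.
move=> t0 [z0 hz]; have eR : complex.Re (t%:C * z) = t * complex.Re z by case: (z) => x y /=; rewrite mul0r subr0.
have eI : complex.Im (t%:C * z) = t * complex.Im z by case: (z) => x y /=; rewrite mul0r addr0.
split; first by rewrite eR mulr_gt0.
by rewrite eR eI normrM gtr0_norm // mulrCA ler_wpM2l // ltW.
Qed.

Lemma in_cone_self z : 0 < complex.Re z -> exists2 kappa : R, 0 <= kappa & in_cone kappa z.
Proof.
move=> z0; exists (`|complex.Im z| / complex.Re z); first by rewrite divr_ge0 // ltW.
by split=> //; rewrite divfK // gt_eqF.
Qed.

(** [mehler_transfer] moves all of [w] but a small multiple [h w]. Then [mehler (h w) f] tends to
    [f] inside the cone of [w], while the outer factor is locally bounded and continuous at
    [z + w]. *)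
Lemma mehlerD z w f : 0 < complex.Re z -> 0 < complex.Re w -> mehler (z + w) f = mehler z (mehler w f).
Proof.
move=> z0 w0; apply: subr0_eq; apply: rnorm_eq0; apply: le_anti; rewrite rnorm_ge0 andbT.
apply/ler_addgt0Pr => e e0; rewrite add0r.
have eR s : complex.Re (z + s%:C * w) = complex.Re z + s * complex.Re w.
  by case: (z); case: (w) => ? ? ? ? /=; rewrite mul0r subr0.
have eW s : complex.Re (w + s%:C * - w) = (1 - s) * complex.Re w.
  by case: (w) => ? ? /=; ring.
have hs (b s : R) : b < 1 -> 0 <= s <= b -> 0 < complex.Re (z + s%:C * w) /\ 0 < complex.Re (w + s%:C * - w).
  move=> b1 /andP[s0 sb]; have s1 : 0 < 1 - s by rewrite subr_gt0 (le_lt_trans sb).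
  rewrite eR eW mulr_gt0 //; split=> //; have := mulr_ge0 s0 (ltW w0); lra.
have h1 : 0 < complex.Re (z + 1%:C * w) by rewrite eR mul1r addr_gt0.
have [K K0 [e1 e10 hK]] := mehler_line_bound W h1.
have [C [e2 [C0 e20 hC]]] := dqr_lip (dq_line (mehler_dq W f h1)).
have [kappa k0 hk] := in_cone_self w0.
have K1 : 0 < K + 1 by rewrite ltr_wpDl.
have C1 : 0 < C + 1 by rewrite ltr_wpDl.
have w1 : 0 < cabs w + 1 by rewrite ltr_wpDl ?cabs_ge0.
have [dl dl0 hdl] := mehler_cone_cvg0 W f k0 (divr_gt0 (divr_gt0 e0 (ltr0n R 2)) K1).
pose h := Num.min (Num.min (Num.min 1 e1) e2) (Num.min (dl / (cabs w + 1)) (e / 2 / (C + 1))).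
have h0 : 0 < h by rewrite !lt_min ltr01 e10 e20 !divr_gt0.
have : h <= h by [].
rewrite {2}/h !le_min => /andP[/andP[/andP[h_1 he1] he2] /andP[hw hc]].
have b0 : 0 <= 1 - h by rewrite subr_ge0.
have hh : `|- h| = h by rewrite normrN gtr0_norm.
have ht := mehler_transfer W f b0 (z := z) (w := w) (al := w).
rewrite -ht; last by move=> s; apply: hs; rewrite ltrBlDr ltrDl.
have -> : w + (1 - h)%:C * - w = h%:C * w by rewrite rmorphB rmorph1; ring.
rewrite rdistC; have [lP bP] : linear (mehler (z + (1 - h)%:C * w)) /\
    forall f, rnorm (mehler (z + (1 - h)%:C * w) f) <= K * rnorm f by apply: hK; rewrite hh.
have -> : mehler (z + (1 - h)%:C * w) (mehler (h%:C * w) f) - mehler (z + w) f =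
    mehler (z + (1 - h)%:C * w) (mehler (h%:C * w) f - f) + (mehler (z + (1 - h)%:C * w) f - mehler (z + w) f).
  by rewrite (linrB lP) addrA subrK.
have hcw : cabs (h%:C * w) <= dl.
  rewrite cabsM cabs_real gtr0_norm; last exact: h0.
  move: hw; rewrite ler_pdivlMr; last exact: w1.
  by apply: le_trans; rewrite ler_wpM2l; [|exact: ltW|rewrite lerDl].
have b1 : rnorm (mehler (z + (1 - h)%:C * w) (mehler (h%:C * w) f - f)) <= e / 2.
  apply: (le_trans (bP _)); apply: (le_trans (ler_wpM2l K0 (hdl _ (in_coneZ h0 hk) hcw))).
  exact: mul_frac_le K0 (ltW (divr_gt0 e0 (ltr0n R 2))).
have b2 : rnorm (mehler (z + (1 - h)%:C * w) f - mehler (z + w) f) <= e / 2.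
  have := hC (- h); rewrite hh rmorph1 mul1r => /(_ he2)/le_trans; apply.
  move: hc; rewrite ler_pdivlMr; last exact: C1.
  by apply: le_trans; rewrite mulrC ler_wpM2l; [|exact: ltW|rewrite lerDl].
by rewrite [leRHS]splitr; exact: le_trans (rnormD _ _) (lerD b1 b2).
Qed.

(** The derivative of [Q(s) f - s G] is [Q(s) G - G], which is small, but it is known only for
    [s > 0]. The mean value estimate therefore runs from some [h > 0] to [t], and continuity at [0]
    disposes of [h]. *)
Lemma mehler_diff f (g : bool * 'I_d -> X) (e : R) : sqrs f g -> 0 < e ->
  exists2 dl : R, 0 < dl & forall t, 0 < t <= dl ->
    rnorm (t^-1%:C *: (mehler t%:C f - f) - mehler_gen f (\sum_c g c)) <= e.
Proof.
move=> hg e0; set G := mehler_gen _ _.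
have [dl dl0 hdl] := mehler_real_cvg0 W G e0; exists dl => // t /andP[t0 td].
suff key : rnorm (mehler t%:C f - f - t%:C *: G) <= e * t.
  have -> : t^-1%:C *: (mehler t%:C f - f) - G = t^-1%:C *: (mehler t%:C f - f - t%:C *: G).
    have e1 : t^-1%:C * t%:C = 1 :> R[i] by rewrite -rmorphM mulVf ?gt_eqF // rmorph1.
    by rewrite [RHS]scalerBr [X in _ = _ - X]scalerA e1 scale1r.
  by rewrite rnormZ cabs_real gtr0_norm ?invr_gt0 // mulrC ler_pdivrMr.
apply/ler_addgt0Pr => e' e'0.
have [dl' dl'0 hdl'] := mehler_real_cvg0 W f (divr_gt0 e'0 (ltr0n R 2)).
have G1 : 0 < rnorm G + 1 by rewrite ltr_wpDl ?rnorm_ge0.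
pose h := Num.min (Num.min t dl') (e' / 2 / (rnorm G + 1)).
have h0 : 0 < h by rewrite !lt_min t0 dl'0 !divr_gt0.
have : h <= h by [].
rewrite {2}/h !le_min => /andP[/andP[ht hd] hG].
have hm : rnorm ((mehler t%:C f + t%:C *: - G) - (mehler h%:C f + h%:C *: - G)) <= e * (t - h).
  apply: (mean_value (F := fun s => mehler s%:C f + s%:C *: - G)) => // s /andP[s1 s2].
  have s0 : 0 < s := lt_le_trans h0 s1.
  exists (mehler s%:C G - G); last by apply: hdl; rewrite s0 (le_trans s2).
  apply: (dqr_real (F := fun z => mehler z f + z *: - G)).
  have := dqD (mehler_dq_sqrs W (z := s%:C) s0 hg) (dqM (dq_id s%:C) (dq_cst (- G) s%:C)).
  by rewrite scaler0 addr0 scale1r.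
have -> : mehler t%:C f - f - t%:C *: G = (mehler t%:C f + t%:C *: - G - (mehler h%:C f + h%:C *: - G)) +
   ((mehler h%:C f - f) - h%:C *: G) by linx R[i].
rewrite (le_trans (rnormD _ _)) // lerD //; first by rewrite (le_trans hm) // ler_wpM2l ?(ltW e0) // gerBl ltW.
rewrite (le_trans (rnormB _ _)) // [leRHS]splitr lerD //; first by apply: hdl'; rewrite h0.
rewrite rnormZ cabs_real gtr0_norm //; move: hG; rewrite ler_pdivlMr //; apply: le_trans.
by rewrite ler_wpM2l ?(ltW h0) // lerDl.
Qed.

End mehler_semigroup.

(** * The semigroup, its generator and its analytic extension *)

Section weyl_semigroup_properties.
Context {R : realType} {X : completeNormedModType R[i]} {d : nat}.
Variables (A B : 'I_d -> set (X * X)) (EA EB : 'I_d -> R -> X -> X).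
Hypothesis W : weyl_pair A B EA EB.
Local Notation sqrs := (sqrs A B).
Local Notation mehler := (mehler EA EB).
Local Notation mehler_gen := (@mehler_gen R X d).
Local Notation P := (weyl_semigroup EA EB).
Local Notation D := (op_dom (op_sum_sqr A) `&` op_dom (op_sum_sqr B)).
Implicit Types (z w : R[i]) (f : X) (t : R).

Lemma weyl_semigroup_mehler t f : 0 < t -> P t f = mehler t%:C f.
Proof. by move=> t0; rewrite /weyl_semigroup t0; exact: (weyl_calculus_mehler W f t0). Qed.

Lemma weyl_semigroup0 f : P 0 f = f.
Proof. by rewrite /weyl_semigroup ltxx. Qed.

Lemma near_right (dl : R) : 0 < dl -> \forall t \near (0 : R)^'+, 0 < t <= dl.
Proof.
move=> dl0; near=> t; apply/andP; split; near: t; first exact: nbhs_right_gt.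
exact: nbhs_right_le.
Unshelve. all: end_near. Qed.

Lemma near_right_ex (Q : R -> Prop) : (\forall t \near (0 : R)^'+, Q t) -> exists2 t, 0 < t & Q t.
Proof.
move=> h; have hf : \forall t \near (0 : R)^'+, Q t /\ 0 < t <= 1.
  by apply: filterS2 h (near_right ltr01).
by have [t [Qt /andP[t0 _]]] := @filter_ex _ _ (at_right_proper_filter 0) _ hf; exists t.
Qed.

Lemma weyl_semigroup_cvg0 f : P t f @[t --> (0 : R)^'+] --> f.
Proof.
apply: rnorm_cvg => e /(mehler_real_cvg0 W f)[dl dl0 hdl].
apply: filterS (near_right dl0) => t ht; rewrite weyl_semigroup_mehler; last by case/andP: ht.
exact: hdl.
Qed.

Lemma real_in_cone t : 0 < t -> in_cone 0 t%:C.
Proof. by move=> t0; split; rewrite //= normr0 mul0r. Qed.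

Lemma weyl_semigroup_linear t : 0 <= t -> linear (P t).
Proof.
rewrite le_eqVlt => /predU1P[<-|t0] c f g; first by rewrite !weyl_semigroup0.
by rewrite !weyl_semigroup_mehler // (mehler_lin W (z := t%:C)).
Qed.

Lemma weyl_semigroup_bound : exists2 M : R, 1 <= M & forall t f, 0 <= t -> rnorm (P t f) <= M * rnorm f.
Proof.
have [M M1 hM] := mehler_cone_bound W (lexx 0); exists M => // t f.
rewrite le_eqVlt => /predU1P[<-|t0]; first by rewrite weyl_semigroup0 ler_peMl ?rnorm_ge0.
by rewrite weyl_semigroup_mehler //; apply: hM; exact: real_in_cone.
Qed.

Lemma weyl_semigroupD s t f : 0 <= s -> 0 <= t -> P (s + t) f = P s (P t f).
Proof.
rewrite le_eqVlt => /predU1P[<-|s0]; first by rewrite add0r weyl_semigroup0.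
rewrite le_eqVlt => /predU1P[<-|t0]; first by rewrite addr0 weyl_semigroup0.
rewrite (weyl_semigroup_mehler _ (addr_gt0 s0 t0)) (weyl_semigroup_mehler _ s0) (weyl_semigroup_mehler _ t0).
by rewrite rmorphD; exact: (mehlerD W f (z := s%:C) (w := t%:C) s0 t0).
Qed.

Lemma weyl_semigroup_C0 : bounded_C0_semigroup P.
Proof.
have [M M1 hM] := weyl_semigroup_bound; split; last by exists M => t f t0; rewrite ler_rnormC; exact: hM.
split; [|exact: weyl_semigroup0|exact: weyl_semigroupD|exact: weyl_semigroup_cvg0].
move=> t t0; split; first exact: weyl_semigroup_linear.
by exists M => f; rewrite ler_rnormC; exact: hM.
Qed.

Lemma sum_sqr_domP f : D f <-> exists g, sqrs f g.
Proof.
split=> [[[sA [gA hA _]] [sB [gB hB _]]]|[g hg]].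
  by exists (fun c => if c.1 then gA c.2 else gB c.2) => -[[] j]; [exact: hA|exact: hB].
split; [exists (\sum_j g (true, j)); exists (fun j => g (true, j)) => // j; exact: (hg (true, j))|].
by exists (\sum_j g (false, j)); exists (fun j => g (false, j)) => // j; exact: (hg (false, j)).
Qed.

Lemma generator_sqrs f g : sqrs f g -> generator P (f, mehler_gen f (\sum_c g c)).
Proof.
move=> hg; apply: rnorm_cvg => e /(mehler_diff W hg)[dl dl0 hdl].
apply: filterS (near_right dl0) => t ht; rewrite weyl_semigroup_mehler; last by case/andP: ht.
exact: hdl.
Qed.

Lemma generator_fun f g h : generator P (f, g) -> generator P (f, h) -> g = h.
Proof. exact: cvg_unique. Qed.

Lemma generator_orbit t f g : 0 <= t -> generator P (f, g) -> generator P (P t f, P t g).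
Proof.
move=> t0 hg; have [M M1 hM] := weyl_semigroup_bound; have M0 := le_trans ler01 M1.
apply: rnorm_cvg => e e0; have M2 : 0 < M + 1 by rewrite ltr_wpDl.
have hn : \forall s \near (0 : R)^'+, rnorm ((s^-1)%:C *: (P s f - f) - g) <= e / (M + 1).
  exact: rnorm_near hg (divr_gt0 e0 M2).
apply: filterS2 hn (near_right ltr01) => s hs /andP[s0 _].
have -> : P s (P t f, P t g).1 = P t (P s f).
  by rewrite -(weyl_semigroupD f t0 (ltW s0)) addrC (weyl_semigroupD f (ltW s0) t0).
have lP := weyl_semigroup_linear t0.
rewrite -(linrB lP) -(linrZ lP) -(linrB lP) (le_trans (hM _ _ t0)) //.
by rewrite (le_trans (ler_wpM2l M0 hs)) // mul_frac_le // ltW.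
Qed.

Lemma sum_sqr_dom_orbit t f : 0 < t -> D (P t f).
Proof.
move=> t0; rewrite weyl_semigroup_mehler //; apply/sum_sqr_domP.
by have [g hg _] := mehler_sqrs W f (z := t%:C) t0; exists g.
Qed.

Lemma sum_sqr_dom_dense : dense D.
Proof.
move=> O [f Of] oO; have hO : \forall t \near (0 : R)^'+, O (P t f).
  by apply: weyl_semigroup_cvg0; exact: open_nbhs_nbhs.
have [t t0 Ot] := near_right_ex hO.
by exists (P t f); split=> //; exact: sum_sqr_dom_orbit.
Qed.

Lemma sum_sqr_dom_subspace : is_subspace D.
Proof.
have sqr0 c : op_sqr (opc A B c) (0, 0).
  by have [h0 _ _] := opc_operator W c; exists 0.
split; first by apply/sum_sqr_domP; exists (fun=> 0).
move=> c f g /sum_sqr_domP[u hu] /sum_sqr_domP[v hv]; apply/sum_sqr_domP.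
exists (fun j => c *: u j + v j) => j; have [_ hl _] := opc_operator W j.
have [y /= hy1 hy2] := hu j; have [y' /= hy1' hy2'] := hv j.
exists (c *: y + y'); [exact: (hl c (f, y) (g, y'))|exact: (hl c (y, u j) (y', v j))].
Qed.

Lemma sum_sqr_dom_core : is_core D (generator P).
Proof.
split; first exact: sum_sqr_dom_subspace.
  by move=> f /sum_sqr_domP[g hg]; exists (mehler_gen f (\sum_c g c)); exact: generator_sqrs.
move=> [f g] hfg O hO.
have hc : (P t f, P t g) @[t --> (0 : R)^'+] --> (f, g).
  by apply: cvg_pair; exact: weyl_semigroup_cvg0.
have hn : \forall t \near (0 : R)^'+, O (P t f, P t g) by exact: hc hO.
have [t t0 Ot] := near_right_ex hn.
exists (P t f, P t g); split=> //; split; [exact: generator_orbit (ltW t0) hfg|exact: sum_sqr_dom_orbit].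
Qed.

Lemma op_oppK (G : set (X * X)) : op_opp (op_opp G) = G.
Proof.
apply/seteqP; split=> [[f g] [h /= [k /= hk ->] ->]|[f g] hg].
  by rewrite scalerA mulrNN mulr1 scale1r.
exists (- g); last by rewrite /= scaleN1r opprK.
by exists g => //=; rewrite scaleN1r.
Qed.

(** An equality of graphs, so it compares domains as well: the right-hand side is defined exactly on
    [D], and on [D] single-valuedness of the generator fixes the value. *)
Lemma generator_opp_restrict : op_restrict (op_opp (generator P)) D =
  op_add (op_scale 2^-1 (op_add (op_sum_sqr A) (op_sum_sqr B))) (op_scale (- (2^-1 * d%:R)) op_id).
Proof.
have sumE (g : bool * 'I_d -> X) : \sum_c g c = \sum_j g (true, j) + \sum_j g (false, j).
  by rewrite sum_bool_ord big_split.
apply/seteqP; split=> [[f l] [[y /= hy ->] /= /sum_sqr_domP[g hg]]|].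
  rewrite (generator_fun hy (generator_sqrs hg)).
  exists (2^-1 *: (\sum_c g c)), (- (2^-1 * d%:R) *: f); split=> /=.
  - exists (\sum_c g c) => //=; exists (\sum_j g (true, j)), (\sum_j g (false, j)); split=> //=.
    + by exists (fun j => g (true, j)) => // j; exact: (hg (true, j)).
    + by exists (fun j => g (false, j)) => // j; exact: (hg (false, j)).
    + exact: sumE.
  - by exists f.
  - by rewrite /mehler_gen; linx R[i].
move=> [f l] [u [v [/= [s /= [sA [sB [/= hA hB es]]] eu] [f' /= ef ev] el]]].
have [gA /= hgA eA] := hA; have [gB /= hgB eB] := hB.
pose g (c : bool * 'I_d) := if c.1 then gA c.2 else gB c.2.
have hg : sqrs f g by move=> -[[] j]; [exact: hgA|exact: hgB].
split; last by apply/sum_sqr_domP; exists g.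
exists (mehler_gen f (\sum_c g c)); first exact: generator_sqrs.
have eg : \sum_c g c = sA + sB by rewrite sumE eA eB.
have ef' : f' = f := ef.
by rewrite /= el eu ev es ef' eg /mehler_gen; linx R[i].
Qed.

Lemma sector_Re_gt0 z : sector (pi / 2) z -> 0 < complex.Re z.
Proof.
move=> [r [phi [r0 hphi ->]]] /=; rewrite mul0r subr0 mulr_gt0 //.
by apply: cos_gt0_pihalf; rewrite -ltr_norml.
Qed.

Lemma sector_sub (eta theta : R) z : eta <= theta -> sector eta z -> sector theta z.
Proof. by move=> et [r [phi [r0 h ->]]]; exists r, phi; split=> //; exact: lt_le_trans et. Qed.

(** A crude slope in place of [tan eta]: [|sin phi| <= 1 <= cos phi / cos eta]. *)
Lemma sector_in_cone (eta : R) z : 0 < eta < pi / 2 -> sector eta z -> in_cone (cos eta)^-1 z.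
Proof.
move=> /andP[eta0 eta1] [r [phi [r0 hphi ->]]]; have p0 := pi_gt0 R.
have c0 : 0 < cos eta by apply: cos_gt0_pihalf; lra.
have hc : cos eta <= cos phi.
  have -> : cos phi = cos `|phi| by have [_|_] := ger0P phi; rewrite ?cosN.
  by rewrite leNgt ltr_cos ?in_itv /= ?normr_ge0 /=; [rewrite -leNgt; exact: ltW|lra|lra].
split=> /=; rewrite ?mul0r ?subr0 ?addr0; first by rewrite mulr_gt0 // (lt_le_trans c0).
rewrite normrM gtr0_norm // mulrCA ler_wpM2l ?(ltW r0) // (le_trans (_ : _ <= 1)) //.
  by rewrite ler_norml sin_geN1 sin_le1.
by rewrite mulrC ler_pdivlMr // mul1r.
Qed.

(** At [z = 0] the formula inverts [1 - 1], so the identity is put in by hand. *)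
Definition mehler_ext (z : R[i]^o) f : X := if z == 0 then f else mehler z f.

Lemma mehler_extE z f : 0 < complex.Re z -> mehler_ext z f = mehler z f.
Proof.
move=> z0; rewrite /mehler_ext; case: eqP => // e; by move: z0; rewrite e /= ltxx.
Qed.

Lemma mehler_ext0 f : mehler_ext 0 f = f.
Proof. by rewrite /mehler_ext eqxx. Qed.

Lemma mehler_ext_dq z f : 0 < complex.Re z -> exists y, dq (fun w => mehler_ext w f) z y.
Proof.
move=> z0; have [K _ [e e0 hK]] := mehler_local_bound W z0.
have [g hg [C [e' [C0 e'0 H]]]] := mehler_sqrs W f z0.
exists (mehler_gen (mehler z f) (\sum_c g c)), C, (Num.min e e'); split=> //; first by rewrite lt_min e0.
move=> h; rewrite le_min => /andP[he he']; have [hr _] := hK h he.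
by rewrite !mehler_extE //; exact: H.
Qed.

Lemma near_cabs z (e : R) : 0 < e -> \forall w \near (z : R[i]^o), cabs (w - z) <= e.
Proof.
move=> e0; have h : (w : R[i]^o) @[w --> (z : R[i]^o)] --> (z : R[i]^o) by exact: cvg_id.
exact: rnorm_near h e0.
Qed.

Lemma mehler_ext_within (eta : R) f : 0 < eta < pi / 2 ->
  {within sector eta `|` [set 0], continuous (fun z => mehler_ext z f)}.
Proof.
move=> heta; have /andP[eta0 eta1] := heta; apply/subspace_continuousP => z hz.
have sRe w : sector eta w -> 0 < complex.Re w.
  by move=> /(sector_sub (ltW eta1)); exact: sector_Re_gt0.
apply: rnorm_cvg => e e0; case: hz => [hz|->].
  (* At a point of the open sector differentiability is enough; only the vertex needs the cone
     estimate. *)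
  have [y /dq_lip[C [e1 [C0 e10 H]]]] := mehler_ext_dq f (sRe _ hz).
  have C1 : 0 < C + 1 by rewrite ltr_wpDl.
  have e2 : 0 < Num.min e1 (e / (C + 1)) by rewrite lt_min e10 divr_gt0.
  rewrite /= near_withinE; apply: filterS (near_cabs z e2) => w; rewrite le_min => /andP[h1 h2] _.
  have e3 : (z : R[i]) + (w - z) = w by rewrite addrC subrK.
  have h3 := H (w - z) h1; rewrite e3 in h3; apply: (le_trans h3).
  exact: le_trans (ler_wpM2l C0 h2) (mul_frac_le C0 (ltW e0)).
have k0 : 0 <= (cos eta)^-1 by rewrite invr_ge0 ltW // cos_gt0_pihalf //; have := pi_gt0 R; lra.
have [dl dl0 hdl] := mehler_cone_cvg0 W f k0 e0.
rewrite /= near_withinE; apply: filterS (near_cabs 0 dl0) => w hw hs; rewrite subr0 in hw.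
suff : rnorm (mehler_ext w f - f) <= e by rewrite -{2}(mehler_ext0 f).
case: hs => [hs|->].
  by rewrite mehler_extE ?sRe //; apply: hdl => //; exact: sector_in_cone.
by rewrite mehler_ext0 subrr rnorm0 ltW.
Qed.

Lemma weyl_semigroup_analytic : extends_to_analytic_semigroup (pi / 2) P.
Proof.
exists mehler_ext; split.
- split.
  + move=> z /sector_Re_gt0 z0; have [kappa k0 hk] := in_cone_self z0.
    have [M M1 hM] := mehler_cone_bound W k0; split.
      by move=> c f g; rewrite !mehler_extE //; exact: (mehler_lin W z0).
    by exists M => f; rewrite ler_rnormC mehler_extE //; exact: hM.
  + exact: mehler_ext0.
  + move=> z w f /sector_Re_gt0 z0 /sector_Re_gt0 w0.
    have zw0 : 0 < complex.Re (z + w).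
      by move: z0 w0; case: (z) => ? ?; case: (w) => ? ? /=; exact: addr_gt0.
    by rewrite (mehler_extE _ z0) (mehler_extE _ w0) (mehler_extE _ zw0); exact: (mehlerD W f z0 w0).
  + by move=> f z /sector_Re_gt0 /(mehler_ext_dq f)[y]; exact: dq_derivable.
- move=> t f; rewrite le_eqVlt => /predU1P[<-|t0]; first by rewrite weyl_semigroup0 rmorph0 mehler_ext0.
  by rewrite weyl_semigroup_mehler // mehler_extE.
- move=> eta heta; split; last by move=> f; exact: mehler_ext_within.
  have /andP[eta0 eta1] := heta.
  have k0 : 0 <= (cos eta)^-1 by rewrite invr_ge0 ltW // cos_gt0_pihalf //; have := pi_gt0 R; lra.
  have [M M1 hM] := mehler_cone_bound W k0; exists M => z f hz; rewrite ler_rnormC.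
  rewrite mehler_extE; first exact: hM (sector_in_cone heta hz).
  exact: sector_Re_gt0 (sector_sub (ltW eta1) hz).
Qed.

End weyl_semigroup_properties.

Theorem theorem5p2 (R : realType) (X : completeNormedModType R[i]) (d : nat)
    (A B : 'I_d -> set (X * X)) (EA EB : 'I_d -> R -> X -> X) :
  weyl_pair A B EA EB ->
  let P := weyl_semigroup EA EB in
  let L := op_opp (generator P) in
  let D := op_dom (op_sum_sqr A) `&` op_dom (op_sum_sqr B) in
  [/\ bounded_C0_semigroup P,
      [/\ dense D,
          is_core D (op_opp L)
        & op_restrict L D =
            op_add (op_scale 2^-1 (op_add (op_sum_sqr A) (op_sum_sqr B)))
                   (op_scale (- (2^-1 * d%:R)) op_id)]
    & extends_to_analytic_semigroup (pi / 2) P].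
Proof.
move=> W P L D; split; first exact: weyl_semigroup_C0 W.
  split; first exact: sum_sqr_dom_dense W.
    by rewrite /L op_oppK; exact: sum_sqr_dom_core W.
  exact: generator_opp_restrict W.
exact: weyl_semigroup_analytic W.
Qed.
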